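(* Consider the following six properties of an arbitrary weight $w$ on the unit disc $\mathbb{D}$: $w\in B_1$; $w\in B_p$ ($1<p<\infty$); $w\in B_\infty$; $w\in RH$ (reverse Hölder property); $w\in RJ$ (reverse Jensen property); $w\in AC$ (almost constant on top halves). The truth or falsity of every pairwise implication between these properties is as follows. (i) The following implications are true: $B_1\subset\bigcap_{1<p<\infty}B_p$; $\bigcup_{1<p<\infty}B_p\subset RJ$; $RJ\subset B_\infty$; $RH\subset B_\infty$. (ii) Each of the following holds (false implications): - $B_1\not\subset RH$; - $RH\not\subset RJ$; - $RJ\cap RH\not\subset\bigcup_{1<p<\infty}B_p$; - $B_1\cap RH\not\subset AC$; - $RH\cap\bigcap_{1<p<\infty}B_p\not\subset B_1$; - $AC\cap B_\infty\not\subset B_1$; - $AC\not\subset B_\infty$. Consequently the only true implications between two distinct properties among the six are those in (i) and those obtained from (i) by transitivity.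
   Context: $\mathbb{D}=\{z\in\mathbb{C}:|z|<1\}$ carries normalized area measure and $\mathbb{T}=\{|z|=1\}$ carries normalized arc length measure; $|\cdot|$ denotes these measures. $I\subset\mathbb{T}$ always means that $I$ is an interval (arc) of $\mathbb{T}$ of positive length, possibly all of $\mathbb{T}$. The Carleson square of $I$ is $Q_I=\{z\in\mathbb{D}\setminus\{0\}: z/|z|\in I,\ 1-|z|<|I|\}$ and its top half is $T_I=\{z\in\mathbb{D}\setminus\{0\}: z/|z|\in I,\ |I|/2<1-|z|<|I|\}$. For measurable $f$ on $\mathbb{D}$, $Mf(z)=\sup_{I\subset\mathbb{T}:\,z\in Q_I}\frac{1}{|Q_I|}\int_{Q_I}|f|$. A weight on $\mathbb{D}$ is a measurable $w:\mathbb{D}\to[0,\infty]$ with $0<w<\infty$ a.e. For an integrable weight $w$ (the classes $B_1,B_p,RJ,RH,B_\infty$ consist of integrable weights only; a non-integrable weight belongs to none of them): - $w\in B_1$ if there is $C>0$ with $\frac1{|Q_I|}\int_{Q_I}w\le C\operatorname{ess\,inf}_{Q_I}w$ for all $I\subset\mathbb{T}$. - $w\in B_p$ ($1<p<\infty$) if there is $C>0$ with $\left(\frac1{|Q_I|}\int_{Q_I}w\right)\left(\frac1{|Q_I|}\int_{Q_I}w^{1-p'}\right)^{p-1}\le C$ for all $I\subset\mathbb{T}$, where $p'=p/(p-1)$. - $w\in RJ$ if there is $C>0$ with $\frac1{|Q_I|}\int_{Q_I}w\le C\exp\left(\frac1{|Q_I|}\int_{Q_I}\log w\right)$ for all $I\subset\mathbb{T}$.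 - $w\in RH$ if there are $1<q<\infty$ and $C>0$ with $\left(\frac1{|Q_I|}\int_{Q_I}w^q\right)^{1/q}\le\frac{C}{|Q_I|}\int_{Q_I}w$ for all $I\subset\mathbb{T}$. - $w\in B_\infty$ if there is $C>0$ with $\int_{Q_I}M(w1_{Q_I})\le C\int_{Q_I}w$ for all $I\subset\mathbb{T}$. A (not necessarily integrable) weight $w$ is in $AC$ if there is $C\ge1$ with $\operatorname{ess\,sup}_{T_I}w\le C\operatorname{ess\,inf}_{T_I}w$ for all $I\subset\mathbb{T}$. In the last sentence of the claim, ''$B_p$'' as one of the six properties may be read as $B_p$ for a fixed $p\in(1,\infty)$, or as $\bigcup_{1<p<\infty}B_p$, or as $\bigcap_{1<p<\infty}B_p$. *)

(* Defs.v *)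
From HB Require Import structures.
From Stdlib Require Export Relation_Operators.
From mathcomp Require Export all_boot all_order all_algebra.
From mathcomp Require Export all_classical all_reals all_analysis.
From mathcomp Require Export measurable_realfun ess_sup_inf.

Set Implicit Arguments.
Unset Strict Implicit.
Unset Printing Implicit Defensive.

Import Order.TTheory GRing.Theory Num.Theory.
Import numFieldNormedType.Exports.

Local Open Scope classical_set_scope.
Local Open Scope ring_scope.
Local Open Scope ereal_scope.

(* The complex plane is R * R.  To get Lebesgue (not only Borel) measurable
   functions, area is built from the Caratheodory completion of the product
   measure, as completed_lebesgue_measure is in dimension one. *)
Definition borel_area (R : realType) :
    {measure set (measurableTypeR R * measurableTypeR R) -> \bar R} :=
  (@lebesgue_measure R \x @lebesgue_measure R).

Definition plane (R : realType) : measurableType _ :=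
  caratheodory_type (mu_ext (@borel_area R)).

Lemma pi_inv_ge0 (R : realType) : (0 <= (pi : R)^-1)%R.
Proof. by rewrite invr_ge0 pi_ge0. Qed.

(* Normalized so that the unit disc has measure 1. *)
Definition area (R : realType) : {measure set (plane R) -> \bar R} :=
  mscale (NngNum (pi_inv_ge0 R))
    (@completed_measure_extension _ _ R (@borel_area R)).

Section weights.
Context {R : realType}.
Implicit Types (z : plane R) (I A : set (plane R)) (w f : plane R -> \bar R).

(* The library norm on R * R is the sup norm, hence this explicit modulus. *)
Definition modulus z : R := Num.sqrt (z.1 ^+ 2 + z.2 ^+ 2).

Definition disc : set (plane R) := [set z | (modulus z < 1)%R].

Definition direction z : plane R := (z.1 / modulus z, z.2 / modulus z)%R.

Definition expi (t : R) : plane R := (cos t, sin t).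

Definition arclen A : R :=
  (fine (lebesgue_measure (`[0%R, 2 * pi[ `&` expi @^-1` A)) / (2 * pi))%R.

(* J may be longer than 2 * pi, in which case I is the whole circle. *)
Definition is_arc I :=
  (exists J : interval R, I = expi @` [set` J]) /\ (0 < arclen I)%R.

Definition carleson I : set (plane R) :=
  [set z | [/\ disc z, z <> (0, 0)%R, I (direction z)
             & (1 - modulus z < arclen I)%R]].

Definition top_half I : set (plane R) :=
  [set z | [/\ disc z, z <> (0, 0)%R, I (direction z)
             & (arclen I / 2 < 1 - modulus z < arclen I)%R]].

Definition avg I f : \bar R :=
  (fine (area R (carleson I)))^-1%:E * \int[area R]_(z in carleson I) f z.

(* No Carleson square contains 0, so the value there (sup of the empty set) is
   irrelevant. *)
Definition maximal f z : \bar R :=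
  ereal_sup [set avg I (fun u => `|f u|)
            | I in [set I | is_arc I /\ carleson I z]].

Definition ess_sup_on A f := ess_sup (area R) (patch (cst -oo) A f).
Definition ess_inf_on A f := ess_inf (area R) (patch (cst +oo) A f).

(* Functions are total; only their values on the disc matter. *)
Definition weight w :=
  [/\ measurable_fun disc w,
      (forall z, disc z -> 0 <= w z)
    & {ae area R, forall z, disc z -> 0 < w z < +oo}].

Definition integrable_weight w := weight w /\ (area R).-integrable disc w.

Definition B1 : set (plane R -> \bar R) :=
  [set w | integrable_weight w /\
    exists2 C : R, (0 < C)%R & forall I, is_arc I ->
      avg I w <= C%:E * ess_inf_on (carleson I) w].

(* poweR at 0 and +oo with a negative exponent departs from the usual
   convention, but a weight takes these values only on a null set. *)
Definition Bp (p : R) : set (plane R -> \bar R) :=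
  [set w | integrable_weight w /\
    exists2 C : R, (0 < C)%R & forall I, is_arc I ->
      let p' := (p / (p - 1))%R in
      avg I w * poweR (avg I (fun z => poweR (w z) (1 - p')%R)) (p - 1)%R
        <= C%:E].

Definition RJ : set (plane R -> \bar R) :=
  [set w | integrable_weight w /\
    exists2 C : R, (0 < C)%R & forall I, is_arc I ->
      avg I w <= C%:E * expeR (avg I (fun z => lne (w z)))].

Definition RH : set (plane R -> \bar R) :=
  [set w | integrable_weight w /\
    exists2 q : R, (1 < q)%R & exists2 C : R, (0 < C)%R &
      forall I, is_arc I ->
        poweR (avg I (fun z => poweR (w z) q)) q^-1%R <= C%:E * avg I w].

Definition Binfty : set (plane R -> \bar R) :=
  [set w | integrable_weight w /\
    exists2 C : R, (0 < C)%R & forall I, is_arc I ->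
      \int[area R]_(z in carleson I) maximal (w \_ (carleson I)) z
        <= C%:E * \int[area R]_(z in carleson I) w z].

Definition AC : set (plane R -> \bar R) :=
  [set w | weight w /\
    exists2 C : R, (1 <= C)%R & forall I, is_arc I ->
      ess_sup_on (top_half I) w <= C%:E * ess_inf_on (top_half I) w].

Definition bigcap_Bp : set (plane R -> \bar R) :=
  \bigcap_(p in [set p : R | (1 < p)%R]) Bp p.

Definition bigcup_Bp : set (plane R -> \bar R) :=
  \bigcup_(p in [set p : R | (1 < p)%R]) Bp p.

(* The possible meanings of B_p when it is counted as a single property. *)
Definition Bp_reading (X : set (plane R -> \bar R)) :=
  [\/ exists2 p : R, (1 < p)%R & X = Bp p, X = bigcup_Bp | X = bigcap_Bp].

End weights.

Inductive property := prop_B1 | prop_Bp | prop_Binfty | prop_RH | prop_RJ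
  | prop_AC.

Definition class_of (R : realType) (X : set (plane R -> \bar R)) (P : property) :
    set (plane R -> \bar R) :=
  match P with
  | prop_B1 => B1
  | prop_Bp => X
  | prop_Binfty => Binfty
  | prop_RH => RH
  | prop_RJ => RJ
  | prop_AC => AC
  end.

Inductive basic_implication : property -> property -> Prop :=
  | B1_Bp : basic_implication prop_B1 prop_Bp
  | Bp_RJ : basic_implication prop_Bp prop_RJ
  | RJ_Binfty : basic_implication prop_RJ prop_Binfty
  | RH_Binfty : basic_implication prop_RH prop_Binfty.

(* Main.v *)
Require Import Defs.
From mathcomp Require Import ring lra zify.

(** The true inclusions hinge on the condition called half_jensen below: the mean of a
    weight w over each Carleson square is at most a constant times the square of the
    mean of sqrt w.

    - RJ implies it, because exp (mean of log w) is the square of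
      exp (mean of log (sqrt w)), hence at most the square of the mean of sqrt w.
    - RH implies it, because reverse Hoelder forces a fixed fraction of the mass of w
      to lie where w is at most a multiple of its mean A, and there w is at most a
      multiple of sqrt A * sqrt w.
    - It implies B_infty (half_jensen_Binfty): the averages of w are controlled by the
      squares of those of f := sqrt w, so the maximal function of w is controlled by the
      square of the maximal function of f, and the L^2 maximal inequality gives back
      the integral of f^2 = w.

    The last step needs care since B_infty involves w restricted to Q_I, for which
    half_jensen fails on the squares that meet Q_I without being contained in it.  Large
    squares are handled by the mean of w over Q_I.  Small ones are contained in Q_J for
    an arc J slightly longer than I, and Q_J carries at most a multiple of the mass of
    Q_I (half_jensen_doubling): if w had almost all its mass on the small set Q_J \ Q_I,
    then Cauchy-Schwarz would make the mean of sqrt w over Q_J too small.  The L^2 bound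
    comes from dyadic Carleson squares: a small Carleson square is contained in a
    comparable dyadic one of the standard grid or of the grid shifted by a third of the
    circle (carleson_in_cell), and the dyadic maximal function is bounded by induction
    on generations (dyadic_max_L2).  The inclusion of B_1 in B_p is immediate, that of
    B_p in RJ is Jensen's inequality.

    The geometry reduces to the area of angular sectors of annuli.  No polar coordinates
    are used: the area of a sector is additive in the opening, because rotations are
    products of shears and so preserve area, and it is quadratic in the radius.

    Five counterexamples are radial step weights, equal to g n where
    2^-(n+1) < |z| <= 2^-n.  The origin is an interior point of the disc, so Carleson
    squares of arcs of at most half the circle only see the value g 0, and averages over
    the others are at most a multiple of the sum of g n * 4^-n.  Every condition becomes
    one on the sequence g:

    - g n = n + 1            is in B_1 and RH, and not in AC;
    - g n = 4^n / (n + 1)^2  is in B_1, and its powers above 1 are not integrable;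
    - g n = exp (- n 4^n)    is in RH, and its logarithm is not integrable;
    - g n = exp (- 2^n)      is in RJ and RH, and its negative powers are not integrable;
    - g n = 1 / (n + 1)      is in RH and in every B_p, and it tends to 0 at the origin.

    The two examples in AC are powers of the distance to the circle: 1 - |z| vanishes
    on the circle, and (1 - |z|)^-2 is not integrable. *)

Set Implicit Arguments.
Unset Strict Implicit.
Unset Printing Implicit Defensive.

Import Order.TTheory GRing.Theory Num.Theory.
Import numFieldNormedType.Exports.

Local Open Scope classical_set_scope.
Local Open Scope ring_scope.

(** * Invariance of planar Lebesgue measure *)

Section lebesgue_affine.
Context {R : realType}.
Local Notation mu := (@lebesgue_measure R).

Lemma lebesgue_measure_shift (t : R) (A : set (measurableTypeR R)) :
  measurable A -> mu ((fun x => x + t) @^-1` A) = mu A.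
Proof.
pose f : measurableTypeR R -> measurableTypeR R := fun x => x + t.
have mf : measurable_fun setT f by exact: measurable_funD.
move=> mA; apply/esym.
apply: (@lebesgue_measure_unique R (pushforward mu f)) => //= _ [[a b]] _ <-.
rewrite /pushforward /f /=.
rewrite (_ : _ @^-1` _ = `]a - t, b - t]%classic); last first.
  by apply/seteqP; split => x /=; rewrite !in_itv/=; lra.
rewrite !lebesgue_measure_itv/= !lte_fin ltrD2r.
by case: ifPn => // _; rewrite -!EFinB; congr EFin; lra.
Qed.

Lemma lebesgue_measure_scale (r : R) (A : set (measurableTypeR R)) : 0 < r ->
  measurable A -> (r%:E * mu ((fun x : R => r * x)%R @^-1` A) = mu A)%E.
Proof.
move=> r0.
pose f : measurableTypeR R -> measurableTypeR R := fun x => r * x.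
have mf : measurable_fun setT f by exact: measurable_funM.
move=> mA; apply/esym.
apply: (@lebesgue_measure_unique R (mscale (NngNum (ltW r0)) (pushforward mu f))) => //= _ [[a b]] _ <-.
rewrite /mscale/= /pushforward /f /=.
rewrite (_ : _ @^-1` _ = `](r^-1 * a), (r^-1 * b)]%classic); last first.
  apply/seteqP; split => x /=; rewrite !in_itv/=.
    by move=> /andP[? ?]; rewrite ltr_pdivrMl// ler_pdivlMl//; apply/andP.
  by move=> /andP[]; rewrite ltr_pdivrMl// ler_pdivlMl// => *; apply/andP.
rewrite !lebesgue_measure_itv/= !lte_fin ltr_pM2l ?invr_gt0//.
case: ifPn => // _; last by rewrite mule0.
rewrite -!EFinB -EFinM; congr EFin; rewrite mulrBr !mulrA mulfV ?gt_eqF// !mul1r//.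
Qed.

End lebesgue_affine.

Section planar.
Context {R : realType}.
Local Notation mu := (@lebesgue_measure R).
Local Notation R2 := (measurableTypeR R * measurableTypeR R)%type.
Local Notation m2 := (@borel_area R).

Lemma borel_area_swap (A : set R2) : measurable A ->
  m2 ((fun z : R2 => (z.2, z.1) : R2) @^-1` A) = m2 A.
Proof.
move=> mA.
pose f : R2 -> R2 := fun z => (z.2, z.1).
have mf : measurable_fun setT f by exact: measurable_fun_pair.
apply/esym.
apply: (@product_measure_unique _ _ _ _ _ mu mu (pushforward m2 f)) => //= X Y mX mY.
rewrite /pushforward /f.
rewrite (_ : _ @^-1` _ = Y `*` X); last first.
  by apply/seteqP; split => -[a b]/= [].
by rewrite muleC; exact: product_measure1E.
Qed.

(** Shears translate each vertical line, so Fubini reduces this to translation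
    invariance in dimension one. *)
Lemma borel_area_shear2 (k : R) (A : set R2) : measurable A ->
  m2 ((fun z : R2 => (z.1, z.2 + k * z.1) : R2) @^-1` A) = m2 A.
Proof.
move=> mA; apply: eq_integral => x _ /=.
rewrite -[RHS](lebesgue_measure_shift (k * x)); last exact: measurable_xsection.
apply: (congr1 (fun B : set R => mu B)); apply/seteqP; split => y; rewrite /xsection/= !inE//.
Qed.

Lemma measurable_shear2 (k : R) :
  measurable_fun setT (fun z : R2 => (z.1, z.2 + k * z.1) : R2).
Proof.
apply: measurable_fun_pair => //; apply: measurable_funD => //.
by apply: measurable_funM.
Qed.

Lemma measurable_shear1 (k : R) :
  measurable_fun setT (fun z : R2 => (z.1 + k * z.2, z.2) : R2).
Proof.
apply: measurable_fun_pair => //; apply: measurable_funD => //.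
by apply: measurable_funM.
Qed.

Lemma measurable_preimage d d' (T : measurableType d) (T' : measurableType d')
    (f : T -> T') (A : set T') :
  measurable_fun setT f -> measurable A -> measurable (f @^-1` A).
Proof. by move=> mf mA; rewrite -[_ @^-1` _]setTI; exact: mf. Qed.

Lemma borel_area_shear1 (k : R) (A : set R2) : measurable A ->
  m2 ((fun z : R2 => (z.1 + k * z.2, z.2) : R2) @^-1` A) = m2 A.
Proof.
move=> mA.
have msw : measurable_fun setT (fun z : R2 => (z.2, z.1) : R2).
  exact: measurable_fun_pair.
have mA' : measurable ((fun z : R2 => (z.2, z.1) : R2) @^-1` A).
  exact: measurable_preimage.
rewrite -(borel_area_swap mA) -(borel_area_shear2 k mA') -borel_area_swap//.
apply: measurable_preimage => //; exact: measurable_shear1.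
Qed.

Definition rotation (c s : R) (z : R2) : R2 :=
  (c * z.1 - s * z.2, s * z.1 + c * z.2).

Lemma measurable_rot c s : measurable_fun setT (rotation c s).
Proof.
apply: measurable_fun_pair.
  by apply: measurable_funB; apply: measurable_funM.
by apply: measurable_funD; apply: measurable_funM.
Qed.

(** A rotation by an angle other than pi is the product of three shears. *)
Lemma borel_area_rot0 (c s : R) (A : set R2) : c ^+ 2 + s ^+ 2 = 1 -> c != -1 ->
  measurable A -> m2 (rotation c s @^-1` A) = m2 A.
Proof.
move=> cs c1 mA.
have c1' : 1 + c != 0 by rewrite addrC; apply: contra c1; rewrite addr_eq0.
(* minus the tangent of half the angle *)
pose t := - (s / (1 + c)).
have mB := measurable_preimage (measurable_shear1 t) mA.
have mC := measurable_preimage (measurable_shear2 s) mB.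
have ts : s * t = c - 1.
  have : s ^+ 2 = (1 - c) * (1 + c) by lra.
  rewrite /t mulrN mulrA -expr2 => ->; rewrite mulfK//; ring.
have tc : t * (1 + c) = - s by rewrite /t mulNr divfK.
rewrite -(borel_area_shear1 t mA) -(borel_area_shear2 s mB).
rewrite -(borel_area_shear1 t mC).
pose f1 (z : R2) : R2 := (z.1 + t * z.2, z.2).
pose f2 (z : R2) : R2 := (z.1, z.2 + s * z.1).
have F z : rotation c s z = f1 (f2 (f1 z)).
  case: z => x y; rewrite /rotation /f1 /f2 /=; congr pair.
    transitivity ((1 + s * t) * x + (2 * t + (s * t) * t) * y); last by ring.
    rewrite ts (_ : 2 * t + (c - 1) * t = t * (1 + c)); last by ring.
    by rewrite tc; ring.
  transitivity (s * x + (1 + s * t) * y); last by ring.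
  rewrite ts; ring.
suff -> : rotation c s @^-1` A = f1 @^-1` (f2 @^-1` (f1 @^-1` A)) by [].
by apply/seteqP; split => z; rewrite /preimage/= F.
Qed.

(** The half turn, which is not a product of three shears, is the square of a
    quarter turn. *)
Lemma borel_area_rot (a : R) (A : set R2) :
  measurable A -> m2 (rotation (cos a) (sin a) @^-1` A) = m2 A.
Proof.
move=> mA; have [c1|c1] := eqVneq (cos a) (-1); last first.
  by apply: borel_area_rot0 => //; exact: cos2Dsin2.
have s0 : sin a = 0 by apply: cos1sin0; rewrite c1 normrN1.
have E0 : 0 ^+ 2 + 1 ^+ 2 = 1 :> R by rewrite expr0n expr1n add0r.
have N0 : 0 != -1 :> R by rewrite eq_sym oppr_eq0 oner_eq0.
have mB := measurable_preimage (measurable_rot 0 1) mA.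
rewrite -(borel_area_rot0 E0 N0 mA) -(borel_area_rot0 E0 N0 mB).
have F z : rotation (cos a) (sin a) z = rotation 0 1 (rotation 0 1 z).
  by case: z => x y; rewrite /rotation c1 s0 /=; congr pair; ring.
suff -> : rotation (cos a) (sin a) @^-1` A = rotation 0 1 @^-1` (rotation 0 1 @^-1` A) by [].
by apply/seteqP; split => z; rewrite /preimage/= F.
Qed.

Lemma borel_area_dilate (r : R) (A : set R2) : 0 < r -> measurable A ->
  ((r ^+ 2)%:E * m2 ((fun z : R2 => (r * z.1, r * z.2)%R : R2) @^-1` A) = m2 A)%E.
Proof.
move=> r0 mA.
pose f : R2 -> R2 := fun z => (r * z.1, r * z.2).
have mf : measurable_fun setT f.
  by apply: measurable_fun_pair; apply: measurable_funM.
have rr0 : 0 <= r ^+ 2 by rewrite exprn_ge0// ltW.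
apply/esym.
apply: (@product_measure_unique _ _ _ _ _ mu mu (mscale (NngNum rr0) (pushforward m2 f))) => //= X Y mX mY.
rewrite /mscale/= /pushforward /f.
rewrite (_ : _ @^-1` _ = ((fun x => r * x) @^-1` X) `*` ((fun x => r * x) @^-1` Y)); last first.
  by apply/seteqP; split => -[a b]/= [].
have mr : measurable_fun setT (fun x : measurableTypeR R => r * x : measurableTypeR R).
  exact: measurable_funM.
rewrite -(lebesgue_measure_scale r0 mX) -(lebesgue_measure_scale r0 mY).
rewrite [X in (_ * X)%E](product_measure1E mu mu); [|exact: measurable_preimage..].
by rewrite expr2 EFinM -!muleA; congr (_ * _)%E; rewrite muleCA.
Qed.

End planar.

(** * Polar angle and sectors *)

Section angle.
Context {R : realType}.
Local Notation R2 := (measurableTypeR R * measurableTypeR R)%type.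
Local Notation m2 := (@borel_area R).
Implicit Types (z : R2) (a l r s t : R).

Lemma modulus_ge0 z : 0 <= modulus z.
Proof. exact: sqrtr_ge0. Qed.

Lemma sqr_modulus z : modulus z ^+ 2 = z.1 ^+ 2 + z.2 ^+ 2.
Proof. by rewrite sqr_sqrtr// addr_ge0// sqr_ge0. Qed.

Lemma modulus_eq0 z : (modulus z = 0) <-> z = (0, 0).
Proof.
split => [h|->]; last by rewrite /modulus expr0n addr0 sqrtr0.
have := sqr_modulus z; rewrite h expr0n/= => /esym/eqP.
rewrite paddr_eq0 ?sqr_ge0// !sqrf_eq0; case: z {h} => x y/=.
by case/andP => /eqP -> /eqP ->.
Qed.

Lemma modulus_gt0 z : (0 < modulus z) <-> z <> (0, 0).
Proof.
split => [h /modulus_eq0 E|h]; first by rewrite E ltxx in h.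
rewrite lt_neqAle modulus_ge0 andbT eq_sym; apply/eqP => /modulus_eq0//.
Qed.

Lemma measurable_modulus : measurable_fun setT (@modulus R : R2 -> R).
Proof.
rewrite (_ : (@modulus R : R2 -> R) =
    (fun z : R2 => powR (z.1 ^+ 2 + z.2 ^+ 2) 2^-1)).
  have h : measurable_fun setT (fun z : R2 => z.1 ^+ 2 + z.2 ^+ 2 : R).
    by apply: measurable_funD; apply: measurable_funX.
  exact: (measurableT_comp (measurable_powR (2^-1)) h).
by apply/funext => z; rewrite /modulus powR12_sqrt// addr_ge0// sqr_ge0.
Qed.

Lemma measurable_acos : measurable_fun (`[(-1 : R), 1]%classic : set R) (@acos R : R -> R).
Proof.
apply: (@measurable_fun_itv_cc R (-1) 1 false true).
apply: open_continuous_measurable_fun; first exact: interval_open.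
move=> x; rewrite inE/= in_itv/= => x1; exact: continuous_acos.
Qed.

(** Cosine determines the angle up to sign, and the sign of the ordinate selects the
    value in [0, 2 pi[. *)
Definition arg z : R :=
  if 0 <= z.2 then acos (z.1 / modulus z) else 2 * pi - acos (z.1 / modulus z).

Lemma measurable_cosine : measurable_fun setT (fun z : R2 => z.1 / modulus z : R).
Proof.
rewrite (_ : (fun _ => _) =
    (fun z : R2 => z.1 * powR (modulus z) (-1))); last first.
  by apply/funext => z; rewrite powR_inv1// modulus_ge0.
apply: measurable_funM => //.
exact: (measurableT_comp (measurable_powR (-1)) measurable_modulus).
Qed.

Lemma cosine_bound z : -1 <= z.1 / modulus z <= 1.
Proof.
have [E|z0] := eqVneq (modulus z) 0; first by rewrite E invr0 mulr0; lra.
have zp : 0 < modulus z by rewrite lt_neqAle eq_sym z0 modulus_ge0.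
rewrite -ler_norml normrM normfV (gtr0_norm zp) ler_pdivrMr// mul1r.
rewrite -sqrtr_sqr ler_wsqrtr// lerDl sqr_ge0//.
Qed.

Lemma measurable_arg : measurable_fun setT arg.
Proof.
have mac : measurable_fun setT (fun z : R2 => acos (z.1 / modulus z) : R).
  apply: (@measurable_comp _ _ _ _ _ _ (`[(-1 : R), 1]%classic : set R)) => //.
  - move=> _ [z _ <-] /=; rewrite in_itv/=; exact: cosine_bound.
  - exact: measurable_acos.
  - exact: measurable_cosine.
apply: measurable_fun_ifT => //.
  by apply: measurable_fun_ler.
by apply: measurable_funB.
Qed.

Lemma sine_sqr z : modulus z != 0 ->
  1 - (z.1 / modulus z) ^+ 2 = (z.2 / modulus z) ^+ 2.
Proof.
move=> z0; have := sqr_modulus z; rewrite !expr_div_n.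
move=> E; have -> : z.2 ^+ 2 = modulus z ^+ 2 - z.1 ^+ 2 by lra.
by rewrite mulrBl divff// expf_neq0.
Qed.

Lemma expi_arg z : z <> (0, 0) -> expi (arg z) = direction z.
Proof.
move=> /modulus_gt0 zp; have z0 : modulus z != 0 by rewrite gt_eqF.
have cb := cosine_bound z.
have ca : cos (acos (z.1 / modulus z)) = z.1 / modulus z.
  by rewrite acosK// in_itv.
have sa : sin (acos (z.1 / modulus z)) = `|z.2| / modulus z.
  rewrite sin_acos// sine_sqr// sqrtr_sqr normrM normfV (gtr0_norm zp)//.
rewrite /expi /direction /arg; case: ifPn => [z2|].
  by rewrite ca sa ger0_norm.
rewrite -ltNge => z2.
have -> : 2 * pi - acos (z.1 / modulus z) = - acos (z.1 / modulus z) + pi *+ 2.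
  by rewrite mulr_natl addrC.
rewrite cosD2pi sinD2pi cosN sinN ca sa ltr0_norm//.
by rewrite mulNr opprK.
Qed.

Lemma arg_bound z : 0 <= arg z < 2 * pi.
Proof.
have cb := cosine_bound z; have p0 := @pi_gt0 R.
have a0 := acos_ge0 cb; have a1 := acos_lepi cb.
rewrite /arg; case: ifPn => [_|]; first by apply/andP; split => //; lra.
rewrite -ltNge => z2; apply/andP; split; first by lra.
suff : 0 < acos (z.1 / modulus z) by lra.
apply: acos_gt0; case/andP : cb => -> cb/=; rewrite lt_neqAle cb andbT.
have zp : modulus z != 0.
  by apply/eqP => /modulus_eq0 E; move: z2; rewrite E ltxx.
apply/eqP => E; have := sine_sqr zp; rewrite E expr1n subrr => /esym/eqP.
by rewrite sqrf_eq0 mulf_eq0 invr_eq0 (negbTE zp) orbF lt_eqF.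
Qed.

Lemma expi_inj b s t : b <= s < b + 2 * pi -> b <= t < b + 2 * pi ->
  expi s = expi t -> s = t.
Proof.
wlog st : s t / s <= t => [h hs ht E|].
  by have [st|/ltW st] := leP s t; [exact: h|apply/esym/h].
move=> hs ht [Ec Es].
have c1 : cos (t - s) = 1 by rewrite cosB Ec Es -!expr2 cos2Dsin2.
have [d|d] := leP (t - s) pi.
  have : t - s = 0; last by lra.
  apply: (@cos_inj R); rewrite ?in_itv/= ?cos0// ?lexx ?pi_ge0//.
  by apply/andP; split => //; lra.
exfalso.
have c2 : cos (2 * pi - (t - s)) = 1.
  transitivity (cos (t - s)) => //; rewrite (_ : 2 * pi - (t - s) = - (t - s) + pi *+ 2).
    by rewrite cosD2pi cosN.
  by rewrite mulr_natl addrC.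
have : 2 * pi - (t - s) = 0; last by lra.
apply: (@cos_inj R); rewrite ?in_itv/= ?cos0// ?lexx ?pi_ge0//.
apply/andP; split => //; lra.
Qed.

Lemma expi_period (t : R) : expi (t + 2 * pi) = expi t.
Proof. by rewrite /expi mulr_natl cosD2pi sinD2pi. Qed.

(** The angle of z measured from the direction a, again in [0, 2 pi[.  Letting a vary
    keeps arcs that cross the positive real axis within one chart. *)
Definition ang a z : R := arg (rotation (cos (- a)) (sin (- a)) z).

Lemma ang_bound a z : 0 <= ang a z < 2 * pi.
Proof. exact: arg_bound. Qed.

Lemma measurable_ang a : measurable_fun setT (ang a).
Proof. apply: measurableT_comp; [exact: measurable_arg|exact: measurable_rot]. Qed.

Lemma modulus_rot a z : modulus (rotation (cos a) (sin a) z) = modulus z.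
Proof.
rewrite /modulus /rotation/=; congr Num.sqrt.
transitivity ((cos a ^+ 2 + sin a ^+ 2) * (z.1 ^+ 2 + z.2 ^+ 2)); first ring.
by rewrite cos2Dsin2 mul1r.
Qed.

Lemma expi_ang a z : z <> (0, 0) -> expi (a + ang a z) = direction z.
Proof.
move=> z0; rewrite /ang.
set u := rotation _ _ z.
have u0 : u <> (0, 0).
  by apply/modulus_gt0; rewrite modulus_rot; apply/modulus_gt0.
have := expi_arg u0; rewrite /expi cosD sinD /direction modulus_rot => -[-> ->].
rewrite /u /rotation cosN sinN/=; congr pair.
  transitivity ((cos a ^+ 2 + sin a ^+ 2) * (z.1 / modulus z)); first ring.
  by rewrite cos2Dsin2 mul1r.
transitivity ((cos a ^+ 2 + sin a ^+ 2) * (z.2 / modulus z)); first ring.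
by rewrite cos2Dsin2 mul1r.
Qed.

Lemma ang_uniq a z t : z <> (0, 0) -> a <= t < a + 2 * pi ->
  direction z = expi t -> ang a z = t - a.
Proof.
move=> z0 ht zt; have ab := ang_bound a z.
suff <- : a + ang a z = t by rewrite addrC addKr.
apply: (@expi_inj a) => //; last by rewrite expi_ang.
by apply/andP; split; lra.
Qed.

(** The opening l is a fraction of the full turn, to match normalized arc length. *)
Definition sector a l r : set R2 :=
  [set z | [/\ 0 < modulus z, modulus z < r & ang a z < 2 * pi * l]].

Lemma measurable_lt_set d (T : measurableType d) (f g : T -> R) :
  measurable_fun setT f -> measurable_fun setT g ->
  measurable [set x | f x < g x].
Proof.
move=> mf mg; have := @measurable_fun_ltr _ _ _ _ _ _ mf mg measurableT [set true].
by move=> /(_ Logic.I); rewrite setTI.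
Qed.

Lemma measurable_le_set d (T : measurableType d) (f g : T -> R) :
  measurable_fun setT f -> measurable_fun setT g ->
  measurable [set x | f x <= g x].
Proof.
move=> mf mg; have := @measurable_fun_ler _ _ _ _ _ _ mf mg measurableT [set true].
by move=> /(_ Logic.I); rewrite setTI.
Qed.

Lemma measurable_sector a l r : measurable (sector a l r).
Proof.
rewrite (_ : sector a l r = [set z : R2 | 0 < modulus z] `&`
  ([set z : R2 | modulus z < r] `&` [set z : R2 | ang a z < 2 * pi * l])).
  have mm := measurable_modulus; have ma := measurable_ang a.
  by apply: measurableI; [|apply: measurableI]; exact: measurable_lt_set.
by apply/seteqP; split => z /= => [[? ? ?]|[? [? ?]]]; split.
Qed.

Lemma sector_rot a l r : m2 (sector a l r) = m2 (sector 0 l r).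
Proof.
rewrite -(borel_area_rot (- a) (measurable_sector 0 l r)).
suff -> : sector a l r = rotation (cos (- a)) (sin (- a)) @^-1` sector 0 l r by [].
have A z : ang 0 z = arg z.
  rewrite /ang oppr0 cos0 sin0 /rotation; congr arg; case: z => x y/=.
  by congr pair; ring.
apply/seteqP; split => z; rewrite /preimage /sector/= modulus_rot A;
  by case.
Qed.

Lemma dilate_modulus r z : 0 < r -> modulus ((r * z.1, r * z.2) : R2) = r * modulus z.
Proof.
move=> r0; rewrite /modulus/= !exprMn -mulrDr sqrtrM ?sqr_ge0//.
by rewrite sqrtr_sqr gtr0_norm.
Qed.

Lemma dilate_ang a r z : 0 < r -> ang a ((r * z.1, r * z.2) : R2) = ang a z.
Proof.
move=> r0; rewrite /ang /rotation/=.
set c := cos _; set s := sin _.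
rewrite (_ : c * (r * z.1) - s * (r * z.2) = r * (c * z.1 - s * z.2)); last by ring.
rewrite (_ : s * (r * z.1) + c * (r * z.2) = r * (s * z.1 + c * z.2)); last by ring.
have := @dilate_modulus r (c * z.1 - s * z.2, s * z.1 + c * z.2) r0.
rewrite /= /arg/= => ->; rewrite pmulr_rge0// invfM.
have r0' : r != 0 by rewrite gt_eqF.
set u := _ - _; set m := modulus _.
suff -> : r * u * (r^-1 / m) = u / m by [].
by rewrite mulrACA divff// mul1r.
Qed.

Lemma sector_dilate a l r : 0 < r ->
  m2 (sector a l r) = ((r ^+ 2)%:E * m2 (sector a l 1))%E.
Proof.
move=> r0; rewrite -(borel_area_dilate r0 (measurable_sector a l r)).
suff -> : (fun z : R2 => (r * z.1, r * z.2) : R2) @^-1` sector a l r = sector a l 1 by [].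
apply/seteqP; split => z; rewrite /preimage /sector/= dilate_modulus// dilate_ang//;
  by rewrite pmulr_rgt0// -{2}(mulr1 r) ltr_pM2l.
Qed.

Lemma sector_add l l' : 0 <= l -> 0 <= l' -> l + l' <= 1 ->
  m2 (sector 0 (l + l') 1) = (m2 (sector 0 l 1) + m2 (sector 0 l' 1))%E.
Proof.
move=> l0 l0' ll'; have p0 := @pi_gt0 R.
have pl : 0 <= pi * l by rewrite mulr_ge0// ltW.
have pl' : 0 <= pi * l' by rewrite mulr_ge0// ltW.
have pll : pi * l + pi * l' <= pi by rewrite -mulrDr ler_piMr// ltW.
rewrite -(sector_rot (2 * pi * l) l') -measureU; last 3 first.
- exact: measurable_sector.
- exact: measurable_sector.
- apply/seteqP; split => z //= -[[z0 _ h] [_ _ h']].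
  have z0' := z0; move/modulus_gt0 : z0' => z0'.
  have /andP[b0 b1] := ang_bound (2 * pi * l) z.
  have : ang 0 z = (2 * pi * l + ang (2 * pi * l) z) - 0.
    apply: ang_uniq => //; last by rewrite expi_ang.
    by apply/andP; split; lra.
  by lra.
set X := (Y in _ = m2 Y).
suff -> : sector 0 (l + l') 1 = X by [].
apply/seteqP; split => z.
- move=> [z0 z1 h]; have z0' := z0; move/modulus_gt0 : z0' => z0'.
  have /andP[b0 b1] := ang_bound 0 z.
  have [h'|h'] := ltP (ang 0 z) (2 * pi * l); [left|right]; split => //.
  have -> : ang (2 * pi * l) z = (0 + ang 0 z) - 2 * pi * l.
    apply: ang_uniq => //; last by rewrite expi_ang.
    by apply/andP; split; lra.
  by lra.
- case=> -[z0 z1 h]; split => //; first by lra.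
  have z0' := z0; move/modulus_gt0 : z0' => z0'.
  have /andP[b0 b1] := ang_bound (2 * pi * l) z.
  have -> : ang 0 z = (2 * pi * l + ang (2 * pi * l) z) - 0.
    apply: ang_uniq => //; last by rewrite expi_ang.
    by apply/andP; split; lra.
  by lra.
Qed.

End angle.

(** * Area of sectors *)

(** Cauchy's functional equation on [0, 1]: nonnegativity makes f monotone, and
    a monotone function that is linear on the rationals is linear. *)
Lemma additive_nonneg_linear (R : realType) (f : R -> R) :
  (forall x y, 0 <= x -> 0 <= y -> x + y <= 1 -> f (x + y) = f x + f y) ->
  (forall x, 0 <= x <= 1 -> 0 <= f x) ->
  forall x, 0 <= x <= 1 -> f x = x * f 1.
Proof.
move=> fD f0.
have f1 : 0 <= f 1 by apply: f0; lra.
have mono x y : 0 <= x -> x <= y -> y <= 1 -> f x <= f y.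
  move=> x0 xy y1; rewrite -(subrK x y) addrC fD ?lerDl; [|lra..].
  apply: f0; lra.
have fz : f 0 = 0 by have := fD 0 0; rewrite addr0 => /(_ _ _ _); lra.
have fmul n x : 0 <= x -> n%:R * x <= 1 -> f (n%:R * x) = n%:R * f x.
  move=> x0; elim: n => [|n IH]; first by rewrite !mul0r.
  rewrite -natr1 !mulrDl !mul1r => h.
  have nx : 0 <= n%:R * x by rewrite mulr_ge0.
  by rewrite fD// IH//; lra.
have frat (k n : nat) : (k <= n.+1)%N -> f (k%:R / n.+1%:R) = k%:R / n.+1%:R * f 1.
  move=> kn; have n0 : (0 : R) < n.+1%:R by rewrite ltr0n.
  have e1 : f 1 = n.+1%:R * f n.+1%:R^-1.
    by rewrite -fmul ?divff ?gt_eqF// ?invr_ge0 ?ltW.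
  have kn1 : k%:R / n.+1%:R <= 1 :> R by rewrite ler_pdivrMr// mul1r ler_nat.
  have ni : (0 : R) <= n.+1%:R^-1 by rewrite invr_ge0 ltW.
  by rewrite fmul// e1 mulrA divfK// gt_eqF.
move=> x /andP[x0 x1].
have [->|xn1] := eqVneq x 1; first by rewrite mul1r.
have {xn1}x1 : x < 1 by rewrite lt_neqAle xn1.
apply/eqP; rewrite -subr_eq0 -normr_le0; apply/ler_addgt0Pr => e e0; rewrite add0r.
pose n := Num.truncn (f 1 / e).
have n0 : (0 : R) < n.+1%:R by rewrite ltr0n.
have ne : f 1 / n.+1%:R <= e.
  rewrite ler_pdivrMr// mulrC -ler_pdivrMr// ltW//.
  by rewrite truncnS_gt// divr_ge0// ltW.
pose k := Num.truncn (x * n.+1%:R).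
have xn : 0 <= x * n.+1%:R by rewrite mulr_ge0// ltW.
have k1 : k%:R <= x * n.+1%:R by rewrite truncn_le.
have k2 : x * n.+1%:R < k.+1%:R by rewrite truncnS_gt.
have kn : (k < n.+1)%N.
  rewrite -(ltr_nat R); apply: (le_lt_trans k1).
  by rewrite -{2}(mul1r n.+1%:R) ltr_pM2r.
have l1 : k%:R / n.+1%:R <= x by rewrite ler_pdivrMr.
have l2 : x <= k.+1%:R / n.+1%:R by rewrite ler_pdivlMr// ltW.
have m1 : k%:R / n.+1%:R * f 1 <= f x.
  rewrite -frat; last exact: ltnW.
  by apply: mono => //; exact: ltW.
have m2 : f x <= k.+1%:R / n.+1%:R * f 1.
  rewrite -frat//; apply: mono => //.
  by rewrite ler_pdivrMr// mul1r ler_nat.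
have S : k.+1%:R / n.+1%:R * f 1 = k%:R / n.+1%:R * f 1 + f 1 / n.+1%:R.
  by rewrite -natr1; ring.
have L1 := ler_wpM2r f1 l1; have L2 := ler_wpM2r f1 l2.
move: S ne L1 L2 m1 m2.
move: (k.+1%:R / n.+1%:R * f 1) (k%:R / n.+1%:R * f 1) (f 1 / n.+1%:R) (x * f 1).
move=> A B D E S ne L1 L2 m1 m2.
by rewrite ler_norml; apply/andP; split; lra.
Qed.

Section area_of_sectors.
Context {R : realType}.
Local Notation R2 := (measurableTypeR R * measurableTypeR R)%type.
Local Notation m2 := (@borel_area R).
Local Notation mu := (@area R).
Implicit Types (z : R2) (a l r s t : R).

Lemma measurable_plane (A : set R2) : measurable A -> measurable (A : set (plane R)).
Proof.
move=> mA; apply: (@sub_caratheodory _ _ _ (@borel_area R)).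
exact: sub_sigma_algebra.
Qed.

Lemma area_borel (A : set R2) : measurable A -> mu A = ((pi^-1)%:E * m2 A)%E.
Proof.
move=> mA; rewrite /area /mscale/=; congr (_ * _)%E.
exact: (measurable_mu_extE m2 mA).
Qed.

Lemma measurable_fun_plane d (T : measurableType d) (f : R2 -> T) :
  measurable_fun setT f -> measurable_fun setT (f : plane R -> T).
Proof. by move=> mf _ B mB; apply: measurable_plane; apply: mf. Qed.

Lemma area_setD (A B : set (plane R)) : measurable A -> measurable B ->
  B `<=` A -> (mu A < +oo)%E -> mu (A `\` B) = (mu A - mu B)%E.
Proof. by move=> mA mB BA Aoo; rewrite measureD// setIidr. Qed.

Lemma area_sector_rot a l r : mu (sector a l r) = mu (sector 0 l r).
Proof.
have m := @measurable_sector R.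
by rewrite (area_borel (m a l r)) (area_borel (m 0 l r)) sector_rot.
Qed.

Lemma area_sector_dilate a l r : 0 < r ->
  mu (sector a l r) = ((r ^+ 2)%:E * mu (sector a l 1))%E.
Proof.
move=> r0; have m := @measurable_sector R.
by rewrite (area_borel (m a l r)) (area_borel (m a l 1)) (sector_dilate _ _ r0) muleCA.
Qed.

Lemma area_sector_add l l' : 0 <= l -> 0 <= l' -> l + l' <= 1 ->
  mu (sector 0 (l + l') 1) = (mu (sector 0 l 1) + mu (sector 0 l' 1))%E.
Proof.
move=> l0 l0' ll'; have m := @measurable_sector R.
rewrite (area_borel (m 0 l 1)) (area_borel (m 0 l' 1)) (area_borel (m 0 (l + l') 1)).
by rewrite sector_add// ge0_muleDr.
Qed.

Lemma modulus_ge_coord z : `|z.1| <= modulus z /\ `|z.2| <= modulus z.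
Proof.
by split; rewrite -sqrtr_sqr ler_wsqrtr// ?lerDl ?lerDr sqr_ge0.
Qed.

Lemma borel_area_rect (X Y : set (measurableTypeR R)) :
  measurable X -> measurable Y ->
  m2 (X `*` Y) = (lebesgue_measure X * lebesgue_measure Y)%E.
Proof. by move=> mX mY; exact: product_measure1E. Qed.

Lemma area_sector_fin l : mu (sector 0 l 1) \is a fin_num.
Proof.
have m := @measurable_sector R 0 l 1.
rewrite area_borel// fin_numM//.
rewrite ge0_fin_numE//.
pose Q : set R2 := `[(-1 : R), 1]%classic `*` `[(-1 : R), 1]%classic.
have mQ : measurable Q by apply: measurableX; exact: measurable_itv.
apply: (@le_lt_trans _ _ (m2 Q)).
  apply: le_measure; rewrite ?inE//.
  move=> z [_ z1 _]; have [h1 h2] := modulus_ge_coord z.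
  split; rewrite /= in_itv/= -ler_norml; apply/ltW; exact: le_lt_trans z1.
rewrite borel_area_rect; [|exact: measurable_itv..].
by rewrite !lebesgue_measure_itv/= !lte_fin; case: ifP => _; rewrite ?mul0e// -EFinB -EFinM ltry.
Qed.

(** The mass of the disc is kept as a symbol, which cancels in all averages. *)
Definition disc_area : R := fine (mu (sector 0 1 1)).

Lemma disc_area_gt0 : 0 < disc_area.
Proof.
apply: fine_gt0; apply/andP; split; last first.
  by have := area_sector_fin 1; rewrite ge0_fin_numE.
rewrite area_borel; last exact: measurable_sector.
rewrite mule_gt0// ?lte_fin ?invr_gt0 ?pi_gt0//.
pose Q : set R2 := `[(4^-1 : R), 2^-1]%classic `*` `[(4^-1 : R), 2^-1]%classic.
have mQ : measurable Q by apply: measurableX; exact: measurable_itv.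
apply: (@lt_le_trans _ _ (m2 Q)).
  rewrite borel_area_rect; [|exact: measurable_itv..].
  rewrite !lebesgue_measure_itv/= !lte_fin.
  rewrite ifT; last by lra.
  by rewrite -EFinB -EFinM lte_fin; nra.
apply: le_measure; rewrite ?inE//; first exact: measurable_sector.
move=> z [/=]; rewrite !in_itv/= => /andP[a1 a2] /andP[b1 b2].
split.
- apply/modulus_gt0 => E; move: a1; rewrite E/=; lra.
- rewrite -(@ltr_pXn2r _ 2)// ?nnegrE ?modulus_ge0// sqr_modulus expr1n.
  nra.
- by rewrite mulr1; case/andP : (ang_bound 0 z).
Qed.

Lemma area_sector a l r : 0 <= l <= 1 -> 0 <= r ->
  mu (sector a l r) = (disc_area * l * r ^+ 2)%:E.
Proof.
move=> l01; rewrite le_eqVlt => /predU1P[<-|r0].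
  rewrite expr0n mulr0 (_ : sector a l 0 = set0) ?measure0//.
  by apply/seteqP; split => z //= -[]; lra.
rewrite area_sector_rot area_sector_dilate//.
rewrite -(fineK (area_sector_fin l)).
rewrite (@additive_nonneg_linear R (fun l => fine (mu (sector 0 l 1))))//=.
- by rewrite -EFinM; congr EFin; rewrite /disc_area; ring.
- by move=> x y x0 y0 xy; rewrite area_sector_add// fineD// area_sector_fin.
- by move=> x _; exact/fine_ge0.
Qed.

(** The circle lies in annuli of arbitrarily small width. *)
Lemma area_circle_null r : 0 <= r -> mu [set z | 0 < modulus z /\ modulus z = r] = 0%E.
Proof.
move=> r0; have K0 := disc_area_gt0.
have mm := @measurable_modulus R.
have mC : measurable [set z : R2 | 0 < modulus z /\ modulus z = r].
  apply: measurableI; first exact: measurable_lt_set.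
  exact: (@measurable_preimage _ _ R2 R (@modulus R) [set r]).
apply/eqP; rewrite eq_le measure_ge0 andbT; apply/lee_addgt0Pr => e e0; rewrite add0e.
have e1 : e / (disc_area * (2 * r + 1)) > 0 by rewrite divr_gt0// mulr_gt0//; lra.
pose d := Num.min 1 (e / (disc_area * (2 * r + 1))).
have d0 : 0 < d by rewrite lt_min e1 ltr01.
have d1 : d <= 1 by rewrite /d ge_min lexx.
have d2 : disc_area * (2 * r + 1) * d <= e.
  by rewrite mulrC -ler_pdivlMr ?mulr_gt0//; [rewrite /d ge_min lexx orbT|lra].
apply: (@le_trans _ _ (mu (sector 0 1 (r + d) `\` sector 0 1 r))).
  apply: le_measure; rewrite ?inE; [exact: measurable_plane| |].
    by apply: measurableD; apply: measurable_plane; exact: measurable_sector.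
  move=> z [z0 zr]; split => /=.
    by split; [|lra|rewrite mulr1; case/andP : (ang_bound 0 z)].
  by case=> _; rewrite zr ltxx.
rewrite area_setD; last 4 first.
- by apply: measurable_plane; exact: measurable_sector.
- by apply: measurable_plane; exact: measurable_sector.
- by move=> z [? ? ?]; split => //; lra.
- by rewrite area_sector ?ltry//; lra.
rewrite !area_sector; [|lra..].
rewrite -EFinB lee_fin; apply: le_trans d2.
have : d * d <= d by rewrite ler_piMr// ltW.
by move=> /(ler_wpM2l (ltW K0)); nra.
Qed.

(** The ray lies in sectors of arbitrarily small opening; truncation at radius 2
    keeps the areas finite. *)
Lemma area_ray_null a t : mu [set z | [/\ 0 < modulus z, modulus z < 2 & ang a z = t]] = 0%E.
Proof.
have K0 := disc_area_gt0; have p0 := @pi_gt0 R.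
have mm := @measurable_modulus R; have ma := @measurable_ang R a.
have mC : measurable [set z : R2 | [/\ 0 < modulus z, modulus z < 2 & ang a z = t]].
  rewrite (_ : [set z | _] = [set z : R2 | 0 < modulus z] `&`
    ([set z : R2 | modulus z < 2] `&` ang a @^-1` [set t])).
    apply: measurableI; first exact: measurable_lt_set.
    apply: measurableI; first exact: measurable_lt_set.
    exact: (@measurable_preimage _ _ R2 R (ang a) [set t]).
  by apply/seteqP; split => z /= => [[? ? ?]|[? [? ?]]].
have [/andP[t0 t1]|tN] := boolP (0 <= t < 2 * pi); last first.
  rewrite (_ : [set z | _] = set0) ?measure0//; apply/seteqP; split => z //= -[_ _ E].
  by move: tN; rewrite -E ang_bound.
pose l := t / (2 * pi).
have tl : 2 * pi * l = t by rewrite /l mulrC divfK//; lra.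
have l0 : 0 <= l by rewrite divr_ge0//; lra.
have l1 : l < 1 by rewrite ltr_pdivrMr//; lra.
apply/eqP; rewrite eq_le measure_ge0 andbT; apply/lee_addgt0Pr => e e0; rewrite add0e.
have e1 : e / (4 * disc_area) > 0 by rewrite divr_gt0//; lra.
pose d := Num.min (1 - l) (e / (4 * disc_area)).
have d0 : 0 < d by rewrite lt_min e1 andbT; lra.
have d1 : d <= 1 - l by rewrite /d ge_min lexx.
have d2 : 4 * disc_area * d <= e.
  by rewrite mulrC -ler_pdivlMr; [rewrite /d ge_min lexx orbT|lra].
apply: (@le_trans _ _ (mu (sector a (l + d) 2 `\` sector a l 2))).
  apply: le_measure; rewrite ?inE; [exact: measurable_plane| |].
    by apply: measurableD; apply: measurable_plane; exact: measurable_sector.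
  move=> z [z0 z2 zr]; split => /=.
    split => //; rewrite zr mulrDr tl; have : 0 < pi * d by rewrite mulr_gt0.
    by lra.
  by case=> _ _; rewrite zr tl ltxx.
rewrite area_setD; last 4 first.
- by apply: measurable_plane; exact: measurable_sector.
- by apply: measurable_plane; exact: measurable_sector.
- move=> z [? ? ?]; split => //; rewrite mulrDr.
  have : 0 < pi * d by rewrite mulr_gt0.
  by lra.
- by rewrite area_sector ?ltry//; lra.
rewrite !area_sector; [|lra..].
rewrite -EFinB lee_fin; apply: le_trans d2; nra.
Qed.

(** Sectors of annuli occur with all kinds of boundary conventions.  Since circles and
    rays are null sets, it suffices to know a set between its interior and closure. *)
Lemma area_sandwich a l r1 r2 (A : set R2) : 0 <= l <= 1 -> 0 <= r1 -> r1 <= r2 -> r2 <= 1 ->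
  measurable (A : set (plane R)) ->
  (forall z, 0 < modulus z -> r1 < modulus z -> modulus z < r2 ->
     0 < ang a z -> ang a z < 2 * pi * l -> A z) ->
  (forall z, A z -> [/\ 0 < modulus z, r1 <= modulus z, modulus z <= r2 &
     ang a z <= 2 * pi * l]) ->
  mu A = (disc_area * l * (r2 ^+ 2 - r1 ^+ 2))%:E.
Proof.
move=> /andP[l0 l1] r10 r12 r21 mA lo hi.
have r22 : r2 < 2 by lra.
have r20 : 0 <= r2 by lra.
have ms r : measurable (sector a l r : set (plane R)).
  by apply: measurable_plane; exact: measurable_sector.
pose N1 : set (plane R) := [set z | 0 < modulus z /\ modulus z = r1].
pose N2 : set (plane R) := [set z | 0 < modulus z /\ modulus z = r2].
pose N3 : set (plane R) := [set z | [/\ 0 < modulus z, modulus z < 2 & ang a z = 0]].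
pose N4 : set (plane R) := [set z | [/\ 0 < modulus z, modulus z < 2 & ang a z = 2 * pi * l]].
have mm : measurable_fun setT (@modulus R : plane R -> R).
  by apply: measurable_fun_plane; exact: measurable_modulus.
have ma : measurable_fun setT (ang a : plane R -> R).
  by apply: measurable_fun_plane; exact: measurable_ang.
have mcirc r : measurable ([set z | 0 < modulus z /\ modulus z = r] : set (plane R)).
  apply: measurableI; first exact: measurable_lt_set.
  exact: (@measurable_preimage _ _ (plane R) R (@modulus R) [set r]).
have mray t : measurable ([set z | [/\ 0 < modulus z, modulus z < 2 & ang a z = t]] : set (plane R)).
  rewrite (_ : [set z | _] = [set z : plane R | 0 < modulus z] `&`
    ([set z : plane R | modulus z < 2] `&` ang a @^-1` [set t])).
    apply: measurableI; first exact: measurable_lt_set.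
    apply: measurableI; first exact: measurable_lt_set.
    exact: (@measurable_preimage _ _ (plane R) R (ang a) [set t]).
  by apply/seteqP; split => z /= => [[? ? ?]|[? [? ?]]].
have mN1 : measurable N1 := mcirc r1.
have mN2 : measurable N2 := mcirc r2.
have mN3 : measurable N3 := mray 0.
have mN4 : measurable N4 := mray (2 * pi * l).
have z1 : mu N1 = 0%E by exact: area_circle_null.
have z2 : mu N2 = 0%E by exact: area_circle_null.
have z3 : mu N3 = 0%E by exact: area_ray_null.
have z4 : mu N4 = 0%E by exact: area_ray_null.
have mN : measurable (N1 `|` N2 `|` N3 `|` N4) by repeat apply: measurableU => //.
have null : mu (N1 `|` N2 `|` N3 `|` N4) = 0%E.
  have h1 : mu (N1 `|` N2) = 0%E by rewrite (measureU0 mN1 mN2 z2).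
  have m12 := measurableU _ _ mN1 mN2.
  have h2 : mu (N1 `|` N2 `|` N3) = 0%E by rewrite (measureU0 m12 mN3 z3).
  by rewrite (measureU0 (measurableU _ _ m12 mN3) mN4 z4).
clear z1 z2 z3 z4.
pose S : set (plane R) := sector a l r2 `\` sector a l r1.
have mS : measurable S by exact: measurableD.
have -> : mu A = mu S.
  rewrite -(@measureU0 _ _ _ mu A _ mA mN null) -(@measureU0 _ _ _ mu S _ mS mN null).
  congr (mu _); apply/seteqP; split => z [Az|]; try by right.
  - have [z0 z1 z2 z3] := hi _ Az.
    have [E|ne2] := eqVneq (modulus z) r2; first by right; left; left; right.
    have [E|ne4] := eqVneq (ang a z) (2 * pi * l).
      by right; right; split => //; exact: le_lt_trans r22.
    left; split => /=.
      by split => //; rewrite lt_neqAle ?ne2 ?ne4.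
    by case=> _; rewrite ltNge z1.
  - case: Az => -[z0 z1 z2] h.
    have [E|ne1] := eqVneq (modulus z) r1; first by right; left; left; left.
    have [E|ne3] := eqVneq (ang a z) 0.
      by right; left; right; split => //; exact: lt_trans r22.
    left; apply: lo => //.
      rewrite lt_neqAle eq_sym ne1/= leNgt; apply/negP => zr; exact: h.
    by rewrite lt_neqAle eq_sym ne3/=; case/andP : (ang_bound a z).
rewrite area_setD//; last 2 first.
- by move=> z [? h ?]; split => //; exact: lt_le_trans r12.
- by rewrite area_sector ?ltry// ?l0 ?l1.
rewrite !area_sector ?l0 ?l1//.
by rewrite -EFinB; congr EFin; ring.
Qed.

End area_of_sectors.

(** * Arcs, Carleson squares and their areas *)

Section arcs.
Context {R : realType}.
Local Notation R2 := (measurableTypeR R * measurableTypeR R)%type.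
Local Notation mu := (@area R).
Local Notation leb := (@lebesgue_measure R).
Implicit Types (z : plane R) (I : set (plane R)) (a l s t : R).

Lemma expi_periodn t (n : nat) : expi (t + 2 * pi * n%:R) = expi t.
Proof.
elim: n => [|n IH]; first by rewrite mulr0 addr0.
by rewrite -(natr1 n) mulrDr mulr1 addrA expi_period.
Qed.

Lemma expi_reduce a t : exists2 s, a <= s < a + 2 * pi &
  exists n : nat, t = s + 2 * pi * n%:R \/ s = t + 2 * pi * n%:R.
Proof.
have p0 := @pi_gt0 R; have pp : 0 < 2 * pi :> R by lra.
pose n := Num.floor ((t - a) / (2 * pi)).
have h1 : n%:~R <= (t - a) / (2 * pi) by exact: floor_le.
have h2 : (t - a) / (2 * pi) < n%:~R + 1.
  by have := floorD1_gt ((t - a) / (2 * pi)); rewrite intrD.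
rewrite ler_pdivlMr// in h1; rewrite ltr_pdivrMr// in h2.
exists (t - n%:~R * (2 * pi)); first by apply/andP; split; lra.
case: n h1 h2 => n _ _; first by exists n; left; rewrite -pmulrn; ring.
by exists n.+1; right; rewrite NegzE mulrNz -pmulrn; ring.
Qed.

Lemma expi_reduce_eq a t : exists2 s, a <= s < a + 2 * pi & expi s = expi t.
Proof.
have [s sa [n [E|E]]] := expi_reduce a t; exists s => //;
  by rewrite E expi_periodn.
Qed.

Definition args I : set R := `[0, 2 * pi[%classic `&` expi @^-1` I.

(** The image of an interval under the covering map t |-> (cos t, sin t) lifts to
    countably many translates of that interval. *)
Lemma measurable_args (J : interval R) : measurable (args (expi @` [set` J])).
Proof.
have E : args (expi @` [set` J]) = `[0, 2 * pi[%classic `&`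
   (\bigcup_(n : nat) ((fun t => t + 2 * pi * n%:R) @^-1` [set` J]) `|`
    \bigcup_(n : nat) ((fun t => t - 2 * pi * n%:R) @^-1` [set` J])).
  apply/seteqP; split => [t [t0 [s Js st]]|t [t0 ts]]; split => //.
    have [u us [n un]] := expi_reduce 0 s.
    have ut : u = t.
      apply: (@expi_inj _ 0) => //.
        by move: t0; rewrite /= in_itv/= add0r.
      rewrite -st; case: un => ->; rewrite expi_periodn//.
    rewrite -ut; case: un => un.
      by left; exists n => //=; rewrite -un.
    by right; exists n => //=; rewrite un addrK.
  case: ts => -[n _ /= Jn].
    by exists (t + 2 * pi * n%:R) => //; rewrite expi_periodn.
  exists (t - 2 * pi * n%:R) => //.
  by rewrite -(expi_periodn (t - 2 * pi * n%:R) n) subrK.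
rewrite E; apply: measurableI; first exact: measurable_itv.
apply: measurableU; apply: bigcup_measurable => n _.
  apply: (@measurable_preimage _ _ R R); last exact: measurable_itv.
  exact: measurable_funD.
apply: (@measurable_preimage _ _ R R); last exact: measurable_itv.
exact: measurable_funD.
Qed.

Lemma args_half_open0 a l : 0 <= a < 2 * pi -> 0 <= l <= 1 ->
  leb (args (expi @` `[a, a + 2 * pi * l[%classic)) = (2 * pi * l)%:E.
Proof.
move=> /andP[a0 a1] /andP[l0 l1]; have p0 := @pi_gt0 R.
have pl : 0 <= pi * l by rewrite mulr_ge0// ltW.
have pl1 : pi * l <= pi by rewrite ler_piMr// ltW.
have [h|h] := leP (a + 2 * pi * l) (2 * pi).
  have -> : args (expi @` `[a, a + 2 * pi * l[%classic) = `[a, a + 2 * pi * l[%classic.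
    apply/seteqP; split => [t [/= t0 [s]]|t /=]; rewrite !in_itv/=.
      move=> /andP[as0 s1] st; suff <- : s = t by rewrite as0.
      apply: (@expi_inj _ 0) => //; first by apply/andP; split; lra.
      by move: t0; rewrite in_itv/= add0r.
    move=> /andP[at0 t1]; split; first by rewrite /= in_itv/=; apply/andP; split; lra.
    by exists t => //=; rewrite in_itv/= at0.
  rewrite lebesgue_measure_itv/= lte_fin; case: ifPn => h'.
    by rewrite -EFinB; congr EFin; lra.
  by congr EFin; rewrite -leNgt in h'; lra.
have -> : args (expi @` `[a, a + 2 * pi * l[%classic) =
    `[a, 2 * pi[%classic `|` `[0, a + 2 * pi * l - 2 * pi[%classic.
  apply/seteqP; split => [t [/= t0 [s]]|t /= [|]]; rewrite !in_itv/=.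
  - move=> /andP[as0 s1] st; rewrite in_itv/= in t0.
    have [s2|s2] := ltP s (2 * pi).
      left; suff <- : s = t by rewrite as0.
      by apply: (@expi_inj _ 0) => //; apply/andP; split; lra.
    right; suff <- : s - 2 * pi = t by apply/andP; split; lra.
    apply: (@expi_inj _ 0); [by apply/andP; split; lra..|].
    by rewrite -st -(expi_period (s - 2 * pi)) subrK.
  - move=> /andP[at0 t1]; split; first by rewrite /= in_itv/=; apply/andP; split; lra.
    by exists t => //=; rewrite in_itv/=; apply/andP; split; lra.
  - move=> /andP[at0 t1]; split; first by rewrite /= in_itv/=; apply/andP; split; lra.
    exists (t + 2 * pi); last exact: expi_period.
    by rewrite /= in_itv/=; apply/andP; split; lra.
rewrite measureU; [|exact: measurable_itv|exact: measurable_itv|].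
  have := lebesgue_measure_itv (`[a, 2 * pi[) => /= ->.
  have := lebesgue_measure_itv (`[0, a + 2 * pi * l - 2 * pi[) => /= ->.
  rewrite !lte_fin a1 ifT; last lra.
  by rewrite -!EFinB -EFinD; congr EFin; lra.
apply/seteqP; split => t //=; rewrite !in_itv/= => -[/andP[? ?] /andP[? ?]]; lra.
Qed.

Lemma args_half_open a l : 0 <= l <= 1 ->
  leb (args (expi @` `[a, a + 2 * pi * l[%classic)) = (2 * pi * l)%:E.
Proof.
move=> l01; have [b b02 [n nb]] := expi_reduce 0 a.
rewrite add0r in b02; rewrite -(args_half_open0 b02 l01).
suff -> : expi @` `[a, a + 2 * pi * l[%classic = expi @` `[b, b + 2 * pi * l[%classic by [].
case: nb => nb; apply/seteqP; split => _ [t /= tI <-];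
  move: tI; rewrite in_itv/= => /andP[t0 t1].
- exists (t - 2 * pi * n%:R); first by rewrite /= in_itv/=; apply/andP; split; lra.
  by rewrite -(expi_periodn (t - 2 * pi * n%:R) n) subrK.
- exists (t + 2 * pi * n%:R); first by rewrite /= in_itv/=; apply/andP; split; lra.
  by rewrite expi_periodn.
- exists (t + 2 * pi * n%:R); first by rewrite /= in_itv/=; apply/andP; split; lra.
  by rewrite expi_periodn.
- exists (t - 2 * pi * n%:R); first by rewrite /= in_itv/=; apply/andP; split; lra.
  by rewrite -(expi_periodn (t - 2 * pi * n%:R) n) subrK.
Qed.

(** An arc can be open, closed or half-open; only its interior and closure matter
    for the areas. *)
Definition arc_between a l I :=
  expi @` `]a, a + 2 * pi * l[%classic `<=` I /\
  I `<=` expi @` `[a, a + 2 * pi * l]%classic.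

(** Half-open arcs of opening slightly smaller and slightly larger than l squeeze I. *)
Lemma arclen_between a l I : 0 <= l <= 1 -> measurable (args I) ->
  arc_between a l I -> arclen I = l.
Proof.
move=> /andP[l0 l1] mI [lo hi]; have p0 := @pi_gt0 R.
have pp : 0 < 2 * pi :> R by lra.
have mono (x y : set R) : measurable x -> measurable y -> x `<=` y -> (leb x <= leb y)%E.
  by move=> mx my xy; apply: le_measure; rewrite ?inE.
have ub : (leb (args I) <= (2 * pi)%:E)%E.
  have <- : leb `[0, 2 * pi[%classic = (2 * pi)%:E.
    by rewrite lebesgue_measure_itv/= lte_fin pp -EFinB subr0.
  by apply: mono => // t [].
have fin : leb (args I) \is a fin_num.
  by rewrite ge0_fin_numE//; apply: le_lt_trans ub _; exact: ltry.
rewrite /arclen -/(args I).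
move: ub; rewrite -(fineK fin) lee_fin => ub.
suff -> : fine (leb (args I)) = 2 * pi * l by rewrite mulrC mulKf// gt_eqF.
apply/eqP; rewrite eq_le; apply/andP; split; last first.
  apply/ler_addgt0Pr => e e0.
  have [el|el] := leP (2 * pi * l) e.
    by apply: (le_trans el); rewrite lerDr; exact: fine_ge0.
  pose d := e / (2 * pi); have d0 : 0 < d by rewrite divr_gt0.
  have de : 2 * pi * d = e by rewrite /d mulrC divfK// gt_eqF.
  have dl : d <= l by rewrite ler_pdivrMr// mulrC ltW.
  rewrite -lerBlDr -lee_fin fineK// (_ : _ - e = 2 * pi * (l - d)); last by rewrite mulrBr de.
  rewrite -(@args_half_open (a + 2 * pi * d)); last by lra.
  apply: mono => //; first exact: measurable_args.
  apply: setIS; apply: preimage_subset; apply: subset_trans lo; apply: image_subset.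
  move=> t; rewrite /= !in_itv/= mulrBr => /andP[t0 t1]; apply/andP; split; lra.
apply/ler_addgt0Pr => e e0.
have [el|el] := leP (2 * pi * (1 - l)) e; first lra.
pose d := e / (2 * pi); have d0 : 0 < d by rewrite divr_gt0.
have de : 2 * pi * d = e by rewrite /d mulrC divfK// gt_eqF.
have dl : d <= 1 - l by rewrite ler_pdivrMr// mulrC ltW.
rewrite -lee_fin fineK// -{1}de -mulrDr.
rewrite -(@args_half_open a); last by lra.
apply: mono => //; first exact: measurable_args.
apply: setIS; apply: preimage_subset; apply: subset_trans hi _; apply: image_subset.
move=> t; rewrite /= !in_itv/= (mulrDr _ l d) => /andP[t0 t1]; apply/andP; split; lra.
Qed.

Lemma is_arc_args I : is_arc I -> measurable (args I).
Proof. by case=> -[J ->] _; exact: measurable_args. Qed.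

Lemma circle_covered a I : (exists J : interval R, I = expi @` [set` J]) ->
  I `<=` expi @` `[a, a + 2 * pi * 1]%classic.
Proof.
move=> [J ->] _ [t _ <-]; have [s /andP[s0 s1] <-] := expi_reduce_eq a t.
by exists s => //; rewrite /= in_itv/= s0/=; lra.
Qed.

(** Normal form of an arc: whatever the interval that parametrizes it, an arc is,
    up to endpoints, an angular interval of opening its own length. *)
Lemma is_arcP I : is_arc I ->
  0 < arclen I <= 1 /\ exists a, arc_between a (arclen I) I.
Proof.
move=> aI; have mI := is_arc_args aI; have p0 := @pi_gt0 R.
have fromI a l : 0 <= l <= 1 -> arc_between a l I ->
  0 < arclen I <= 1 /\ exists a, arc_between a (arclen I) I.
  move=> l01 h; have E := arclen_between l01 mI h.
  split; last by exists a; rewrite E.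
  by rewrite aI.2/= E; case/andP : l01.
(* Intervals of length at least 2 pi give the whole circle, up to one point. *)
have long (a : R) : expi @` `]a, a + 2 * pi[%classic `<=` I -> 
  0 < arclen I <= 1 /\ exists a, arc_between a (arclen I) I.
  move=> h; apply: (@fromI a 1); first lra.
  by split; [rewrite mulr1|exact: (circle_covered a aI.1)].
have empty : ~ (I = set0).
  move=> I0; have : arclen I = 0.
    by rewrite /arclen I0 preimage_set0 setI0 measure0 mul0r.
  by move=> E; have := aI.2; rewrite E ltxx.
have fin (x y : R) : expi @` `]x, y[%classic `<=` I -> I `<=` expi @` `[x, y]%classic ->
  0 < arclen I <= 1 /\ exists a, arc_between a (arclen I) I.
  move=> h1 h2; have [yx|xy] := ltP y x.
    exfalso; apply: empty; apply/seteqP; split => // z /h2[t /=].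
    by rewrite in_itv/= => /andP[? ?] _; lra.
  have [big|small] := leP (2 * pi) (y - x).
    apply: (@long x); apply: subset_trans h1; apply: image_subset => t/=.
    by rewrite !in_itv/=; lra.
  pose l := (y - x) / (2 * pi).
  have yl : y = x + 2 * pi * l by rewrite /l [2 * pi * _]mulrC divfK; [lra|apply/eqP; lra].
  apply: (@fromI x l); last by split; rewrite -yl.
  by rewrite /l divr_ge0//= ?ler_pdivrMr//; lra.
case: aI.1 => -[[b1 x|[]] [b2 y|[]]] EI.
- apply: (fin x y); rewrite EI; apply: image_subset => t/=; rewrite !itv_boundlr/= !bnd_simp;
    by case: (b1); case: (b2); rewrite ?bnd_simp => /andP[? ?]; apply/andP; split => //; exact: ltW.
- exfalso; apply: empty; rewrite EI; apply/seteqP; split => // z [t tJ _].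
  by move: tJ; rewrite /= itv_boundlr; case/andP.
- apply: (@long (x)); rewrite EI; apply: image_subset => t/=.
  by rewrite !itv_boundlr/= !bnd_simp => /andP[t0 t1]; case: (b1); rewrite bnd_simp ?t0// ltW.
- apply: (@long (y - 2 * pi)); rewrite EI subrK; apply: image_subset => t/=.
  by rewrite !itv_boundlr/= !bnd_simp => /andP[t0 t1]; case: (b2); rewrite bnd_simp ?t1// ltW.
- exfalso; apply: empty; rewrite EI; apply/seteqP; split => // z [t tJ _].
  by move: tJ; rewrite /= itv_boundlr; case/andP.
- by apply: (@long 0); rewrite EI; apply: image_subset.
- exfalso; apply: empty; rewrite EI; apply/seteqP; split => // z [t tJ _].
  by move: tJ; rewrite /= itv_boundlr; case/andP.
- exfalso; apply: empty; rewrite EI; apply/seteqP; split => // z [t tJ _].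
  by move: tJ; rewrite /= itv_boundlr; case/andP.
- exfalso; apply: empty; rewrite EI; apply/seteqP; split => // z [t tJ _].
  by move: tJ; rewrite /= itv_boundlr; case/andP.
Qed.

Definition closed_arc a l : set (plane R) := expi @` `[a, a + 2 * pi * l]%classic.

Lemma arclen_closed_arc a l : 0 <= l <= 1 -> arclen (closed_arc a l) = l.
Proof.
move=> l01; apply: (@arclen_between a) => //; first exact: measurable_args.
by split => //; apply: image_subset => t /=; rewrite !in_itv/= => /andP[/ltW-> /ltW->].
Qed.

Lemma is_arc_closed_arc a l : 0 < l <= 1 -> is_arc (closed_arc a l).
Proof.
move=> /andP[l0 l1]; split; first by exists `[a, a + 2 * pi * l].
by rewrite arclen_closed_arc ?l1 ?ltW.
Qed.

Lemma closed_arc_direction a l z : 0 <= l <= 1 -> z <> (0, 0) ->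
  closed_arc a l (direction z) <-> ang a z <= 2 * pi * l.
Proof.
move=> /andP[l0 l1] z0; have p0 := @pi_gt0 R; have /andP[b0 b1] := ang_bound a z.
split => [[t]|h].
  rewrite /= in_itv/= => /andP[t0 t1] tz.
  have [t2|t2] := ltP t (a + 2 * pi).
    by rewrite (@ang_uniq _ a z t)// ?t0//; lra.
  have : 2 * pi <= 2 * pi * l by lra.
  by apply: le_trans; exact: ltW.
exists (a + ang a z); last exact: expi_ang.
by rewrite /= in_itv/=; lra.
Qed.

Lemma arc_direction_lo a l I z : arc_between a l I -> z <> (0, 0) ->
  0 < ang a z -> ang a z < 2 * pi * l -> I (direction z).
Proof.
move=> [lo _] z0 h1 h2; apply: lo; exists (a + ang a z); last exact: expi_ang.
by rewrite /= in_itv/=; lra.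
Qed.

Lemma arc_direction_hi a l I z : 0 <= l <= 1 -> arc_between a l I -> z <> (0, 0) ->
  I (direction z) -> ang a z <= 2 * pi * l.
Proof. by move=> l01 [_ hi] z0 /hi h; apply/(closed_arc_direction a l01 z0). Qed.

Lemma measurable_modulus_plane : measurable_fun setT (@modulus R).
Proof. by apply: measurable_fun_plane; exact: measurable_modulus. Qed.

Lemma measurable_direction I : is_arc I ->
  measurable [set z : plane R | z <> (0, 0) /\ I (direction z)].
Proof.
move=> aI.
rewrite (_ : [set z | _] = [set z : plane R | 0 < modulus z] `&` arg @^-1` (args I)).
  apply: measurableI.
    apply: (@measurable_lt_set _ _ (plane R) (cst 0) (@modulus R)); first exact: measurable_cst.
    exact: measurable_modulus_plane.
  apply: measurable_preimage; last exact: is_arc_args.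
  by apply: measurable_fun_plane; exact: measurable_arg.
apply/seteqP; split => z /=.
  move=> [z0 Iz]; split; first exact/modulus_gt0.
  by split; rewrite /= ?in_itv/= ?arg_bound// expi_arg.
by move=> [/modulus_gt0 z0 [_]] /=; rewrite expi_arg.
Qed.

Lemma measurable_carleson I : is_arc I -> measurable (carleson I).
Proof.
move=> aI; rewrite (_ : carleson I = [set z : plane R | z <> (0, 0) /\ I (direction z)] `&`
  ([set z : plane R | modulus z < 1] `&` [set z : plane R | 1 - modulus z < arclen I])).
  have mm := measurable_modulus_plane.
  apply: measurableI; first exact: measurable_direction.
  apply: measurableI; first exact: measurable_lt_set.
  apply: (@measurable_lt_set _ _ (plane R) (fun z => 1 - modulus z)); last exact: measurable_cst.
  exact: (measurable_funB (measurable_cst _) mm).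
by apply/seteqP; split => z /= => [[? ? ? ?]|[[? ?] [? ?]]].
Qed.

Lemma measurable_top_half I : is_arc I -> measurable (top_half I).
Proof.
move=> aI; rewrite (_ : top_half I = [set z : plane R | z <> (0, 0) /\ I (direction z)] `&`
  ([set z : plane R | modulus z < 1] `&` ([set z : plane R | 1 - modulus z < arclen I] `&`
   [set z : plane R | arclen I / 2 < 1 - modulus z]))).
  have mm := measurable_modulus_plane.
  have mb : measurable_fun setT (fun z : plane R => 1 - modulus z) by exact: measurable_funB.
  apply: measurableI; first exact: measurable_direction.
  by repeat apply: measurableI => //; exact: measurable_lt_set.
by apply/seteqP; split => z /= => [[? ? ? /andP[? ?]]|[[? ?] [? [? ?]]]]; split => //; apply/andP.
Qed.

Lemma measurable_disc : measurable (@disc R).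
Proof.
apply: (@measurable_lt_set _ _ (plane R) (@modulus R) (cst 1)); last exact: measurable_cst.
exact: measurable_modulus_plane.
Qed.

Lemma area_carleson I : is_arc I ->
  mu (carleson I) = (disc_area * (arclen I ^+ 2 * (2 - arclen I)))%:E.
Proof.
move=> aI; have [/andP[l0 l1] [a ab]] := is_arcP aI.
rewrite (@area_sandwich _ a (arclen I) (1 - arclen I) 1); [|lra..| | |].
- by congr EFin; ring.
- exact: measurable_carleson.
- move=> z z0 z1 z2 z3 z4; split => //; [exact/modulus_gt0| |lra].
  by apply: (arc_direction_lo ab) => //; exact/modulus_gt0.
- move=> z [dz z0 Iz h]; split; [exact/modulus_gt0|lra|exact: ltW|].
  by apply: (arc_direction_hi _ ab) => //; rewrite ltW.
Qed.

Lemma area_top_half I : is_arc I ->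
  mu (top_half I) = (disc_area * (arclen I ^+ 2 * (1 - 3 / 4 * arclen I)))%:E.
Proof.
move=> aI; have [/andP[l0 l1] [a ab]] := is_arcP aI.
rewrite (@area_sandwich _ a (arclen I) (1 - arclen I) (1 - arclen I / 2)); [|lra..| | |].
- by congr EFin; field.
- exact: measurable_top_half.
- move=> z z0 z1 z2 z3 z4; split; [|exact/modulus_gt0| |lra].
    by rewrite /disc/=; lra.
  by apply: (arc_direction_lo ab) => //; exact/modulus_gt0.
- move=> z [dz z0 Iz h]; split; [exact/modulus_gt0|lra|lra|].
  by apply: (arc_direction_hi _ ab) => //; rewrite ltW.
Qed.

End arcs.

(** * The L^2 bound for the dyadic maximal function *)

Section dyadic_maximal.
Context d (T : measurableType d) (R : realType).
Context (mu : {measure set T -> \bar R}) (Q : nat -> nat -> set T) (f : T -> R).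
Context (mQ : forall n k, measurable (Q n k)).
Context (Qfin : forall n k, (mu (Q n k) < +oo)%E).
Context (Qpos : forall n k, (0 < mu (Q n k))%E).
Context (subl : forall n k, Q n.+1 k.*2 `<=` Q n k).
Context (subr : forall n k, Q n.+1 k.*2.+1 `<=` Q n k).
Context (disj : forall n k, Q n.+1 k.*2 `&` Q n.+1 k.*2.+1 = set0).
Context (mf : measurable_fun setT f) (f0 : forall x, 0 <= f x).
Context (f2fin : (\int[mu]_x ((f x) ^+ 2)%:E < +oo)%E).

Definition cell_mean n k : R :=
  fine (\int[mu]_(x in Q n k) (f x)%:E) / fine (mu (Q n k)).

(** The dyadic maximal function of f below cell (n, k), truncated to h generations.  The
    running maximum m is an argument so that the L^2 bound can be proved by induction
    on h: descending to a child only updates m. *)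
Fixpoint dyadic_max h n k m x : R :=
  if h is h'.+1 then
    let m' := Num.max m (cell_mean n k) in
    if x \in Q n.+1 k.*2 then dyadic_max h' n.+1 k.*2 m' x
    else if x \in Q n.+1 k.*2.+1 then dyadic_max h' n.+1 k.*2.+1 m' x
    else m'
  else m.

Lemma dyadic_max_ge h n k m x : m <= dyadic_max h n k m x.
Proof.
elim: h n k m => [|h IH] n k m //=.
have mm : m <= Num.max m (cell_mean n k) by rewrite le_max lexx.
by case: ifP => _; [|case: ifP => _ //]; apply: (le_trans mm).
Qed.

Lemma dyadic_max_mono h n k m x : dyadic_max h n k m x <= dyadic_max h.+1 n k m x.
Proof.
elim: h n k m => [|h IH] n k m; first exact: (dyadic_max_ge 1).
rewrite [leRHS]/= [leLHS]/=.
by case: ifP => _; [exact: IH|case: ifP => _; [exact: IH|]].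
Qed.

Lemma measurable_mem (A : set T) : measurable A ->
  measurable_fun setT (fun x => x \in A).
Proof.
move=> mA; apply: (measurable_fun_bool true).
rewrite setTI (_ : _ @^-1` _ = A)//; apply/seteqP; split => x /=.
  by move=> /set_mem.
by move=> /mem_set ->.
Qed.

Lemma measurable_dyadic_max h n k m : measurable_fun setT (dyadic_max h n k m).
Proof.
elim: h n k m => [|h IH] n k m; first exact: measurable_cst.
by apply: measurable_fun_ifT; [exact: measurable_mem|exact: IH|
  apply: measurable_fun_ifT; [exact: measurable_mem|exact: IH|exact: measurable_cst]].
Qed.

Lemma cell_mean_ge0 n k : 0 <= cell_mean n k.
Proof.
by apply: divr_ge0; apply: fine_ge0 => //; apply: integral_ge0 => x _; rewrite lee_fin.
Qed.

Lemma cell_nested n k j : Q (n + j) k `<=` Q n (k %/ 2 ^ j).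
Proof.
elim: j k => [|j IH] k; first by rewrite addn0 expn0 divn1.
rewrite addnS expnS divnMA => x Qx; apply: IH.
have := odd_double_half k; rewrite -divn2; case: (odd k) => E; move: Qx; rewrite -{1}E.
  by rewrite add1n => /subr.
by rewrite add0n => /subl.
Qed.

Lemma dyadic_max_cell h j n k m x : (j < h)%N ->
  Q (n + j) k x -> cell_mean (n + j) k <= dyadic_max h n (k %/ 2 ^ j) m x.
Proof.
elim: j h n m => [|j IH] [//|h] n m; rewrite ltnS => jh Qx.
  rewrite addn0 expn0 divn1 /=.
  have mm : cell_mean n k <= Num.max m (cell_mean n k) by rewrite le_max lexx orbT.
  case: ifP => _; first exact: le_trans (dyadic_max_ge _ _ _ _ _).
  by case: ifP => _ //; exact: le_trans (dyadic_max_ge _ _ _ _ _).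
rewrite addnS -addSn in Qx *.
pose c := (k %/ 2 ^ j)%N.
have -> : (k %/ 2 ^ j.+1 = c %/ 2)%N by rewrite expnSr divnMA.
have Qc : Q n.+1 c x by apply: cell_nested.
have IHc := fun m => IH h n.+1 m jh Qx.
rewrite /=.
have E := odd_double_half c; rewrite -divn2 in E.
case: (odd c) E => E; rewrite ?add1n ?add0n in E.
  have -> : (x \in Q n.+1 (c %/ 2)%N.*2) = false.
    apply/negbTE; rewrite notin_setE => Qx'.
    have := disj n (c %/ 2)%N; rewrite E => D; suff : set0 x by [].
    by rewrite -D.
  by rewrite E mem_set// IHc.
by rewrite E mem_set// IHc.
Qed.

Local Open Scope ereal_scope.

Let mf2 D : measurable_fun D (fun x => (f x ^+ 2)%:E).
Proof.
apply: measurable_funTS; apply/measurable_EFinP.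
exact: measurable_funX.
Qed.

Let mfE D : measurable_fun D (fun x => (f x)%:E).
Proof. by apply: measurable_funTS; exact/measurable_EFinP. Qed.

(** The bound (m - 2 f)^2 >= 0, integrated. *)
Lemma pointwise_bound (A : set T) (m : R) : measurable A -> (0 <= m)%R ->
  (m ^+ 2)%:E * mu A + (4 * m)%:E * \int[mu]_(x in A) (f x)%:E <=
  4%:E * \int[mu]_(x in A) (f x ^+ 2)%:E + (2 * m ^+ 2)%:E * mu A.
Proof.
move=> mA m0.
have m20 : (0 <= m ^+ 2)%R by exact: sqr_ge0.
have c r : r%:E * mu A = \int[mu]_(x in A) (cst r%:E x) by rewrite integral_cst.
have f20 x : A x -> 0 <= (f x ^+ 2)%:E by move=> _; rewrite lee_fin sqr_ge0.
have fE0 x : A x -> 0 <= (f x)%:E by move=> _; rewrite lee_fin.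
have m40 : (0 <= 4 * m)%R by rewrite mulr_ge0.
have g1 x : A x -> 0 <= (4 * m)%:E * (f x)%:E.
  by move=> _; rewrite -EFinM lee_fin mulr_ge0.
have g2 x : A x -> 0 <= 4%:E * (f x ^+ 2)%:E.
  by move=> _; rewrite -EFinM lee_fin mulr_ge0 ?sqr_ge0.
have m1 : measurable_fun A (fun x => (4 * m)%:E * (f x)%:E) by exact: measurable_funeM.
have m2 : measurable_fun A (fun x => 4%:E * (f x ^+ 2)%:E) by exact: measurable_funeM.
rewrite !c -(ge0_integralZl_EFin mu mA fE0 (@mfE A) m40).
rewrite -(ge0_integralZl_EFin mu mA f20 (@mf2 A) (ler0n _ 4)).
have k1 x : A x -> 0 <= cst (m ^+ 2)%:E x by rewrite lee_fin.
have k2 x : A x -> 0 <= cst (2 * m ^+ 2)%:E x by rewrite lee_fin mulr_ge0.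
rewrite -(ge0_integralD mu mA k1 (measurable_cst _) g1 m1).
rewrite -(ge0_integralD mu mA g2 m2 k2 (measurable_cst _)).
apply: ge0_le_integral => //.
- by move=> x Ax; rewrite adde_ge0 ?k1 ?g1.
- by apply: emeasurable_funD.
- by apply: emeasurable_funD.
move=> x _ /=; rewrite -!EFinM -!EFinD lee_fin.
have : (0 <= (2 * f x - m) ^+ 2)%R by exact: sqr_ge0.
by rewrite !expr2; nra.
Qed.

Let intf_fin A : measurable A -> mu A < +oo ->
  \int[mu]_(x in A) (f x ^+ 2)%:E \is a fin_num /\
  \int[mu]_(x in A) (f x)%:E \is a fin_num.
Proof.
move=> mA Aoo.
have f2A : \int[mu]_(x in A) (f x ^+ 2)%:E < +oo.
  apply: le_lt_trans f2fin; apply: ge0_subset_integral => //.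
  by move=> x _; rewrite lee_fin sqr_ge0.
split; rewrite ge0_fin_numE//.
- by apply: integral_ge0 => x _; rewrite lee_fin sqr_ge0.
- apply: (@le_lt_trans _ _ (\int[mu]_(x in A) ((f x ^+ 2)%:E + cst 1%:E x))).
    apply: ge0_le_integral => //.
    - by move=> x _; rewrite lee_fin.
    - by apply: emeasurable_funD.
    move=> x _ /=; rewrite -EFinD lee_fin.
    have : (0 <= (f x - 1) ^+ 2)%R by exact: sqr_ge0.
    have := f0 x; rewrite !expr2; nra.
  rewrite ge0_integralD//; last by move=> x _; rewrite lee_fin sqr_ge0.
  by rewrite integral_cst// mul1e lte_add_pinfty.
- by apply: integral_ge0 => x _; rewrite lee_fin.
Qed.

Lemma combine_three (k r s x1 x2 x3 a1 a2 a3 b1 b2 b3 c1 c2 c3 : \bar R) :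
  0 <= a1 -> 0 <= a2 -> 0 <= a3 -> 0 <= b1 -> 0 <= b2 -> 0 <= b3 ->
  0 <= c1 -> 0 <= c2 -> 0 <= c3 ->
  x1 + k * a1 <= r * b1 + s * c1 -> x2 + k * a2 <= r * b2 + s * c2 ->
  x3 + k * a3 <= r * b3 + s * c3 ->
  x1 + x2 + x3 + k * (a1 + a2 + a3) <= r * (b1 + b2 + b3) + s * (c1 + c2 + c3).
Proof.
move=> *; rewrite !ge0_muleDr ?adde_ge0//.
rewrite addeACA [X in X + _ <= _]addeACA.
rewrite [leRHS]addeACA [X in _ <= X + _]addeACA.
by apply: leeD => //; exact: leeD.
Qed.

(** The inequality X + a <= b gets weaker when b - a increases. *)
Lemma change_level (X : \bar R) (a b a' b' : R) :
  X + a%:E <= b%:E -> (b - a <= b' - a')%R -> X + a'%:E <= b'%:E.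
Proof.
case: X => [x h1 h2|//|_ _].
  by rewrite -EFinD lee_fin; rewrite -EFinD lee_fin in h1; lra.
by rewrite addNye leNye.
Qed.

(** For m := 0 this is the maximal inequality with constant 4.  The terms in m make
    it additive over the two children and the remainder of the cell.  When the mean
    c of the cell exceeds m, the case m := c implies the case m, because
    2 c^2 - 4 c c <= 2 m^2 - 4 m c. *)
Lemma dyadic_max_L2 h n k (m : R) : (0 <= m)%R ->
  \int[mu]_(x in Q n k) ((dyadic_max h n k m x) ^+ 2)%:E +
     (4 * m)%:E * \int[mu]_(x in Q n k) (f x)%:E <=
  4%:E * \int[mu]_(x in Q n k) (f x ^+ 2)%:E + (2 * m ^+ 2)%:E * mu (Q n k).
Proof.
elim: h n k m => [|h IH] n k m m0.
  by apply: le_trans (pointwise_bound (mQ n k) m0); rewrite /= integral_cst.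
set A := Q n k; set B := Q n.+1 k.*2; set C := Q n.+1 k.*2.+1.
pose m' := Num.max m (cell_mean n k).
have m'0 : (0 <= m')%R by rewrite le_max m0.
pose D := A `\` (B `|` C).
have mA : measurable A by exact: mQ.
have mB : measurable B by exact: mQ.
have mC : measurable C by exact: mQ.
have mBC : measurable (B `|` C) by exact: measurableU.
have mD : measurable D by exact: measurableD.
have BA : B `<=` A by exact: subl.
have CA : C `<=` A by exact: subr.
have BC0 : B `&` C = set0 by exact: disj.
have AE : A = (B `|` C) `|` D.
  by rewrite /D setDUK// subUset.
have [f2A fA] := intf_fin mA (Qfin n k).
have Afin : mu A \is a fin_num by rewrite ge0_fin_numE//; exact: Qfin.
have dBC : [disjoint B & C] by rewrite disj_set2E BC0.
have dD : [disjoint (B `|` C) & D].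
  by rewrite disj_set2E; apply/eqP/seteqP; split => x //= [? [_ ]].
have split3 (g : T -> \bar R) : measurable_fun setT g -> (forall x, 0 <= g x) ->
    \int[mu]_(x in A) g x =
    \int[mu]_(x in B) g x + \int[mu]_(x in C) g x + \int[mu]_(x in D) g x.
  move=> mg g0; rewrite AE ge0_integral_setU//; last exact: measurable_funTS.
  by rewrite ge0_integral_setU//; exact: measurable_funTS.
have muA : mu A = mu B + mu C + mu D.
  have := split3 (cst 1) (measurable_cst _) (fun=> lee01).
  by rewrite !integral_cst// !mul1e.
have mM : measurable_fun setT (fun x => (dyadic_max h.+1 n k m x ^+ 2)%:E).
  by apply/measurable_EFinP; apply: measurable_funX; exact: measurable_dyadic_max.
have step : \int[mu]_(x in A) ((dyadic_max h.+1 n k m x) ^+ 2)%:E +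
     (4 * m')%:E * \int[mu]_(x in A) (f x)%:E <=
  4%:E * \int[mu]_(x in A) (f x ^+ 2)%:E + (2 * m' ^+ 2)%:E * mu A.
  have e0 x : 0 <= (f x)%:E by rewrite lee_fin.
  have e2 x : 0 <= (f x ^+ 2)%:E by rewrite lee_fin sqr_ge0.
  have i0 X : 0 <= \int[mu]_(x in X) (f x)%:E by exact: integral_ge0.
  have i2 X : 0 <= \int[mu]_(x in X) (f x ^+ 2)%:E by exact: integral_ge0.
  have P1 := IH n.+1 k.*2 m' m'0.
  have P2 := IH n.+1 k.*2.+1 m' m'0.
  have P3 := pointwise_bound mD m'0.
  rewrite -/B in P1; rewrite -/C in P2.
  have E1 : \int[mu]_(x in B) (dyadic_max h.+1 n k m x ^+ 2)%:E =
            \int[mu]_(x in B) (dyadic_max h n.+1 k.*2 m' x ^+ 2)%:E.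
    by apply: eq_integral => x xB; rewrite /= xB.
  have E2 : \int[mu]_(x in C) (dyadic_max h.+1 n k m x ^+ 2)%:E =
            \int[mu]_(x in C) (dyadic_max h n.+1 k.*2.+1 m' x ^+ 2)%:E.
    apply: eq_integral => x xC; rewrite /= xC ifF//; apply/negbTE.
    rewrite notin_setE => xB; suff : set0 x by [].
    by rewrite -BC0; split => //; exact: set_mem.
  have E3 : \int[mu]_(x in D) (dyadic_max h.+1 n k m x ^+ 2)%:E =
            (m' ^+ 2)%:E * mu D.
    rewrite -integral_cst//; apply: eq_integral => x /set_mem [_ xN] /=.
    rewrite ifF; last by apply/negbTE; rewrite notin_setE => xB; apply: xN; left.
    by rewrite ifF//; apply/negbTE; rewrite notin_setE => xB; apply: xN; right.
  rewrite (split3 _ mM) ?E1 ?E2 ?E3; last by move=> x; rewrite lee_fin sqr_ge0.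
  rewrite (split3 _ (@mfE setT) e0) (split3 _ (@mf2 setT) e2) muA.
  have m4 : 0 <= (4 * m')%:E by rewrite lee_fin mulr_ge0.
  have m2 : 0 <= (2 * m' ^+ 2)%:E by rewrite lee_fin mulr_ge0 ?sqr_ge0.
  exact: combine_three.
move: step; rewrite -(fineK f2A) -(fineK fA) -(fineK Afin) -!EFinM -!EFinD => step.
apply: (change_level step).
set F := fine (\int[mu]_(x in A) (f x)%:E); set V := fine (mu A).
have V0 : (0 < V)%R by apply: fine_gt0; rewrite Qpos/=; exact: Qfin.
have [mc|cm] := leP (cell_mean n k) m.
  by rewrite /m' max_l//; lra.
have F_eq : F = (cell_mean n k * V)%R by rewrite /cell_mean -/A divfK// gt_eqF.
rewrite /m' max_r; last exact: ltW.
rewrite F_eq; set c := cell_mean n k.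
have : (0 <= V * (c - m) ^+ 2)%R by rewrite mulr_ge0 ?sqr_ge0// ltW.
by rewrite !expr2; lra.
Qed.

(** G is the square of the full dyadic maximal function, as a monotone limit of the
    truncated ones. *)
Lemma dyadic_maximal_L2 : exists G : T -> \bar R,
  [/\ measurable_fun (Q 0 0) G, (forall x, 0 <= G x),
    (forall n k x, (k < 2 ^ n)%N -> Q n k x -> (cell_mean n k ^+ 2)%:E <= G x) &
    \int[mu]_(x in Q 0 0) G x <= 4%:E * \int[mu]_(x in Q 0 0) (f x ^+ 2)%:E].
Proof.
pose g h x := ((dyadic_max h 0 0 0 x) ^+ 2)%:E.
have M0 h x : (0 <= dyadic_max h 0 0 0 x)%R by exact: dyadic_max_ge.
have g0 h x : 0 <= g h x by rewrite lee_fin sqr_ge0.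
have gnd x : nondecreasing_seq (g ^~ x).
  apply/nondecreasing_seqP => h; rewrite lee_fin ler_pXn2r ?nnegrE//.
  exact: dyadic_max_mono.
have mg h : measurable_fun (Q 0 0) (g h).
  apply: measurable_funTS; apply/measurable_EFinP; apply: measurable_funX.
  exact: measurable_dyadic_max.
have gcvg x : g ^~ x @ \oo --> limn (g ^~ x).
  exact: ereal_nondecreasing_is_cvgn.
exists (fun x => limn (g ^~ x)); split.
- by apply: (@emeasurable_fun_cvg _ _ _ (Q 0 0) g) => // x _; exact: gcvg.
- by move=> x; apply: lime_ge; [exact: gcvg|exact: nearW].
- move=> n k x kn Qx.
  apply: (@le_trans _ _ (g n.+1 x)).
    rewrite lee_fin ler_pXn2r ?nnegrE ?cell_mean_ge0//.
    by have := @dyadic_max_cell n.+1 n 0 k 0%R x (ltnSn n) Qx; rewrite add0n divn_small.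
  by apply: (lime_ge (gcvg x)); exists n.+1 => // j nj; exact: gnd.
- rewrite monotone_convergence//.
  apply: lime_le.
    apply: ereal_nondecreasing_is_cvgn => a b ab.
    by apply: ge0_le_integral => // x _; exact: gnd.
  apply: nearW => h; have := @dyadic_max_L2 h 0 0 0%R (lexx _).
  by rewrite mulr0 mul0e adde0 expr0n/= mulr0 mul0e adde0.
Qed.

End dyadic_maximal.

(** * Representatives of weights and dyadic Carleson squares *)

Section representatives.
Context {R : realType}.
Local Notation mu := (@area R).
Implicit Types (z : plane R) (I A : set (plane R)) (a l s t : R) (w : plane R -> \bar R).

Lemma carleson_disc I : carleson I `<=` @disc R.
Proof. by move=> z []. Qed.

Definition qarea I : R := fine (mu (carleson I)).

Lemma qareaE I : is_arc I -> qarea I = disc_area * (arclen I ^+ 2 * (2 - arclen I)).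
Proof. by move=> aI; rewrite /qarea area_carleson. Qed.

Lemma qarea_gt0 I : is_arc I -> 0 < qarea I.
Proof.
move=> aI; rewrite qareaE//; have [/andP[l0 l1] _] := is_arcP aI.
by rewrite mulr_gt0 ?disc_area_gt0// mulr_gt0// ?exprn_gt0//; lra.
Qed.

Lemma area_carlesonE I : is_arc I -> mu (carleson I) = (qarea I)%:E.
Proof. by move=> aI; rewrite /qarea area_carleson. Qed.

Lemma area_carleson_fin I : is_arc I -> (mu (carleson I) < +oo)%E.
Proof. by move=> aI; rewrite area_carlesonE// ltry. Qed.

(** The integral of a nonnegative function is a supremum over simple functions below
    it, so it is monotone even where measurability is unknown, as for the maximal
    function. *)
Lemma le_integral_lower A (f g : plane R -> \bar R) :
  (forall z, A z -> (0 <= f z)%E) -> (forall z, A z -> (f z <= g z)%E) ->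
  (\int[mu]_(z in A) f z <= \int[mu]_(z in A) g z)%E.
Proof.
move=> f0 fg; rewrite !ge0_integralE//; last first.
  by move=> z Az; apply: le_trans (f0 _ Az) (fg _ Az).
apply: le_ereal_sup => _ [h /= hf <-]; exists h => //= z.
apply: (le_trans (hf z)); rewrite /patch; case: ifPn => // /set_mem Az; exact: fg.
Qed.

(** A representative with values in ]0, +oo[, on which real powers and logarithms
    behave well; the value 1 is assigned off the disc and on the exceptional set. *)
Definition rep w z : R :=
  let x := fine ((w \_ (@disc R)) z) in if 0 < x then x else 1.

Lemma rep_gt0 w z : 0 < rep w z.
Proof. by rewrite /rep; case: ifP. Qed.

Lemma measurable_rep w : weight w -> measurable_fun setT (rep w).
Proof.
move=> [mw _ _]; have mx : measurable_fun setT (fun z => fine ((w \_ (@disc R)) z)).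
  apply: (measurableT_comp (fine_measurable measurableT)).
  by apply/(measurable_restrictT _ measurable_disc).
have m0 := @measurable_fun_ltr _ _ _ setT (cst 0) _ (measurable_cst _) mx.
exact: (measurable_fun_ifT m0 mx (measurable_cst _)).
Qed.

Lemma repE w : weight w -> {ae mu, forall z, @disc R z -> w z = (rep w z)%:E}.
Proof.
move=> [_ _]; apply: filterS => z h dz; have /andP[w0 w1] := h dz.
rewrite /rep /patch mem_set//= .
by move: w0 w1; case: (w z) => [r||]//=; rewrite lte_fin => ->.
Qed.

Lemma integral_rep w A (F : \bar R -> \bar R) : weight w ->
  measurable_fun setT F -> measurable A -> A `<=` @disc R ->
  (\int[mu]_(z in A) F (w z) = \int[mu]_(z in A) F (rep w z)%:E)%E.
Proof.
move=> ww mF mA AD.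
have mw : measurable_fun A w.
  by case: ww => mw _ _; exact: (measurable_funS measurable_disc AD mw).
have mr : measurable_fun A (EFin \o rep w).
  by apply: measurable_funTS; apply/measurable_EFinP; exact: measurable_rep.
apply: (@ae_eq_integral _ _ _ mu A _ _ mA).
- exact: (measurableT_comp mF mw).
- exact: (measurableT_comp mF mr).
- by apply: filterS (repE ww) => z h Az; rewrite h//; exact: AD.
Qed.

Lemma integral_rep_id w A : weight w -> measurable A -> A `<=` @disc R ->
  (\int[mu]_(z in A) w z = \int[mu]_(z in A) (rep w z)%:E)%E.
Proof. by move=> ww mA AD; exact: (@integral_rep w A idfun ww (@measurable_id _ _ setT) mA AD). Qed.

Lemma measurable_repE w A : weight w -> measurable_fun A (EFin \o rep w).
Proof. by move=> ww; apply: measurable_funTS; apply/measurable_EFinP; exact: measurable_rep. Qed.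

Lemma integrable_rep w A : integrable_weight w -> measurable A -> A `<=` @disc R ->
  mu.-integrable A (EFin \o rep w).
Proof.
move=> [ww iw] mA AD; apply/integrableP; split; first exact: measurable_repE.
under eq_integral do rewrite /= ger0_norm ?(ltW (rep_gt0 _ _))//.
rewrite -(integral_rep_id ww mA AD).
have iA := integrableS measurable_disc mA AD iw.
have [_ w0 _] := ww.
have /integrableP[_ h] := iA; apply: le_lt_trans h.
rewrite [leRHS](_ : _ = \int[mu]_(z in A) w z)%E//.
by apply: eq_integral => z /set_mem Az; rewrite gee0_abs// w0//; exact: AD.
Qed.

(** The dyadic Carleson squares of the grid rotated by s turns.  They are half-open in
    the angle, which makes siblings disjoint. *)
Definition cell s n k : set (plane R) :=
  [set z | [/\ 0 < modulus z, modulus z < 1, 1 - modulus z < 2^-1 ^+ n &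
    ang (2 * pi * (s + k%:R * 2^-1 ^+ n)) z < 2 * pi * 2^-1 ^+ n]].

Lemma measurable_cell s n k : measurable (cell s n k).
Proof.
have mm := @measurable_modulus_plane R.
rewrite (_ : cell s n k = [set z : plane R | 0 < modulus z] `&`
  ([set z : plane R | modulus z < 1] `&` ([set z : plane R | 1 - modulus z < 2^-1 ^+ n] `&`
  [set z : plane R | ang (2 * pi * (s + k%:R * 2^-1 ^+ n)) z < 2 * pi * 2^-1 ^+ n]))).
  have ma := measurable_fun_plane (measurable_ang (2 * pi * (s + k%:R * 2^-1 ^+ n))).
  have mb : measurable_fun setT (fun z : plane R => 1 - modulus z) by exact: measurable_funB.
  by repeat apply: measurableI; exact: measurable_lt_set.
by apply/seteqP; split => z /= => [[? ? ? ?]|[? [? []]]].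
Qed.

Lemma halfn_bound n : 0 < (2^-1 ^+ n : R) <= 1.
Proof. by rewrite exprn_gt0 ?invr_gt0//= exprn_ile1// ?invr_ge0// invf_le1//; lra. Qed.

Lemma area_cell s n k :
  mu (cell s n k) = (disc_area * ((2^-1 ^+ n) ^+ 2 * (2 - 2^-1 ^+ n)))%:E.
Proof.
set a := 2 * pi * (s + k%:R * 2^-1 ^+ n).
have := halfn_bound n; set h := 2^-1 ^+ n => /andP[h0 h1].
rewrite (@area_sandwich _ a h (1 - h) 1); [|lra..| | |].
- by congr EFin; ring.
- exact: measurable_cell.
- by move=> z z0 z1 z2 z3 z4; split => //; rewrite -/h; lra.
- by move=> z [z0 z1 z2 z3]; split; [|rewrite -/h in z2; lra|exact: ltW|exact: ltW].
Qed.

Lemma cell_sub s n k n' k' : (n <= n')%N ->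
  k%:R * 2^-1 ^+ n <= k'%:R * 2^-1 ^+ n' :> R ->
  k'%:R * 2^-1 ^+ n' + 2^-1 ^+ n' <= k%:R * 2^-1 ^+ n + 2^-1 ^+ n :> R ->
  cell s n' k' `<=` cell s n k.
Proof.
move=> nn l1 l2 z [z0 z1 z2 z3].
have /andP[g0 g1] := halfn_bound n.
have zn : z <> (0, 0) by exact/modulus_gt0.
have hh : 2^-1 ^+ n' <= 2^-1 ^+ n :> R by rewrite ler_wiXn2l//; lra.
split => //; first exact: lt_le_trans hh.
have p0 := @pi_gt0 R; have pp : 0 <= 2 * pi :> R by lra.
move: z3; set a' := 2 * pi * (s + k'%:R * _); set a := 2 * pi * (s + k%:R * _) => z3.
have /andP[b0 b1] := ang_bound a' z.
have L1 := ler_wpM2l pp l1; have L2 := ler_wpM2l pp l2.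
have L3 := ler_wpM2l pp g1; rewrite mulr1 in L3.
rewrite !(mulrDr (2 * pi)) in L2.
have e : a = 2 * pi * s + 2 * pi * (k%:R * 2^-1 ^+ n) by rewrite /a (mulrDr (2 * pi)).
have e' : a' = 2 * pi * s + 2 * pi * (k'%:R * 2^-1 ^+ n') by rewrite /a' (mulrDr (2 * pi)).
have -> : ang a z = a' + ang a' z - a.
  apply: ang_uniq => //; last by rewrite expi_ang.
  by apply/andP; split; lra.
by lra.
Qed.

Lemma cell_subl s n k : cell s n.+1 k.*2 `<=` cell s n k.
Proof.
have /andP[g0 g1] := halfn_bound n.
by apply: cell_sub => //; rewrite -mul2n natrM exprS; lra.
Qed.

Lemma cell_subr s n k : cell s n.+1 k.*2.+1 `<=` cell s n k.
Proof.
have /andP[g0 g1] := halfn_bound n.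
by apply: cell_sub => //; rewrite -(natr1 k.*2) -mul2n natrM exprS; lra.
Qed.

Lemma cell_disj s n k : cell s n.+1 k.*2 `&` cell s n.+1 k.*2.+1 = set0.
Proof.
apply/seteqP; split => z //= -[[z0 z1 z2 z3] [_ _ _ z4]].
have zn : z <> (0, 0) by exact/modulus_gt0.
have p0 := @pi_gt0 R; have pp : 0 < 2 * pi :> R by lra.
have /andP[g0 g1] := halfn_bound n.
have G0 : 0 < 2 * pi * 2^-1 ^+ n.+1 :> R by rewrite mulr_gt0// exprn_gt0.
have G1 : 2 * pi * 2^-1 ^+ n.+1 <= pi :> R.
  have : pi * 2^-1 ^+ n <= pi :> R by rewrite ler_piMr// ltW.
  by rewrite exprS; lra.
move: z3 z4; rewrite -(natr1 k.*2) (mulrDl k.*2%:R 1 (2^-1 ^+ n.+1)) mul1r (addrA s).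
rewrite (mulrDr (2 * pi) (s + _)); set a := 2 * pi * _; set h := 2 * pi * _ in G0 G1 *.
move=> z3 z4; have /andP[b0 b1] := ang_bound (a + h) z.
have : ang a z = a + h + ang (a + h) z - a.
  apply: ang_uniq => //; last by rewrite expi_ang.
  by apply/andP; split; lra.
by lra.
Qed.

End representatives.

(** * Covering Carleson squares by dyadic ones *)

Section covering.
Context {R : realType}.
Local Notation mu := (@area R).
Implicit Types (z : plane R) (I A : set (plane R)) (a l s t : R) (w : plane R -> \bar R).

Lemma ang_periodn a (n : nat) z : ang (a + 2 * pi * n%:R) z = ang a z.
Proof. by rewrite /ang !cosN !sinN; have := expi_periodn a n; rewrite /expi => -[-> ->]. Qed.

(** Cells are indexed by naturals below 2^n, while covering arguments produce an
    arbitrary integer index. *)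
Lemma ang_period a (m : int) z : ang (a + 2 * pi * m%:~R) z = ang a z.
Proof.
case: m => n; first by rewrite -pmulrn ang_periodn.
rewrite NegzE mulrNz -pmulrn.
by rewrite -[LHS](ang_periodn _ n.+1); congr (ang _ z); ring.
Qed.

Lemma pow2_not_mul3 (i : int) n : (3 * i)%R <> (2 ^ n)%N%:Z.
Proof.
move=> /(congr1 absz); rewrite abszM /= => E.
have : (3 %| 2 ^ n)%N.
  by apply/dvdnP; exists `|i|%N; rewrite mulnC -E.
by rewrite Euclid_dvdX.
Qed.

(** If an interval of length k met a cut of both grids, two cuts would be at distance
    less than h/3, where h := 2^-n.  Cuts of the two grids differ by 1/3 modulo h,
    that is by at least h/3 because 3 does not divide 2^n. *)
Lemma third_shift_cover x k n : 0 <= k -> 3 * k <= 2^-1 ^+ n ->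
  exists s, (s = 0 \/ s = 3^-1) /\ exists j : int,
    s + j%:~R * 2^-1 ^+ n <= x /\ x + k < s + (j%:~R + 1) * 2^-1 ^+ n :> R.
Proof.
move=> k0 k3; have /andP[h0 h1] := @halfn_bound R n; set h := 2^-1 ^+ n in h0 h1 k3 *.
pose j0 := Num.floor (x / h); pose j1 := Num.floor ((x - 3^-1) / h).
have a0 : j0%:~R * h <= x by rewrite -ler_pdivlMr//; exact: floor_le.
have b0 : x < (j0%:~R + 1) * h.
  by rewrite -ltr_pdivrMr//; have := floorD1_gt (x / h); rewrite intrD.
have a1 : j1%:~R * h <= x - 3^-1 by rewrite -ler_pdivlMr//; exact: floor_le.
have b1 : x - 3^-1 < (j1%:~R + 1) * h.
  by rewrite -ltr_pdivrMr//; have := floorD1_gt ((x - 3^-1) / h); rewrite intrD.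
have [c0|c0] := ltP (x + k) ((j0%:~R + 1) * h).
  by exists 0; split; [left|exists j0; rewrite !add0r].
have [c1|c1] := ltP (x + k) (3^-1 + (j1%:~R + 1) * h).
  by exists 3^-1; split; [right|exists j1; split => //; lra].
exfalso.
(* Both cells of x end before x + k.  Then |3 i - 2^n| < 1 for the difference i of
   their indices, so that 3 i = 2^n. *)
pose N : R := 2 ^+ n; have hN : h * N = 1 by rewrite -exprMn mulVf ?expr1n.
have N0 : 0 < N by rewrite exprn_gt0.
pose i := j0 - j1.
have d1 : 3 * (i%:~R * h) - 1 < h by rewrite /i intrB; lra.
have d2 : - h < 3 * (i%:~R * h) - 1 by rewrite /i intrB; lra.
have e1 : 3 * i%:~R - N < 1.
  by rewrite -(ltr_pM2l h0) mulr1 mulrBr hN; lra.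
have e2 : - 1 < 3 * i%:~R - N.
  by rewrite -(ltr_pM2l h0) mulrN1 mulrBr hN; lra.
apply: (@pow2_not_mul3 i n).
have NE : N = ((2 ^ n)%N%:Z)%:~R by rewrite -pmulrn natrX.
have E : (3 * i - (2 ^ n)%N%:Z)%:~R = 3 * i%:~R - N :> R by rewrite intrB intrM NE.
rewrite -E ltrz1 in e1.
have {}e2 : (-1 : int)%:~R < (3 * i - (2 ^ n)%N%:Z)%:~R :> R by rewrite E mulrNz.
rewrite ltr_int in e2.
apply/eqP; rewrite -subr_eq0; move: (_ - _) e1 e2 => q; clear => q1 q2.
by apply/eqP; lia.
Qed.

Lemma dyadic_scale l : 0 < l -> l <= 3^-1 ->
  exists2 n, 3 * l <= 2^-1 ^+ n & 2^-1 ^+ n < 6 * l.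
Proof.
move=> l0 l3; have l3p : 0 < 3 * l by lra.
have m1 : (0 < Num.truncn (3 * l)^-1)%N.
  by rewrite truncn_gt0 invf_ge1//; lra.
have /andP[n1 n2] := trunc_log_bounds (ltnSn 1) m1.
exists (trunc_log 2 (Num.truncn (3 * l)^-1)).
  rewrite exprVn -[leLHS]invrK lef_pV2 ?posrE ?exprn_gt0 ?invr_gt0//.
  apply: (@le_trans _ _ (Num.truncn (3 * l)^-1)%:R); first by rewrite -natrX ler_nat.
  by rewrite truncn_le// invr_ge0 ltW.
move: n2; set n := trunc_log _ _ => n2.
suff : (2 ^+ n.+1)^-1 < 3 * l.
  rewrite -exprVn exprS; move: (2^-1 ^+ n) => h; clear -h l; lra.
rewrite -[ltRHS]invrK ltf_pV2 ?posrE ?exprn_gt0 ?invr_gt0//.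
apply: (@lt_le_trans _ _ (Num.truncn (3 * l)^-1).+1%:R); first by rewrite truncnS_gt.
by rewrite -natrX ler_nat.
Qed.

Lemma carleson_in_cell I : is_arc I -> arclen I <= 3^-1 ->
  exists s n i, [/\ s = 0 \/ s = 3^-1, (i < 2 ^ n)%N, carleson I `<=` cell s n i &
    fine (mu (cell s n i)) <= 72 * qarea I].
Proof.
move=> aI; have [/andP[l0 l1] [b ab]] := is_arcP aI; set l := arclen I in l0 l1 ab *.
move=> l3.
have [n v1 v2] := dyadic_scale l0 l3.
have h0 : 0 < 2^-1 ^+ n :> R by have /andP[] := @halfn_bound R n.
have hN : 2^-1 ^+ n * 2 ^+ n = 1 :> R by rewrite -exprMn mulVf ?expr1n.
have p0 := @pi_gt0 R; have pp : 0 < 2 * pi :> R by lra.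
have [s [s01 [j [j1 j2]]]] := @third_shift_cover (b / (2 * pi)) l n (ltW l0) v1.
(* The cells of index j modulo 2^n coincide. *)
pose i := `|(j %% 2 ^+ n)%Z|%N.
have M0 : (2 ^+ n : int) != 0 by rewrite expf_neq0.
have iE : i%:Z = (j %% 2 ^+ n)%Z by rewrite gez0_abs// modz_ge0.
have iN : (i < 2 ^ n)%N.
  have : (j %% 2 ^+ n)%Z < `|2 ^+ n : int| by rewrite ltz_mod.
  rewrite -iE ger0_norm ?exprn_ge0//.
  by rewrite (_ : 2 ^+ n = (2 ^ n)%N%:Z)//; rewrite -natrX natz.
have angE z : ang (2 * pi * (s + j%:~R * 2^-1 ^+ n)) z =
    ang (2 * pi * (s + i%:R * 2^-1 ^+ n)) z.
  rewrite -[RHS](ang_period _ (j %/ 2 ^+ n)%Z); congr (ang _ z).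
  have -> : j%:~R = (j %/ 2 ^+ n)%Z%:~R * 2 ^+ n + i%:R :> R.
    by rewrite {1}(divz_eq j (2 ^+ n)) intrD intrM -iE -pmulrn rmorphXn.
  set q := (_ %/ _)%Z%:~R.
  transitivity (2 * pi * (s + i%:R * 2^-1 ^+ n) + 2 * pi * (q * (2^-1 ^+ n * 2 ^+ n))).
    by ring.
  by rewrite hN mulr1.
exists s, n, i; split => //.
- move=> z [dz z0 Iz hz]; rewrite -/l in hz.
  have bz := arc_direction_hi (_ : 0 <= l <= 1) ab z0 Iz.
  have {}bz : ang b z <= 2 * pi * l by apply: bz; rewrite ltW.
  split; [exact/modulus_gt0|exact: dz|by apply: lt_le_trans hz _; lra|].
  rewrite -angE; have /andP[c0 c1] := ang_bound b z.
  have w1 := ler_wpM2l (ltW pp) j1.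
  have w2 : (2 * pi) * (b / (2 * pi) + l) < (2 * pi) * (s + (j%:~R + 1) * 2^-1 ^+ n).
    by rewrite ltr_pM2l.
  have bE : 2 * pi * (b / (2 * pi)) = b by rewrite mulrC divfK// gt_eqF.
  rewrite bE in w1.
  have w3 : b + 2 * pi * l < 2 * pi * (s + j%:~R * 2^-1 ^+ n) + 2 * pi * 2^-1 ^+ n.
    rewrite -{1}bE; lra.
  have h1 : 2 * pi * 2^-1 ^+ n <= 2 * pi :> R.
    by have /andP[_ hh] := @halfn_bound R n; rewrite ler_piMr//; exact: ltW.
  set a := 2 * pi * (s + _) in w1 w3 *.
  have -> : ang a z = b + ang b z - a.
    apply: ang_uniq => //; last by rewrite expi_ang.
    by apply/andP; split; lra.
  by lra.
- rewrite area_cell /= qareaE// -/l [leRHS]mulrCA ler_pM2l ?disc_area_gt0//.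
  set h := 2^-1 ^+ n in h0 v1 v2 *.
  have : h ^+ 2 <= (6 * l) ^+ 2 by rewrite ler_pXn2r ?nnegrE ?ltW//; lra.
  have q0 : 0 <= l ^+ 2 by exact: sqr_ge0.
  have q1 : l ^+ 2 <= l ^+ 2 * (2 - l) by rewrite ler_peMr//; lra.
  have q2 : h ^+ 2 * (2 - h) <= h ^+ 2 * 2 by rewrite ler_wpM2l ?sqr_ge0//; lra.
  by rewrite exprMn; lra.
Qed.

Lemma expi_shift s t u : expi s = expi t -> expi (s + u) = expi (t + u) :> plane R.
Proof. by rewrite /expi => -[h1 h2]; rewrite !cosD !sinD h1 h2. Qed.

(** Prolonging I by e * |I| at both ends catches every short arc that meets I.  When
    the prolonged arc would exceed the circle, the whole circle is taken. *)
Lemma enlarged_arc I e : is_arc I -> 0 < e ->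
  exists J, [/\ is_arc J, carleson I `<=` carleson J,
    (forall K, is_arc K -> arclen K <= e * arclen I ->
       carleson I `&` carleson K !=set0 -> carleson K `<=` carleson J) &
    qarea J <= (1 + 2 * e) ^+ 2 * qarea I].
Proof.
move=> aI e0; have [/andP[l0 l1] [a ab]] := is_arcP aI; set l := arclen I in l0 l1 ab *.
have p0 := @pi_gt0 R; have pp : 0 < 2 * pi :> R by lra.
have el0 : 0 < e * l by rewrite mulr_gt0.
pose L := Num.min 1 (l * (1 + 2 * e)).
have L1 : L <= 1 by rewrite /L ge_min lexx.
have lL : l <= L by rewrite /L le_min l1/=; lra.
have L2 : L <= l * (1 + 2 * e) by rewrite /L ge_min lexx orbT.
have L01 : 0 < L <= 1 by rewrite L1 andbT; lra.
have L01' : 0 <= L <= 1 by rewrite L1 andbT; lra.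
have Lcase : L = 1 \/ (L = l * (1 + 2 * e) /\ L < 1).
  have [h|h] := leP 1 (l * (1 + 2 * e)); [left|right].
    by rewrite /L min_l.
  by split; rewrite /L min_r ?ltW.
have aJ := @is_arc_closed_arc R (a - 2 * pi * (e * l)) L L01.
have EJ := @arclen_closed_arc R (a - 2 * pi * (e * l)) L L01'.
have pe : 0 < 2 * pi * (e * l) by rewrite mulr_gt0.
have key z t : z <> (0, 0) -> direction z = expi t ->
    a - 2 * pi * (e * l) <= t -> t <= a + 2 * pi * l + 2 * pi * (e * l) ->
    closed_arc (a - 2 * pi * (e * l)) L (direction z).
  move=> z0 zt t1 t2; apply/closed_arc_direction => //.
  have /andP[c0 c1] := ang_bound (a - 2 * pi * (e * l)) z.
  case: Lcase => [->|[LE Llt]]; first by rewrite mulr1 ltW.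
  have pL : 2 * pi * L = 2 * pi * l + 2 * (2 * pi * (e * l)) by rewrite LE; ring.
  have pL1 : 2 * pi * L < 2 * pi by rewrite -[ltRHS]mulr1 ltr_pM2l.
  rewrite (@ang_uniq _ _ z t)//; first lra.
  by apply/andP; split; lra.
exists (closed_arc (a - 2 * pi * (e * l)) L); split => //.
- move=> z [dz z0 Iz hz]; rewrite -/l in hz.
  have bz : ang a z <= 2 * pi * l by apply: (arc_direction_hi _ ab) => //; rewrite ltW.
  have /andP[c0 c1] := ang_bound a z.
  split => //; last by rewrite EJ; apply: lt_le_trans lL.
  by apply: (@key z (a + ang a z) z0); rewrite ?expi_ang//; clear -c0 bz pe; lra.
- move=> K aK Ke [y [[_ y0 Iy _] [_ _ Ky _]]] z [dz z0 Kz hz].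
  have [/andP[k0 k1] [b bb]] := is_arcP aK; set k := arclen K in Ke hz k0 k1 bb *.
  have k01 : 0 <= k <= 1 by rewrite ltW.
  have l01 : 0 <= l <= 1 by rewrite ltW.
  have yI := arc_direction_hi l01 ab y0 Iy.
  have yK := arc_direction_hi k01 bb y0 Ky.
  have zK := arc_direction_hi k01 bb z0 Kz.
  have /andP[c0 _] := ang_bound a y.
  have /andP[c1 _] := ang_bound b y.
  have /andP[c2 _] := ang_bound b z.
  have kk : 2 * pi * k <= 2 * pi * (e * l) by rewrite ler_pM2l.
  split => //; last first.
    rewrite EJ; apply: (lt_le_trans hz).
    case: Lcase => [->//|[-> _]]; apply: (le_trans Ke).
    by lra.
  apply: (@key z (a + ang a y + (ang b z - ang b y)) z0); [|lra..].
  rewrite (@expi_shift _ (b + ang b y)); last by rewrite !expi_ang.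
  have -> : b + ang b y + (ang b z - ang b y) = b + ang b z by ring.
  by rewrite expi_ang.
- rewrite !qareaE// EJ -/l [leRHS]mulrCA ler_pM2l ?disc_area_gt0// mulrA -exprMn.
  apply: ler_pM; rewrite ?sqr_ge0//; [lra| |lra].
  have L0 : 0 <= L by lra.
  have X0 : 0 <= (1 + 2 * e) * l by rewrite mulrC; exact: le_trans L2.
  by rewrite ler_pXn2r ?nnegrE// mulrC.
Qed.

End covering.

(** * The half Jensen condition and doubling *)

Section doubling.
Context {R : realType}.
Local Notation mu := (@area R).
Implicit Types (z : plane R) (I A : set (plane R)) (a l s t : R) (w : plane R -> \bar R).

(** Integrals instead of means: both sides of the inequality between means have been
    multiplied by the square of the area. *)
Definition half_jensen (c : R) w := forall I, is_arc I ->
  (\int[mu]_(z in carleson I) rep w z) * qarea I <=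
  c ^+ 2 * (\int[mu]_(z in carleson I) Num.sqrt (rep w z)) ^+ 2.

Lemma measurable_sqrt_rep w : weight w -> measurable_fun setT (fun z => Num.sqrt (rep w z)).
Proof.
move=> ww.
rewrite (_ : (fun _ => _) = (fun z : plane R => powR (rep w z) 2^-1)).
  exact: (measurableT_comp (measurable_powR _) (measurable_rep ww)).
by apply/funext => z; rewrite powR12_sqrt// ltW// rep_gt0.
Qed.

Lemma integrable_one A : measurable A -> (mu A < +oo)%E -> forall c : R,
  mu.-integrable A (EFin \o cst c).
Proof.
move=> mA Afin c; apply: measurable_bounded_integrable => //; exact: bounded_cst.
Qed.

Lemma integrable_sqrt_rep w A : integrable_weight w -> measurable A -> A `<=` @disc R ->
  (mu A < +oo)%E -> mu.-integrable A (EFin \o (fun z => Num.sqrt (rep w z))).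
Proof.
move=> iw mA AD Afin.
have i1 := integrable_rep iw mA AD.
have i2 := integrable_one mA Afin 1.
apply: (@le_integrable _ _ _ mu A mA _ _ _ _ (integrableD mA i1 i2)).
  by apply: measurable_funTS; apply/measurable_EFinP; apply: measurable_sqrt_rep; case: iw.
move=> z _ /=; have r0 := rep_gt0 w z.
rewrite lee_fin !ger0_norm ?sqrtr_ge0//; last by rewrite addr_ge0// ltW.
have := sqr_ge0 (Num.sqrt (rep w z) - 1).
have := sqr_sqrtr (ltW r0); have := sqrtr_ge0 (rep w z).
by rewrite !expr2; lra.
Qed.

(** Cauchy-Schwarz in linearized form, with a free parameter t. *)
Lemma sqrt_young w A (t : R) : integrable_weight w -> measurable A -> A `<=` @disc R ->
  (mu A < +oo)%E -> 0 < t ->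
  \int[mu]_(z in A) Num.sqrt (rep w z) <=
  (\int[mu]_(z in A) rep w z) / (2 * t) + t / 2 * fine (mu A).
Proof.
move=> iw mA AD Afin t0.
have i1 := integrable_rep iw mA AD.
have i2 := integrable_one mA Afin (t / 2).
have i3 := integrable_sqrt_rep iw mA AD Afin.
have i4 : mu.-integrable A (EFin \o (fun z => (2 * t)^-1 * rep w z)).
  by apply: eq_integrable (integrableZl mA (2 * t)^-1 i1).
rewrite [X in X + _]mulrC -(RintegralZl _ mA i1) -(Rintegral_cst mu mA).
rewrite -(RintegralD mA i4 i2); apply: (le_Rintegral mA i3).
  by apply: eq_integrable (integrableD mA i4 i2).
move=> z _ /=.
have t2 : 0 < 2 * t by rewrite mulr_gt0.
rewrite -(ler_pM2l t2) mulrDr mulrA divff ?gt_eqF// mul1r.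
have r0 := rep_gt0 w z.
have := sqr_ge0 (Num.sqrt (rep w z) - t).
have := sqr_sqrtr (ltW r0).
by rewrite !expr2; lra.
Qed.

(** The computation behind half_jensen_doubling.  Here s is the square root of the mean
    W / q on the large square.  Young's inequality on the small square is used with
    t = s / (2 c) and on the gap with t = 4 c s.  Apart from the term in WI, each then
    contributes s q / 4 to c times the integral of the square root, so that half of
    the total s q must come from the mass WI of the small square. *)
Lemma doubling_algebra (c s q qI qE W WI WE SI SE : R) :
  1 <= c -> 0 < s -> 0 < q -> s ^+ 2 * q = W -> W = WI + WE -> 0 <= WI -> 0 <= WE ->
  0 <= SI -> 0 <= SE -> qI <= q -> qE <= (4 * c)^-1 ^+ 2 * q ->
  SI <= WI / (2 * (s / (2 * c))) + s / (2 * c) / 2 * qI ->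
  SE <= WE / (2 * (s / (4 * c)^-1)) + s / (4 * c)^-1 / 2 * qE ->
  W * q <= c ^+ 2 * (SI + SE) ^+ 2 ->
  W <= 2 * c ^+ 2 * WI.
Proof.
move=> c1 s0 q0 s2 Wsum WI0 WE0 SI0 SE0 qIq.
have c0 : 0 < c by lra.
set d := (4 * c)^-1 => qEq yI yE.
have d0 : 0 < d by rewrite invr_gt0 mulr_gt0.
have cd : c * d = 4^-1 by rewrite /d invfM mulrCA mulfV ?gt_eqF// mulr1.
have h1 : 0 <= s * q by rewrite mulr_ge0// ltW.
have h2 : 0 <= c * (SI + SE) by rewrite mulr_ge0 ?addr_ge0// ltW.
have -> : W * q = (s * q) ^+ 2 by rewrite -s2; ring.
rewrite -exprMn ler_pXn2r ?nnegrE// => main.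
have eI : SI <= c * WI / s + s / (4 * c) * q.
  apply: (le_trans yI).
  have -> : WI / (2 * (s / (2 * c))) = c * WI / s.
    by field; rewrite !gt_eqF.
  rewrite lerD2l; have -> : s / (2 * c) / 2 = s / (4 * c) by field; rewrite gt_eqF.
  by apply: ler_wpM2l => //; rewrite divr_ge0// ltW// mulr_gt0.
have eE : SE <= d * s * q.
  apply: (le_trans yE).
  have -> : WE / (2 * (s / d)) = d * WE / (2 * s) by field; rewrite !gt_eqF.
  have -> : d * s * q = d * (s ^+ 2 * q) / (2 * s) + s / d / 2 * (d ^+ 2 * q).
    by field; rewrite !gt_eqF.
  apply: lerD.
    by rewrite ler_pM2r ?invr_gt0 ?mulr_gt0// ler_pM2l// s2 Wsum lerDr.
  by apply: ler_wpM2l => //; rewrite divr_ge0// divr_ge0// ltW.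
have m2 : s * q <= c * (c * WI / s + s / (4 * c) * q + d * s * q).
  by apply: (le_trans main); rewrite ler_pM2l//; exact: lerD.
have E1 : c * (s / (4 * c) * q) = s * q / 4 by field; rewrite gt_eqF.
have E2 : c * (d * s * q) = s * q / 4 by rewrite !mulrA cd; field.
rewrite !mulrDr E1 E2 in m2.
have m3 : s * q / 2 <= c * (c * WI / s) by lra.
have : s * (s * q / 2) <= s * (c * (c * WI / s)) by rewrite ler_pM2l.
have -> : s * (c * (c * WI / s)) = c ^+ 2 * WI by field; rewrite gt_eqF.
have -> : s * (s * q / 2) = W / 2 by rewrite -s2; field.
by lra.
Qed.

(** If Q_J \ Q_I is a small part of Q_J, Cauchy-Schwarz makes the integral of sqrt w
    over it small, so the mass of w on Q_J must be felt by Q_I. *)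
Lemma half_jensen_doubling w (c : R) I J : integrable_weight w -> 1 <= c -> half_jensen c w ->
  is_arc I -> is_arc J -> carleson I `<=` carleson J ->
  qarea J - qarea I <= (4 * c)^-1 ^+ 2 * qarea J ->
  \int[mu]_(z in carleson J) rep w z <= 2 * c ^+ 2 * \int[mu]_(z in carleson I) rep w z.
Proof.
move=> iw c1 hj aI aJ IJ small.
have mI := measurable_carleson aI; have mJ := measurable_carleson aJ.
have dI := @carleson_disc R I; have dJ := @carleson_disc R J.
pose E := carleson J `\` carleson I.
have mE : measurable E by exact: measurableD.
have EJ : E `<=` carleson J by move=> z [].
have dE : E `<=` @disc R by move=> z /EJ/dJ.
have JE : carleson J = carleson I `|` E by rewrite /E setDUK.
have disj : [disjoint carleson I & E] by rewrite disj_set2E; apply/eqP; rewrite /E setDIK.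
have fJ := area_carleson_fin aJ; have fI := area_carleson_fin aI.
have fE : (mu E < +oo)%E by apply: le_lt_trans fJ; apply: le_measure; rewrite ?inE.
have aE : fine (mu E) = qarea J - qarea I.
  by rewrite /E area_setD// !area_carlesonE.
set W := \int[mu]_(z in carleson J) rep w z.
set WI := \int[mu]_(z in carleson I) rep w z.
pose WE := \int[mu]_(z in E) rep w z.
have WI0 : 0 <= WI by apply: Rintegral_ge0 => z _; rewrite ltW// rep_gt0.
have WE0 : 0 <= WE by apply: Rintegral_ge0 => z _; rewrite ltW// rep_gt0.
have Wsum : W = WI + WE.
  rewrite /W JE Rintegral_setU// -JE; exact: integrable_rep.
have [W0|W0] := leP W 0.
  by apply: (le_trans W0); rewrite mulr_ge0// mulr_ge0// sqr_ge0.
have q0 := qarea_gt0 aJ; have qI0 := qarea_gt0 aI.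
set q := qarea J in small q0 aE *.
pose s := Num.sqrt (W / q).
have s0 : 0 < s by rewrite sqrtr_gt0 divr_gt0.
have s2 : s ^+ 2 * q = W.
  rewrite sqr_sqrtr; first by rewrite divfK// gt_eqF.
  exact: (divr_ge0 (ltW W0) (ltW q0)).
have c0 : 0 < c := lt_le_trans ltr01 c1.
have SJ : \int[mu]_(z in carleson J) Num.sqrt (rep w z) =
    \int[mu]_(z in carleson I) Num.sqrt (rep w z) + \int[mu]_(z in E) Num.sqrt (rep w z).
  rewrite [in LHS]JE Rintegral_setU// -JE; exact: integrable_sqrt_rep.
have t1 : 0 < s / (2 * c) by rewrite divr_gt0 ?mulr_gt0.
have t2 : 0 < s / (4 * c)^-1 by rewrite divr_gt0// invr_gt0 mulr_gt0.
have yI := sqrt_young iw mI dI fI t1.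
have yE := sqrt_young iw mE dE fE t2.
have main := hj _ aJ; rewrite SJ in main.
rewrite aE in yE.
have qIq : qarea I <= q by rewrite -subr_ge0 -aE fine_ge0.
apply: (doubling_algebra c1 s0 q0 s2 Wsum WI0 WE0 _ _ qIq small yI yE main);
  by apply: Rintegral_ge0 => z _; exact: sqrtr_ge0.
Qed.

End doubling.

(** * Majorants of the maximal function *)

Section majorants.
Context {R : realType}.
Local Notation mu := (@area R).
Implicit Types (z : plane R) (I K A : set (plane R)) (a l s t : R) (w : plane R -> \bar R).

Lemma integral_rep_fin w A : integrable_weight w -> measurable A -> A `<=` @disc R ->
  (\int[mu]_(z in A) (rep w z)%:E = (\int[mu]_(z in A) rep w z)%:E)%E.
Proof.
move=> iw mA AD; rewrite /Rintegral fineK//.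
exact: (integrable_fin_num mA (integrable_rep iw mA AD)).
Qed.

Lemma integral_weight w A : integrable_weight w -> measurable A -> A `<=` @disc R ->
  (\int[mu]_(z in A) w z = (\int[mu]_(z in A) rep w z)%:E)%E.
Proof. by move=> iw mA AD; rewrite integral_rep_id ?integral_rep_fin//; case: iw. Qed.

Lemma avg_restrict w I K : integrable_weight w -> is_arc I -> is_arc K ->
  avg K (fun u => `|(w \_ (carleson I)) u|)%E =
  ((\int[mu]_(z in carleson K `&` carleson I) rep w z) / qarea K)%:E.
Proof.
move=> iw aI aK; have mI := measurable_carleson aI; have mK := measurable_carleson aK.
have sub : carleson K `&` carleson I `<=` @disc R by move=> z [[]].
rewrite /avg mulrC EFinM -integral_weight//; last exact: measurableI.
congr (_ * _)%E.
rewrite integral_mkcondr; apply: eq_integral => z _.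
rewrite /patch; case: ifPn => [/set_mem zI|]; last by rewrite abse0.
by rewrite gee0_abs//; case: iw => -[_ w0 _] _; apply: w0; exact: (carleson_disc zI).
Qed.

Lemma le_Rintegral_rep w A B : integrable_weight w -> measurable A -> measurable B ->
  A `<=` B -> B `<=` @disc R ->
  \int[mu]_(z in A) rep w z <= \int[mu]_(z in B) rep w z.
Proof.
move=> iw mA mB AB BD; rewrite -lee_fin -!integral_rep_fin//; last exact: subset_trans BD.
have mr : measurable_fun B (EFin \o rep w) by apply: measurable_repE; case: iw.
apply: (ge0_subset_integral mu mA mB mr _ AB).
by move=> z _; rewrite lee_fin ltW// rep_gt0.
Qed.

(** Squares at least e times as large as Q_I have averages bounded through the mass of
    Q_I.  A smaller one lies in Q_J and in a comparable dyadic cell, and half_jensen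
    compares its average with the square of the mean of sqrt w over that cell, hence
    with the maximal functions G of the two grids. *)
Lemma half_jensen_pointwise w (c e : R) I J : integrable_weight w -> 1 <= c ->
  half_jensen c w -> 0 < e -> e <= 3^-1 -> is_arc I -> is_arc J ->
  carleson I `<=` carleson J ->
  (forall K, is_arc K -> arclen K <= e * arclen I ->
     carleson I `&` carleson K !=set0 -> carleson K `<=` carleson J) ->
  exists G : plane R -> \bar R,
  [/\ measurable_fun (carleson I) G, (forall z, 0 <= G z)%E,
   (\int[mu]_(z in carleson I) G z <= 8%:E * \int[mu]_(z in carleson J) w z)%E &
   forall z, carleson I z ->
    (maximal (w \_ (carleson I)) z <=
      (2 / e ^+ 2 * (\int[mu]_(z in carleson I) rep w z) / qarea I)%:E +
      (c ^+ 2 * 72 ^+ 2)%:E * G z)%E].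
Proof.
move=> iw c1 hj e0 e3 aI aJ IJ small.
have ww : weight w by case: iw.
have mI := measurable_carleson aI; have mJ := measurable_carleson aJ.
have dI := @carleson_disc R I; have dJ := @carleson_disc R J.
pose f z : R := Num.sqrt (rep w z) * \1_(carleson J) z.
have f0 z : 0 <= f z by rewrite mulr_ge0// sqrtr_ge0.
have mf : measurable_fun setT f.
  apply: measurable_funM; first exact: measurable_sqrt_rep.
  exact: measurable_indic.
have f2 z : f z ^+ 2 = rep w z * \1_(carleson J) z.
  rewrite exprMn sqr_sqrtr ?(ltW (rep_gt0 _ _))// indicE.
  by case: (z \in _); rewrite ?expr1n// expr0n.
have f2J A : measurable A ->
    (\int[mu]_(z in A) (f z ^+ 2)%:E = \int[mu]_(z in A `&` carleson J) (rep w z)%:E)%E.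
  move=> mA; rewrite integral_mkcondr; apply: eq_integral => z _.
  rewrite f2 /patch indicE; case: ifP => _; first by rewrite mulr1.
  by rewrite mulr0.
have f2fin : (\int[mu]_z ((f z) ^+ 2)%:E < +oo)%E.
  by rewrite f2J// setTI integral_rep_fin// ltry.
have cfin s n k : (mu (cell s n k) < +oo)%E by rewrite area_cell ltry.
have cpos s n k : (0 < mu (cell s n k))%E.
  rewrite area_cell lte_fin mulr_gt0 ?disc_area_gt0//.
  have /andP[h0 h1] := @halfn_bound R n.
  by rewrite mulr_gt0 ?exprn_gt0// subr_gt0; apply: (le_lt_trans h1); rewrite ltr1n.
have dyadic s := @dyadic_maximal_L2 _ _ R mu (cell s) f (measurable_cell s) (cfin s) (cpos s)
   (@cell_subl R s) (@cell_subr R s) (@cell_disj R s) mf f0 f2fin.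
have [G0 [mG0 G00 G0c G0i]] := dyadic 0.
have [G1 [mG1 G10 G1c G1i]] := dyadic 3^-1.
have Icell s : carleson I `<=` cell s 0 0.
  move=> z [dz z0 Iz hz]; split; first exact/modulus_gt0.
  - exact: dz.
  - by rewrite expr0 gtrBl; exact/modulus_gt0.
  - rewrite [ltRHS](_ : _ = 2 * pi); last by rewrite expr0 mulr1.
    by case/andP : (ang_bound (2 * pi * (s + 0%:R * 2^-1 ^+ 0)) z).
have mGI s (G : plane R -> \bar R) : measurable_fun (cell s 0 0) G -> measurable_fun (carleson I) G.
  by move=> mG; exact: (measurable_funS (measurable_cell s 0 0) (Icell s) mG).
have Gint s (G : plane R -> \bar R) : measurable_fun (cell s 0 0) G -> (forall z, 0 <= G z)%E ->
  (\int[mu]_(z in cell s 0 0) G z <= 4%:E * \int[mu]_(z in cell s 0 0) (f z ^+ 2)%:E)%E ->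
  (\int[mu]_(z in carleson I) G z <= 4%:E * \int[mu]_(z in carleson J) w z)%E.
  move=> mG G_0 Gi.
  apply: (@le_trans _ _ (\int[mu]_(z in cell s 0 0) G z)%E).
    by apply: (ge0_subset_integral mu mI (measurable_cell s 0 0) mG) => // z _; exact: Icell.
  apply: (le_trans Gi); apply: lee_wpmul2l; first by rewrite lee_fin.
  rewrite f2J; last exact: measurable_cell.
  have mc : measurable (cell s 0 0 `&` carleson J) by apply: measurableI => //; exact: measurable_cell.
  rewrite (integral_rep_id ww mJ dJ).
  have mr : measurable_fun (carleson J) (EFin \o rep w) by exact: measurable_repE.
  apply: (ge0_subset_integral mu mc mJ mr); last by move=> z [].
  by move=> z _; rewrite lee_fin ltW// rep_gt0.
exists (fun z => G0 z + G1 z)%E; split.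
- by apply: emeasurable_funD; [exact: mGI mG0|exact: mGI mG1].
- by move=> z; rewrite adde_ge0.
- rewrite ge0_integralD//; [|exact: mGI mG0|exact: mGI mG1].
  apply: (le_trans (leeD (Gint _ _ mG0 G00 G0i) (Gint _ _ mG1 G10 G1i))).
  rewrite (integral_weight iw mJ dJ) -!EFinM -EFinD lee_fin -mulrDl.
  by rewrite (_ : 4 + 4 = 8 :> R)// -natrD.
move=> z Iz; apply: ge_ereal_sup => _ [K [aK Kz] <-].
rewrite avg_restrict//.
have mK := measurable_carleson aK; have dK := @carleson_disc R K.
have qK := qarea_gt0 aK; have qI := qarea_gt0 aI.
have mKI : measurable (carleson K `&` carleson I) by exact: measurableI.
have [big|sm] := leP (e * arclen I) (arclen K).
  apply: (@le_trans _ _ (2 / e ^+ 2 * (\int[mu]_(z in carleson I) rep w z) / qarea I)%:E); last first.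
    by rewrite leeDl// mule_ge0 ?adde_ge0// lee_fin mulr_ge0// sqr_ge0.
  rewrite lee_fin.
  apply: (@le_trans _ _ ((\int[mu]_(z in carleson I) rep w z) / qarea K)).
    rewrite ler_pM2r ?invr_gt0//; apply: le_Rintegral_rep => //.
  have WI0 : 0 <= \int[mu]_(z in carleson I) rep w z.
    by apply: Rintegral_ge0 => u _; rewrite ltW// rep_gt0.
  rewrite mulrAC [leRHS]mulrC; apply: ler_wpM2l => //.
  have e20 : 0 < e ^+ 2 by rewrite exprn_gt0.
  rewrite ler_pdivlMr// ler_pdivlMr// -mulrA mulrC ler_pdivrMr//.
  rewrite !qareaE//; have [/andP[l0 l1] _] := is_arcP aI; have [/andP[k0 k1] _] := is_arcP aK.
  have D0 := @disc_area_gt0 R.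
  move: (arclen I) (arclen K) (disc_area) l0 l1 k0 k1 D0 big => l k D l0 l1 k0 k1 D0 big.
  clear -e0 l0 l1 k0 k1 D0 big.
  rewrite -mulrA [leRHS]mulrCA ler_pM2l//.
  have h1 : (e * l) ^+ 2 <= k ^+ 2.
    by rewrite ler_pXn2r ?nnegrE// ?mulr_ge0// ltW.
  have h2 : l ^+ 2 * (2 - l) * e ^+ 2 <= 2 * (e * l) ^+ 2.
    rewrite exprMn; have : 0 <= l ^+ 2 * e ^+ 2 by rewrite mulr_ge0 ?sqr_ge0.
    by move=> h; nra.
  have h3 : k ^+ 2 <= k ^+ 2 * (2 - k) by rewrite ler_peMr ?sqr_ge0//; lra.
  by lra.
have KJ : carleson K `<=` carleson J.
  by apply: small => //; [exact: ltW|exists z].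
have k3 : arclen K <= 3^-1.
  have [/andP[l0 l1] _] := is_arcP aI; apply: ltW; apply: (lt_le_trans sm).
  by apply: le_trans e3; rewrite ler_piMr// ltW.
have [s [n [i [s01 iN Kcell acell]]]] := carleson_in_cell aK k3.
pose W := \int[mu]_(z in carleson K) rep w z.
pose S := \int[mu]_(z in carleson K) Num.sqrt (rep w z).
pose m := cell_mean mu (cell s) f n i.
have mG : (m%:E ^+ 2 <= G0 z + G1 z)%E.
  case: s01 => sE.
    apply: (@le_trans _ _ (G0 z)); last by rewrite leeDl.
    by rewrite /m sE; apply: G0c => //; rewrite -sE; exact: Kcell.
  apply: (@le_trans _ _ (G1 z)); last by rewrite leeDr.
  by rewrite /m sE; apply: G1c => //; rewrite -sE; exact: Kcell.
have S0 : 0 <= S by apply: Rintegral_ge0 => u _; exact: sqrtr_ge0.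
have Scell : S <= fine (\int[mu]_(z in cell s n i) (f z)%:E).
  have mC : measurable (cell s n i `&` carleson J).
    by apply: measurableI => //; exact: measurable_cell.
  have CD : cell s n i `&` carleson J `<=` @disc R by move=> u [_ /dJ].
  have KC : carleson K `<=` cell s n i `&` carleson J.
    by move=> u Ku; split; [exact: Kcell|exact: KJ].
  have Cfin : (mu (cell s n i `&` carleson J) < +oo)%E.
    apply: le_lt_trans (cfin s n i); apply: le_measure; rewrite ?inE//.
    exact: measurable_cell.
  have -> : (\int[mu]_(z in cell s n i) (f z)%:E =
      \int[mu]_(z in cell s n i `&` carleson J) (Num.sqrt (rep w z))%:E)%E.
    rewrite integral_mkcondr; apply: eq_integral => u _.
    rewrite /f /patch indicE; case: ifP => _; first by rewrite mulr1.
    by rewrite mulr0.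
  have iC := integrable_sqrt_rep iw mC CD Cfin.
  have iK := integrable_sqrt_rep iw mK dK (area_carleson_fin aK).
  apply: fine_le; [exact: (integrable_fin_num mK iK)|exact: (integrable_fin_num mC iC)|].
  apply: (ge0_subset_integral mu mK mC (measurable_int _ iC) _ KC).
  by move=> u _; rewrite lee_fin sqrtr_ge0.
have Vpos : 0 < fine (mu (cell s n i)).
  by apply: fine_gt0; rewrite cpos cfin.
have Sm : S / qarea K <= 72 * m.
  rewrite ler_pdivrMr// /m /cell_mean; apply: (le_trans Scell).
  set F := fine _ in Scell *; set V := fine _ in acell Vpos *.
  have F0 : 0 <= F by exact: le_trans Scell.
  rewrite (_ : 72 * (F / V) * qarea K = F * (72 * qarea K / V)); last by ring.
  by apply: ler_peMr => //; rewrite ler_pdivlMr// mul1r.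
apply: (@le_trans _ _ (W / qarea K)%:E).
  rewrite lee_fin ler_pM2r ?invr_gt0//; apply: le_Rintegral_rep => //.
apply: (@le_trans _ _ ((c ^+ 2 * 72 ^+ 2)%:E * (m ^+ 2)%:E)%E); last first.
  apply: (@le_trans _ _ ((c ^+ 2 * 72 ^+ 2)%:E * (G0 z + G1 z))%E).
    by apply: lee_wpmul2l => //; rewrite lee_fin mulr_ge0// sqr_ge0.
  rewrite leeDr// lee_fin; apply: divr_ge0; last exact: ltW.
  rewrite mulr_ge0 ?divr_ge0 ?sqr_ge0//.
  by apply: Rintegral_ge0 => u _; rewrite ltW// rep_gt0.
rewrite -EFinM lee_fin -mulrA -exprMn.
have := hj _ aK; rewrite -/W -/S => hK.
apply: (@le_trans _ _ (c ^+ 2 * (S / qarea K) ^+ 2)).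
  by rewrite expr_div_n mulrA ler_pdivlMr ?exprn_gt0// expr2 mulrA divfK// gt_eqF.
apply: ler_wpM2l; first exact: sqr_ge0.
have m0 : 0 <= 72 * m by apply: le_trans Sm; rewrite divr_ge0// ltW.
by rewrite ler_pXn2r ?nnegrE// divr_ge0// ltW.
Qed.

End majorants.

(** * The true inclusions *)

Section implications.
Context {R : realType}.
Local Notation mu := (@area R).
Implicit Types (z : plane R) (I K A : set (plane R)) (a l s t : R) (w : plane R -> \bar R).

Lemma half_jensen_Binfty w (c : R) : integrable_weight w -> 1 <= c ->
  half_jensen c w -> Binfty w.
Proof.
move=> iw c1 hj; split => //.
have c0 : 0 < c := lt_le_trans ltr01 c1.
have c20 : 0 < c ^+ 2 by rewrite exprn_gt0.
have c21 : 1 <= c ^+ 2 by rewrite expr2 mulr_ege1.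
pose e := (64 * c ^+ 2)^-1.
have e0 : 0 < e by rewrite invr_gt0 mulr_gt0.
have ce : c ^+ 2 * e = 64^-1 by rewrite /e invfM mulrCA mulfV ?gt_eqF// mulr1.
have e64 : e <= 64^-1 by rewrite -ce ler_peMl// ltW.
have e3 : e <= 3^-1 by apply: (le_trans e64); rewrite lef_pV2 ?posrE ?ltr0n// ler_nat.
pose k1 := 2 / e ^+ 2; pose k2 := c ^+ 2 * 72 ^+ 2.
have k10 : 0 < k1 by rewrite divr_gt0 ?exprn_gt0.
have k20 : 0 < k2 by rewrite mulr_gt0 ?exprn_gt0.
exists (k1 + k2 * (8 * (2 * c ^+ 2))).
  by rewrite addr_gt0// !mulr_gt0.
move=> I aI.
have [J [aJ IJ small qJ]] := enlarged_arc aI e0.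
have mI := measurable_carleson aI; have mJ := measurable_carleson aJ.
have dI := @carleson_disc R I; have dJ := @carleson_disc R J.
have qI0 := qarea_gt0 aI.
(* e is chosen so that 4 e is the tolerance (4 c)^-2 of half_jensen_doubling. *)
have gap : qarea J - qarea I <= (4 * c)^-1 ^+ 2 * qarea J.
  have -> : (4 * c)^-1 ^+ 2 = 4 * e.
    by rewrite /e; field; rewrite gt_eqF.
  have h : (1 - 4 * e) * qarea J <= (1 - 4 * e) * ((1 + 2 * e) ^+ 2 * qarea I).
    by apply: ler_wpM2l => //; lra.
  have h2 : (1 - 4 * e) * (1 + 2 * e) ^+ 2 <= 1.
    have e20 : 0 <= e ^+ 2 by exact: sqr_ge0.
    have e30 : 0 <= e ^+ 2 * e by rewrite mulr_ge0// ltW.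
    have -> : (1 - 4 * e) * (1 + 2 * e) ^+ 2 = 1 - 12 * e ^+ 2 - 16 * (e ^+ 2 * e) by ring.
    by lra.
  have h3 := ler_wpM2r (ltW qI0) h2; rewrite mul1r -mulrA in h3.
  have h4 := le_trans h h3; rewrite mulrBl mul1r in h4.
  by rewrite lerBlDl -lerBlDr.
have WJ := half_jensen_doubling iw c1 hj aI aJ IJ gap.
have [G [mG G0 Gint Gpt]] := half_jensen_pointwise iw c1 hj e0 e3 aI aJ IJ small.
set WI := \int[mu]_(z in carleson I) rep w z in WJ Gpt.
set V := k1 * WI / qarea I in Gpt.
have WI0 : 0 <= WI by apply: Rintegral_ge0 => z _; rewrite ltW// rep_gt0.
have V0 : 0 <= V := divr_ge0 (mulr_ge0 (ltW k10) WI0) (ltW qI0).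
apply: (@le_trans _ _ (\int[mu]_(z in carleson I) (cst V%:E z + k2%:E * G z))%E).
  apply: le_integral_lower => z Iz; last exact: Gpt.
  apply: (@le_trans _ _ (avg I (fun u => `|(w \_ (carleson I)) u|)%E)); last first.
    by apply: ereal_sup_ubound; exists I.
  rewrite avg_restrict// lee_fin divr_ge0//; last exact: ltW.
  by apply: Rintegral_ge0 => u _; rewrite ltW// rep_gt0.
have mkG : measurable_fun (carleson I) (fun z => k2%:E * G z)%E by exact: measurable_funeM.
have kG0 z : carleson I z -> (0 <= k2%:E * G z)%E.
  by move=> _; rewrite mule_ge0// lee_fin ltW.
have V0' z : carleson I z -> (0 <= cst V%:E z)%E by rewrite lee_fin.
rewrite (ge0_integralD mu mI V0' (measurable_cst _) kG0 mkG).
rewrite (ge0_integralZl_EFin mu mI (fun z _ => G0 z) mG (ltW k20)).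
rewrite (integral_cst mu mI) (area_carlesonE aI) (integral_weight iw mI dI) -/WI.
rewrite (integral_weight iw mJ dJ) -EFinM in Gint.
have k2e : (0 <= k2%:E)%E by rewrite lee_fin ltW.
apply: (le_trans (leeD (lexx _) (lee_wpmul2l k2e Gint))).
rewrite -!EFinM -EFinD lee_fin.
rewrite {1}/V divfK ?gt_eqF// [leRHS]mulrDl lerD2l -[leRHS]mulrA ler_pM2l//.
by rewrite -[leRHS]mulrA ler_pM2l.
Qed.

Lemma measurable_lne : measurable_fun setT (@lne R).
Proof.
rewrite (_ : @lne R = (fun x => if (x == +oo)%E then +oo%E else
    if (x <= 0)%E then -oo%E else (ln (fine x))%:E)); last first.
  apply/funext => -[r||]//=.
  by rewrite leNye.
apply: measurable_fun_ifT; first exact: (measurable_fun_eqe (@measurable_id _ _ setT) (measurable_cst _)).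
  exact: measurable_cst.
apply: measurable_fun_ifT; first exact: (measurable_fun_lee (@measurable_id _ _ setT) (measurable_cst _)).
  exact: measurable_cst.
apply/measurable_EFinP.
exact: (measurableT_comp (@measurable_ln R) (fine_measurable measurableT)).
Qed.

(** Comparing positive and negative parts separately makes this valid for integrals
    with values in the extended reals. *)
Lemma le_integral_signed A (f g : plane R -> \bar R) : measurable A ->
  measurable_fun A f -> measurable_fun A g -> (forall z, A z -> f z <= g z)%E ->
  (\int[mu]_(z in A) f z <= \int[mu]_(z in A) g z)%E.
Proof.
move=> mA mf mg fg; rewrite integralE [leRHS]integralE; apply: leeB.
  apply: ge0_le_integral => //; [exact: measurable_funepos|exact: measurable_funepos|].
  by move=> z Az; rewrite !funeposE ge_max !le_max fg//= lexx orbT.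
apply: ge0_le_integral => //; [exact: measurable_funeneg|exact: measurable_funeneg|].
by move=> z Az; rewrite !funenegE ge_max !le_max leeN2 fg//= lexx orbT.
Qed.

Lemma Rintegral_gt0 A (f : plane R -> R) : measurable A -> (0 < mu A)%E ->
  (forall z, 0 < f z) -> mu.-integrable A (EFin \o f) -> 0 < \int[mu]_(z in A) f z.
Proof.
move=> mA A0 f0 fi; rewrite lt_neqAle; apply/andP; split; last first.
  by apply: Rintegral_ge0 => z _; exact: ltW.
apply/eqP => E.
have : (\int[mu]_(z in A) `|(EFin \o f) z| = 0)%E.
  rewrite -[RHS]/(0%:E) E /Rintegral fineK; last exact: integrable_fin_num.
  by apply: eq_integral => z _; rewrite /= ger0_norm// ltW.
have mf : measurable_fun A (EFin \o f) := measurable_int _ fi.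
move/(ae_eq_integral_abs mu mA mf) => [N [mN N0 AN]].
have : (mu A <= mu N)%E.
  apply: le_measure; rewrite ?inE// => z Az; apply: AN => /= /(_ Az) [fz].
  by have := f0 z; rewrite fz ltxx.
by rewrite N0 leNgt A0.
Qed.

(** The right-hand side of Jensen's inequality: the function integrated is k times the
    tangent of the logarithm at the mean m, evaluated at f. *)
Lemma jensen_bound A (f : plane R -> R) (m k : R) : measurable A -> (mu A < +oo)%E ->
  measurable_fun setT f -> mu.-integrable A (EFin \o f) -> 0 < m ->
  \int[mu]_(z in A) f z = m * fine (mu A) ->
  mu.-integrable A (EFin \o (fun z => k * (ln m - 1) + k / m * f z)) /\
  \int[mu]_(z in A) (k * (ln m - 1) + k / m * f z) = k * ln m * fine (mu A).
Proof.
move=> mA Afin mf fi m0 fm.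
have i1 := integrable_one mA Afin (k * (ln m - 1)).
have i2 : mu.-integrable A (EFin \o (fun z => k / m * f z)).
  by apply: eq_integrable (integrableZl mA (k / m) fi).
split; first by apply: eq_integrable (integrableD mA i1 i2).
rewrite (RintegralD mA i1 i2) (Rintegral_cst mu mA) (RintegralZl _ mA fi) fm.
by field; rewrite gt_eqF.
Qed.

Lemma ln_le_tangent (x m : R) : 0 < x -> 0 < m -> ln x <= ln m - 1 + x / m.
Proof.
move=> x0 m0; have xm : 0 < x / m by rewrite divr_gt0.
have := @le_ln1Dx R (x / m - 1); rewrite addrCA subrr addr0 ln_div ?posrE// => h.
by have := h (ltac:(lra)); lra.
Qed.

Lemma avg_weight w I : integrable_weight w -> is_arc I ->
  avg I w = ((\int[mu]_(z in carleson I) rep w z) / qarea I)%:E.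
Proof.
move=> iw aI; rewrite /avg (integral_weight iw (measurable_carleson aI) (@carleson_disc R I)).
by rewrite -EFinM mulrC.
Qed.

Lemma avg_lne w I : weight w -> is_arc I ->
  avg I (fun z => lne (w z)) =
  ((qarea I)^-1%:E * \int[mu]_(z in carleson I) (ln (rep w z))%:E)%E.
Proof.
move=> ww aI; rewrite /avg.
rewrite (integral_rep ww measurable_lne (measurable_carleson aI) (@carleson_disc R I)).
by congr (_ * _)%E; apply: eq_integral => z _; rewrite lne_EFin// rep_gt0.
Qed.

Lemma avg_poweR w I (p : R) : weight w -> is_arc I ->
  avg I (fun z => poweR (w z) p) =
  ((qarea I)^-1%:E * \int[mu]_(z in carleson I) (powR (rep w z) p)%:E)%E.
Proof.
move=> ww aI; rewrite /avg.
by rewrite (integral_rep ww (measurable_poweR p) (measurable_carleson aI) (@carleson_disc R I)).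
Qed.

Lemma weight_mass_gt0 w I : integrable_weight w -> is_arc I ->
  0 < \int[mu]_(z in carleson I) rep w z.
Proof.
move=> iw aI; apply: Rintegral_gt0.
- exact: measurable_carleson.
- by rewrite area_carlesonE// lte_fin qarea_gt0.
- exact: rep_gt0.
- apply: integrable_rep => //; [exact: measurable_carleson|exact: carleson_disc].
Qed.

Lemma sqrt_mass_gt0 w I : integrable_weight w -> is_arc I ->
  0 < \int[mu]_(z in carleson I) Num.sqrt (rep w z).
Proof.
move=> iw aI; apply: Rintegral_gt0.
- exact: measurable_carleson.
- by rewrite area_carlesonE// lte_fin qarea_gt0.
- by move=> z; rewrite sqrtr_gt0 rep_gt0.
- apply: integrable_sqrt_rep => //; [exact: measurable_carleson|exact: carleson_disc|].
  exact: area_carleson_fin.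
Qed.

Lemma measurable_ln_rep w A : weight w -> measurable_fun A (fun z => (ln (rep w z))%:E).
Proof.
move=> ww; apply: measurable_funTS; apply/measurable_EFinP.
exact: (measurableT_comp (@measurable_ln R) (measurable_rep ww)).
Qed.

(** Jensen's inequality for sqrt w: the logarithm of w is twice that of sqrt w. *)
Lemma RJ_sub_Binfty : (@RJ R) `<=` Binfty.
Proof.
move=> w [iw [C C0 hC]]; have ww : weight w by case: iw.
pose c := Num.max 1 C.
have c1 : 1 <= c by rewrite le_max lexx.
have Cc : C <= c ^+ 2.
  have : C <= c by rewrite le_max lexx orbT.
  by move=> h; apply: (le_trans h); rewrite expr2 ler_peMr//; exact: le_trans c1.
apply: (half_jensen_Binfty iw c1) => I aI.
have mI := measurable_carleson aI; have dI := @carleson_disc R I.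
have fI := area_carleson_fin aI; have q0 := qarea_gt0 aI.
have S0 := sqrt_mass_gt0 iw aI.
have iS := integrable_sqrt_rep iw mI dI fI.
set S := \int[mu]_(z in carleson I) _ in S0 *.
have := hC I aI; rewrite avg_weight// avg_lne//.
set W := \int[mu]_(z in carleson I) rep w z => h.
have m0 : 0 < S / qarea I by rewrite divr_gt0.
have Sm : S = S / qarea I * fine (mu (carleson I)) by rewrite divfK// gt_eqF.
have [ig Eg] := jensen_bound 2 mI fI (measurable_sqrt_rep ww) iS m0 Sm.
have L : (\int[mu]_(z in carleson I) (ln (rep w z))%:E <=
    (2 * ln (S / qarea I) * qarea I)%:E)%E.
  rewrite -Eg /Rintegral fineK; last exact: (integrable_fin_num mI ig).
  apply: (le_integral_signed mI (measurable_ln_rep ww) (measurable_int _ ig)) => z _ /=.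
  rewrite lee_fin; have r0 := rep_gt0 w z.
  have s0 : 0 < Num.sqrt (rep w z) by rewrite sqrtr_gt0.
  have := ln_le_tangent s0 m0.
  have -> : ln (rep w z) = 2 * ln (Num.sqrt (rep w z)).
    by rewrite -{1}(sqr_sqrtr (ltW r0)) lnXn// mulr_natl.
  move: (S / qarea I) (Num.sqrt _) => m s; rewrite (_ : 2 / m * s = 2 * (s / m)); last by ring.
  by move: (s / m) (ln m) (ln s) => x y u; clear; lra.
have {h} : ((W / qarea I)%:E <= C%:E * ((S / qarea I) ^+ 2)%:E)%E.
  apply: (le_trans h); apply: lee_wpmul2l; first by rewrite lee_fin ltW.
  apply: (@le_trans _ _ (expeR (2 * ln (S / qarea I))%:E)).
    rewrite lee_expeR.
    have qi : (0 <= (qarea I)^-1%:E)%E by rewrite lee_fin invr_ge0 ltW.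
    apply: (le_trans (lee_wpmul2l qi L)).
    by rewrite -EFinM lee_fin mulrC mulfK// gt_eqF.
  by rewrite /= lee_fin mulr_natl -lnXn// lnK// posrE exprn_gt0.
rewrite -EFinM lee_fin ler_pdivrMr// => h.
apply: (@le_trans _ _ (C * (S / qarea I) ^+ 2 * qarea I * qarea I)).
  by rewrite ler_pM2r.
have -> : C * (S / qarea I) ^+ 2 * qarea I * qarea I = C * S ^+ 2 by field; rewrite gt_eqF.
by rewrite ler_pM2r// exprn_gt0.
Qed.

End implications.

Section power_classes.
Context {R : realType}.
Local Notation mu := (@area R).
Implicit Types (z : plane R) (I K A : set (plane R)) (a l s t : R) (w : plane R -> \bar R).

Lemma measurable_powR_rep w (p : R) : weight w -> measurable_fun setT (fun z => powR (rep w z) p).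
Proof. by move=> ww; exact: (measurableT_comp (measurable_powR p) (measurable_rep ww)). Qed.

Lemma integrable_powR_rep w (p : R) A : weight w -> measurable A ->
  (\int[mu]_(z in A) (powR (rep w z) p)%:E < +oo)%E ->
  mu.-integrable A (EFin \o (fun z => powR (rep w z) p)).
Proof.
move=> ww mA fin; apply/integrableP; split.
  by apply: measurable_funTS; apply/measurable_EFinP; exact: measurable_powR_rep.
apply: le_lt_trans fin; rewrite le_eqVlt; apply/orP; left; apply/eqP.
by apply: eq_integral => z _; rewrite /= ger0_norm// powR_ge0.
Qed.

Lemma powR_mass_ge0 w (p : R) A : (0 <= \int[mu]_(z in A) (powR (rep w z) p)%:E)%E.
Proof. by apply: integral_ge0 => z _; rewrite lee_fin powR_ge0. Qed.

(** The first term dominates where v <= t and the second one where v >= t. *)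
Lemma sqrt_interpolation (v t r : R) : 0 < v -> 0 < t -> 1 < r ->
  v <= Num.sqrt t * Num.sqrt v + powR t (1 - r) * powR v r.
Proof.
move=> v0 t0 r1.
have [vt|tv] := leP v t.
  apply: (@le_trans _ _ (Num.sqrt t * Num.sqrt v)); last first.
    by rewrite lerDl mulr_ge0// powR_ge0.
  rewrite -{1}(sqr_sqrtr (ltW v0)) expr2 ler_pM2r ?sqrtr_gt0//.
  exact: ler_wsqrtr.
apply: (@le_trans _ _ (powR t (1 - r) * powR v r)); last first.
  by rewrite lerDr mulr_ge0// sqrtr_ge0.
rewrite -(mulr_powRB1 (ltW v0)) ?(lt_trans _ r1)// -opprB powRN mulrCA.
have tr0 : 0 < powR t (r - 1) by rewrite powR_gt0.
rewrite ler_peMr ?(ltW v0)// mulrC ler_pdivlMr// mul1r.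
by apply: ge0_ler_powR; rewrite ?nnegrE ?subr_ge0 ?ltW.
Qed.

Lemma pinfty_scaled (q : R) : 0 < q -> (q^-1%:E * +oo = +oo :> \bar R)%E.
Proof. by move=> q0; rewrite gt0_muley// lte_fin invr_gt0. Qed.

(** With t := L A, where A is the mean of w, reverse Hoelder bounds the second term of
    sqrt_interpolation by half of the mass of w, for L large.  The other half is then
    bounded by sqrt (L A) times the integral of sqrt w. *)
Lemma RH_sub_Binfty : (@RH R) `<=` Binfty.
Proof.
move=> w [iw [r r1 [C C0 hC]]]; have ww : weight w by case: iw.
have r0 : 0 < r := lt_trans ltr01 r1.
have r10 : 0 < r - 1 by rewrite subr_gt0.
have Cr0 : 0 < powR C r by rewrite powR_gt0.
(* the solution of L^(1 - r) * C^r = 1 / 2 *)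
pose L := powR (2 * powR C r) (r - 1)^-1.
have L0 : 0 < L by rewrite powR_gt0// mulr_gt0.
have LC : powR L (1 - r) * powR C r = 2^-1.
  rewrite -opprB powRN /L -powRrM mulVf ?gt_eqF// powRr1 ?mulr_ge0 ?ltW//.
  by rewrite invfM -mulrA mulVf ?gt_eqF// mulr1.
(* From W / 2 <= sqrt (L A) S it follows that W q <= 4 L S^2, where A = W / q. *)
pose c := Num.max 1 (2 * Num.sqrt L).
have c1 : 1 <= c by rewrite le_max lexx.
have Lc : 4 * L <= c ^+ 2.
  have h : 2 * Num.sqrt L <= c by rewrite le_max lexx orbT.
  have s0 : 0 <= 2 * Num.sqrt L by rewrite mulr_ge0// sqrtr_ge0.
  have -> : 4 * L = (2 * Num.sqrt L) ^+ 2.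
    by rewrite exprMn sqr_sqrtr ?ltW// -natrX.
  by rewrite ler_pXn2r ?nnegrE//; exact: le_trans h.
apply: (half_jensen_Binfty iw c1) => I aI.
have mI := measurable_carleson aI; have dI := @carleson_disc R I.
have fI := area_carleson_fin aI; have q0 := qarea_gt0 aI.
have W0 := weight_mass_gt0 iw aI.
have S0 := sqrt_mass_gt0 iw aI.
have iS := integrable_sqrt_rep iw mI dI fI.
have iW := integrable_rep iw mI dI.
have := hC I aI; rewrite (avg_weight iw aI) (avg_poweR r ww aI).
have fin : (\int[mu]_(z in carleson I) (powR (rep w z) r)%:E < +oo)%E ->
    mu.-integrable (carleson I) (EFin \o (fun z => powR (rep w z) r)).
  exact: integrable_powR_rep.
have X0 := powR_mass_ge0 w r (carleson I).
set S := \int[mu]_(z in carleson I) Num.sqrt _ in S0 *.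
set W := \int[mu]_(z in carleson I) rep w z in W0 *.
case EX : (\int[mu]_(z in carleson I) (powR (rep w z) r)%:E)%E => [x||].
- rewrite EX lee_fin in X0; have iP := fin (ltac:(by rewrite EX ltry)) => {fin}.
  pose A := W / qarea I; have A0 : 0 < A by rewrite divr_gt0.
  rewrite -EFinM poweR_EFin -EFinM lee_fin -/A => h.
  have hx : (qarea I)^-1 * x <= powR C r * powR A r.
    have B0 : 0 <= (qarea I)^-1 * x by rewrite mulr_ge0// invr_ge0 ltW.
    rewrite -(powRM r (ltW C0) (ltW A0)).
    rewrite -[leLHS](powRr1 B0) -(mulVf (lt0r_neq0 r0)) powRrM.
    apply: ge0_ler_powR h; first exact: ltW.
      by rewrite nnegrE powR_ge0.
    by rewrite nnegrE; apply: mulr_ge0; exact: ltW.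
  pose t := L * A; have t0 : 0 < t by rewrite mulr_gt0.
  have main : W <= Num.sqrt t * S + powR t (1 - r) * x.
    have i1 : mu.-integrable (carleson I) (EFin \o (fun z => Num.sqrt t * Num.sqrt (rep w z))).
      by apply: eq_integrable (integrableZl mI (Num.sqrt t) iS).
    have i2 : mu.-integrable (carleson I) (EFin \o (fun z => powR t (1 - r) * powR (rep w z) r)).
      by apply: eq_integrable (integrableZl mI (powR t (1 - r)) iP).
    have -> : x = \int[mu]_(z in carleson I) powR (rep w z) r by rewrite /Rintegral EX.
    rewrite /S -(RintegralZl _ mI iS) -(RintegralZl _ mI iP) -(RintegralD mI i1 i2).
    apply: (le_Rintegral mI iW); first by apply: eq_integrable (integrableD mI i1 i2).
    by move=> z _; apply: sqrt_interpolation => //; exact: rep_gt0.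
  have tx : powR t (1 - r) * x <= W / 2.
    have x_le : x <= qarea I * (powR C r * powR A r).
      by rewrite -ler_pdivrMl.
    apply: (le_trans (ler_wpM2l (powR_ge0 _ _) x_le)).
    rewrite /t (powRM _ (ltW L0) (ltW A0)).
    have -> : powR L (1 - r) * powR A (1 - r) * (qarea I * (powR C r * powR A r)) =
      (powR L (1 - r) * powR C r) * (powR A (1 - r) * powR A r) * qarea I by ring.
    rewrite LC -powRD; last by rewrite (gt_eqF A0) implybT.
    rewrite subrK (powRr1 (ltW A0)).
    suff -> : 2^-1 * A * qarea I = W / 2 by [].
    by rewrite /A; field; rewrite gt_eqF.
  have h2 : W / 2 <= Num.sqrt t * S by move: main tx; clear; lra.
  have h3 : (W / 2) ^+ 2 <= t * S ^+ 2.
    have a1 : 0 <= W / 2 by rewrite divr_ge0// ltW.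
    have a2 : 0 <= Num.sqrt t * S by rewrite mulr_ge0 ?sqrtr_ge0// ltW.
    by rewrite -(sqr_sqrtr (ltW t0)) -exprMn ler_pXn2r.
  apply: (@le_trans _ _ (4 * L * S ^+ 2)); last by rewrite ler_pM2r ?exprn_gt0.
  rewrite -(ler_pM2l A0).
  have -> : A * (W * qarea I) = 4 * (W / 2) ^+ 2 by rewrite /A; field; rewrite gt_eqF.
  have -> : A * (4 * L * S ^+ 2) = 4 * (t * S ^+ 2) by rewrite /t; ring.
  by rewrite ler_pM2l.
- by rewrite pinfty_scaled// poweRyr ?gt_eqF ?invr_gt0.
- by move: X0; rewrite EX.
Qed.

(** Jensen's inequality for w^(1 - p'), whose logarithm is - log w / (p - 1). *)
Lemma Bp_sub_RJ (p : R) : 1 < p -> (@Bp R p) `<=` RJ.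
Proof.
move=> p1 w [iw [C C0 hC]]; have ww : weight w by case: iw.
split => //; exists C => // I aI.
have p10 : 0 < p - 1 by rewrite subr_gt0.
have mI := measurable_carleson aI; have dI := @carleson_disc R I.
have fI := area_carleson_fin aI; have q0 := qarea_gt0 aI.
have W0 := weight_mass_gt0 iw aI.
have := hC I aI; set r := 1 - p / (p - 1).
rewrite /= (avg_poweR r ww aI) (avg_weight iw aI) => hB; rewrite (avg_lne ww aI); move: hB.
have rE : (p - 1) * r = -1 by rewrite /r; field; rewrite gt_eqF.
have fin : (\int[mu]_(z in carleson I) (powR (rep w z) r)%:E < +oo)%E ->
    mu.-integrable (carleson I) (EFin \o (fun z => powR (rep w z) r)).
  exact: integrable_powR_rep.
have X0 := powR_mass_ge0 w r (carleson I).
set W := \int[mu]_(z in carleson I) rep w z in W0 *.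
have A0 : 0 < W / qarea I by rewrite divr_gt0.
case EX : (\int[mu]_(z in carleson I) (powR (rep w z) r)%:E)%E => [x||].
- rewrite EX lee_fin in X0; have iP := fin (ltac:(by rewrite EX ltry)) => {fin}.
  have xE : x = \int[mu]_(z in carleson I) powR (rep w z) r by rewrite /Rintegral EX.
  have x0 : 0 < x.
    rewrite xE; apply: Rintegral_gt0 => //.
      by rewrite area_carlesonE// lte_fin.
    by move=> z; rewrite powR_gt0// rep_gt0.
  pose m := x / qarea I; have m0 : 0 < m by rewrite divr_gt0.
  have xm : \int[mu]_(z in carleson I) powR (rep w z) r = m * fine (mu (carleson I)).
    by rewrite -xE divfK// gt_eqF.
  have [ig Eg] := jensen_bound (- (p - 1)) mI fI (measurable_powR_rep r ww) iP m0 xm.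
  have L : ((- (p - 1) * ln m * qarea I)%:E <=
      \int[mu]_(z in carleson I) (ln (rep w z))%:E)%E.
    rewrite -Eg /Rintegral fineK; last exact: (integrable_fin_num mI ig).
    apply: (le_integral_signed mI (measurable_int _ ig) (measurable_ln_rep ww)) => z _ /=.
    rewrite lee_fin; have v0 := rep_gt0 w z.
    have f0 : 0 < powR (rep w z) r by rewrite powR_gt0.
    have := ln_le_tangent f0 m0.
    have -> : ln (rep w z) = - (p - 1) * ln (powR (rep w z) r).
      by rewrite ln_powR mulrA mulNr rE opprK mul1r.
    move: (powR _ _) => f; rewrite (_ : - (p - 1) / m * f = - (p - 1) * (f / m)); last by ring.
    rewrite -mulrDr => h; apply: ler_wnM2l => //.
    by rewrite oppr_le0 ltW.
  rewrite -(EFinM (qarea I)^-1 x) poweR_EFin -EFinM lee_fin [_ * x]mulrC -/m => h.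
  apply: (@le_trans _ _ (C * (powR m (p - 1))^-1)%:E).
    by rewrite lee_fin ler_pdivlMr ?powR_gt0.
  rewrite EFinM; apply: lee_wpmul2l; first by rewrite lee_fin ltW.
  apply: (@le_trans _ _ (expeR (- (p - 1) * ln m)%:E)).
    by rewrite -powRN /powR gt_eqF//= lee_fin.
  rewrite lee_expeR.
  have qi : (0 <= (qarea I)^-1%:E)%E by rewrite lee_fin invr_ge0 ltW.
  apply: le_trans (lee_wpmul2l qi L).
  by rewrite -EFinM lee_fin [leRHS]mulrC mulfK// gt_eqF.
- by rewrite pinfty_scaled// poweRyr ?gt_eqF// gt0_muley ?lte_fin.
- by move: X0; rewrite EX.
Qed.

(** On Q_I the weight is almost everywhere at least its mean divided by C. *)
Lemma B1_sub_Bp (p : R) : 1 < p -> (@B1 R) `<=` Bp p.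
Proof.
move=> p1 w [iw [C C0 hC]]; have ww : weight w by case: iw.
split => //; exists C => // I aI.
have p10 : 0 < p - 1 by rewrite subr_gt0.
have mI := measurable_carleson aI; have dI := @carleson_disc R I.
have fI := area_carleson_fin aI; have q0 := qarea_gt0 aI.
have W0 := weight_mass_gt0 iw aI.
have := hC I aI; set r := 1 - p / (p - 1).
rewrite (avg_weight iw aI).
have rE : r * (p - 1) = -1 by rewrite /r; field; rewrite gt_eqF.
have r0 : r <= 0 by rewrite -(pmulr_lle0 _ p10) rE; lra.
set W := \int[mu]_(z in carleson I) rep w z in W0 *.
move=> h; rewrite /= -/r (avg_poweR r ww aI).
have A0 : 0 < W / qarea I by rewrite divr_gt0.
pose d := W / qarea I / C.
have d0 : 0 < d by rewrite divr_gt0.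
have hd : (d%:E <= ess_inf_on (carleson I) w)%E.
  by rewrite -(@lee_pmul2l _ C%:E)// -EFinM /d mulrC divfK// gt_eqF.
have ae : {ae mu, forall z, carleson I z -> powR (rep w z) r <= powR d r}.
  have wd := ess_inf_le mu (patch (cst +oo%E) (carleson I) w).
  have wr := repE ww.
  apply: filterS2 wd wr => z h1 h2 Iz.
  rewrite /patch mem_set// h2 in h1; last exact: dI.
  have : (d%:E <= (rep w z)%:E)%E by exact: le_trans hd h1.
  rewrite lee_fin => dw.
  have rr : r = - (- r) by rewrite opprK.
  rewrite rr !(powRN _ (- r)) lef_pV2 ?posrE ?powR_gt0 ?rep_gt0//.
  apply: ge0_ler_powR dw; first by rewrite oppr_ge0.
    by rewrite nnegrE ltW.
  by rewrite nnegrE ltW// rep_gt0.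
have L : (\int[mu]_(z in carleson I) (powR (rep w z) r)%:E <= (powR d r * qarea I)%:E)%E.
  apply: (@le_trans _ _ (\int[mu]_(z in carleson I) (cst (powR d r)%:E z))%E); last first.
    by rewrite integral_cst// area_carlesonE.
  have mp : measurable_fun (carleson I) (fun z => (powR (rep w z) r)%:E).
    by apply: measurable_funTS; apply/measurable_EFinP; exact: measurable_powR_rep.
  apply: (@ae_ge0_le_integral _ _ _ mu _ mI _ _ _ mp _ (measurable_cst _)).
  - by move=> z _; rewrite lee_fin powR_ge0.
  - by move=> z _; rewrite lee_fin powR_ge0.
  - by apply: filterS ae => z h1 Iz; rewrite lee_fin h1.
have X0 := powR_mass_ge0 w r (carleson I).
move: X0 L; case: (\int[mu]_(z in carleson I) (powR (rep w z) r)%:E)%E => [x||]//.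
rewrite !lee_fin => x0 xd.
apply: (@le_trans _ _ (W / qarea I * powR (powR d r) (p - 1))).
  rewrite ler_pM2l//; apply: ge0_ler_powR.
  - exact: ltW.
  - by rewrite nnegrE mulr_ge0// invr_ge0 ltW.
  - by rewrite nnegrE powR_ge0.
  - by rewrite mulrC ler_pdivrMr.
rewrite -powRrM rE powR_inv1 ?(ltW d0)// /d invfM invrK mulrA divff ?mul1r//.
by rewrite gt_eqF.
Qed.

End power_classes.

(** * Dyadic annuli around the origin *)

Section radial.
Context {R : realType}.
Local Notation mu := (@area R).
Implicit Types (z : plane R) (I K A : set (plane R)) (a l s t : R) (w : plane R -> \bar R).
Implicit Types (g h : nat -> R).

Definition annulus r1 r2 : set (plane R) :=
  [set z | [/\ 0 < modulus z, r1 < modulus z & modulus z < r2]].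

Lemma measurable_annulus r1 r2 : measurable (annulus r1 r2).
Proof.
have mm := @measurable_modulus_plane R.
rewrite (_ : annulus r1 r2 = [set z : plane R | 0 < modulus z] `&`
  ([set z : plane R | r1 < modulus z] `&` [set z : plane R | modulus z < r2])).
  by repeat apply: measurableI; exact: measurable_lt_set.
by apply/seteqP; split => z /= => [[? ? ?]|[? []]].
Qed.

Lemma area_annulus r1 r2 : 0 <= r1 -> r1 <= r2 -> r2 <= 1 ->
  mu (annulus r1 r2) = (disc_area * (r2 ^+ 2 - r1 ^+ 2))%:E.
Proof.
move=> r10 r12 r21.
rewrite (@area_sandwich _ 0 1 r1 r2); [by rewrite mulr1|by rewrite ler01 lexx|by []..| | |].
- exact: measurable_annulus.
- by move=> z.
- move=> z [z0 z1 z2]; split => //; try exact: ltW.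
  by rewrite mulr1; case/andP : (ang_bound 0 z) => _ /ltW.
Qed.

Definition shell n : set (plane R) :=
  [set z | [/\ modulus z < 1, 2^-1 ^+ n.+1 < modulus z & modulus z <= 2^-1 ^+ n]].

Lemma measurable_shell n : measurable (shell n).
Proof.
have mm := @measurable_modulus_plane R.
rewrite (_ : shell n = [set z : plane R | modulus z < 1] `&`
  ([set z : plane R | 2^-1 ^+ n.+1 < modulus z] `&` [set z : plane R | modulus z <= 2^-1 ^+ n])).
  apply: measurableI; first exact: measurable_lt_set.
  apply: measurableI; [exact: measurable_lt_set|exact: measurable_le_set].
by apply/seteqP; split => z /= => [[? ? ?]|[? []]].
Qed.

Definition shell_area n : R := disc_area * (3 / 4) * 4^-1 ^+ n.

Lemma shell_area_gt0 n : 0 < shell_area n.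
Proof. by rewrite /shell_area !mulr_gt0 ?disc_area_gt0 ?exprn_gt0 ?invr_gt0. Qed.

Lemma area_shell n : mu (shell n) = (shell_area n)%:E.
Proof.
have /andP[h0 h1] := @halfn_bound R n; have /andP[k0 k1] := @halfn_bound R n.+1.
rewrite (@area_sandwich _ 0 1 (2^-1 ^+ n.+1) (2^-1 ^+ n)).
- congr EFin; rewrite /shell_area mulr1 -mulrA; congr (_ * _).
  have -> : 4^-1 ^+ n = (2^-1 ^+ n) ^+ 2 :> R.
    by rewrite -exprM mulnC exprM; congr (_ ^+ n); rewrite exprVn -natrX.
  by rewrite (exprS _ n); field.
- by rewrite ler01 lexx.
- exact: ltW.
- by rewrite exprS ler_piMl ?ltW// invf_lt1//; lra.
- by [].
- exact: measurable_shell.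
- move=> z z0 z1 z2 _ _; split => //; [exact: lt_le_trans h1|exact: ltW].
- move=> z [z1 z2 z3]; split => //; [exact: lt_trans z2|exact: ltW|].
  by rewrite mulr1; case/andP : (ang_bound 0 z) => _ /ltW.
Qed.

(** As trunc_log is the integer part of the binary logarithm, the index is n on the
    annulus 2^-(n+1) < |z| <= 2^-n, and 0 outside the disc. *)
Definition shell_index z : nat := trunc_log 2 (Num.truncn (modulus z)^-1).

Lemma shell_indexE n z : shell n z -> shell_index z = n.
Proof.
move=> [z1 z2 z3]; have k0 : 0 < 2^-1 ^+ n.+1 :> R by rewrite exprn_gt0 ?invr_gt0.
have z0 : 0 < modulus z := lt_trans k0 z2.
apply: trunc_log_eq => //; apply/andP; split.
  rewrite truncn_ge_nat ?invr_ge0 ?(ltW z0)//.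
  rewrite natrX -[leLHS]invrK lef_pV2 ?posrE ?invr_gt0 ?exprn_gt0//.
  by rewrite -exprVn.
rewrite truncn_lt_nat ?invr_ge0 ?(ltW z0)//.
rewrite natrX -[ltRHS]invrK ltf_pV2 ?posrE ?invr_gt0 ?exprn_gt0//.
by rewrite -exprVn.
Qed.

Lemma shell_index_outer z : 2^-1 < modulus z -> shell_index z = 0%N.
Proof.
move=> z2; have z0 : 0 < modulus z by apply: lt_trans z2; rewrite invr_gt0.
have : (Num.truncn (modulus z)^-1 < 2)%N.
  rewrite truncn_lt_nat ?invr_ge0 ?(ltW z0)//.
  by rewrite -[ltRHS]invrK ltf_pV2 ?posrE ?invr_gt0.
by rewrite /shell_index; case: (Num.truncn _) => [|[|]].
Qed.

Definition punctured : set (plane R) := [set z | 0 < modulus z /\ modulus z < 1].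

Lemma measurable_punctured : measurable punctured.
Proof.
have mm := @measurable_modulus_plane R.
by apply: measurableI; exact: measurable_lt_set.
Qed.

Lemma punctured_shells : punctured = \bigcup_n shell n.
Proof.
apply/seteqP; split => z.
  move=> [z0 z1]; exists (shell_index z) => //.
  have m1 : (0 < Num.truncn (modulus z)^-1)%N.
    by rewrite truncn_gt0 invf_ge1// ltW.
  have /andP[n1 n2] := trunc_log_bounds (ltnSn 1) m1.
  rewrite -/(shell_index z) in n1 n2.
  split => //.
    rewrite truncn_lt_nat ?invr_ge0 ?(ltW z0)// in n2.
    by rewrite natrX -[ltRHS]invrK ltf_pV2 ?posrE ?invr_gt0 ?exprn_gt0// in n2; rewrite exprVn.
  rewrite truncn_ge_nat ?invr_ge0 ?(ltW z0)// in n1.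
  by rewrite natrX -[leLHS]invrK lef_pV2 ?posrE ?invr_gt0 ?exprn_gt0// in n1; rewrite exprVn.
move=> [n _ [z1 z2 z3]]; split => //; apply: lt_trans z2.
by rewrite exprn_gt0 ?invr_gt0.
Qed.

Lemma carleson_punctured I : carleson I `<=` punctured.
Proof. by move=> z [dz z0 _ _]; split => //; exact/modulus_gt0. Qed.

Lemma disc_punctured : @disc R = punctured `|` [set (0, 0)].
Proof.
apply/seteqP; split => z /=.
  move=> dz; have [->|/eqP z0] := eqVneq z (0, 0); first by right.
  by left; split => //; exact/modulus_gt0.
by case=> [[]//|->]; rewrite /disc/= (_ : modulus _ = 0) ?ltr01//; exact/modulus_eq0.
Qed.

Lemma measurable_origin : measurable ([set (0, 0)] : set (plane R)).
Proof.
rewrite (_ : [set (0, 0)] = @disc R `\` punctured).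
  by apply: measurableD; [exact: measurable_disc|exact: measurable_punctured].
rewrite disc_punctured; apply/seteqP; split => z /=.
  move=> ->; split; first by right.
  by case=> + _; rewrite (_ : modulus _ = 0) ?ltxx//; exact/modulus_eq0.
by case=> -[].
Qed.

Lemma area_origin : mu [set (0, 0)] = 0%E.
Proof.
have E : [set (0, 0)] = ([set 0] : set (measurableTypeR R)) `*` ([set 0] : set (measurableTypeR R)).
  by apply/seteqP; split => -[x y] /= [-> ->].
have m0 : measurable ([set 0] : set (measurableTypeR R)) by exact: measurable_set1.
rewrite E area_borel; last exact: measurableX.
by rewrite borel_area_rect// lebesgue_measure_set1 mule0 mule0.
Qed.

Lemma measurable_shell_fun h : measurable_fun (@disc R) (fun z => (h (shell_index z))%:E).
Proof.
pose E n : set (plane R) := if n is n'.+1 then shell n' else [set (0, 0)].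
have DE : @disc R = \bigcup_n E n.
  rewrite disc_punctured punctured_shells; apply/seteqP; split => z.
    by case=> [[n _ zn]|z0]; [exists n.+1|exists 0%N].
  by case=> -[|n] _ zn; [right|left; exists n].
have mE n : measurable (E n).
  by case: n => [|n]; [exact: measurable_origin|exact: measurable_shell].
rewrite DE; apply/(measurable_fun_bigcup _ mE) => -[|n].
  apply: (eq_measurable_fun (cst (h (shell_index (0, 0)))%:E)); last exact: measurable_cst.
  by move=> z /set_mem ->.
apply: (eq_measurable_fun (cst (h n)%:E)); last exact: measurable_cst.
by move=> z /set_mem zn; rewrite (shell_indexE zn).
Qed.

Lemma shell_disjoint : trivIset setT shell.
Proof.
apply/trivIsetP => i j _ _ ij; apply/seteqP; split => z //= -[zi zj].
by move: ij; rewrite -(shell_indexE zi) (shell_indexE zj) eqxx.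
Qed.

Lemma integral_shell h n : (\int[mu]_(z in shell n) (h (shell_index z))%:E = (h n * shell_area n)%:E)%E.
Proof.
transitivity (\int[mu]_(z in shell n) (cst (h n)%:E z))%E.
  by apply: eq_integral => z /set_mem zn; rewrite (shell_indexE zn).
by rewrite (integral_cst mu (measurable_shell n)) area_shell.
Qed.

Lemma punctured_disc : punctured `<=` @disc R.
Proof. by move=> z []. Qed.

Let mshP h : measurable_fun punctured (fun z => (h (shell_index z))%:E).
Proof. exact: (measurable_funS measurable_disc punctured_disc (measurable_shell_fun h)). Qed.

(** The n-th annulus has area 3/4 * 4^-n times that of the disc. *)
Lemma integral_shells_le h (M : R) : (forall n, 0 <= h n) ->
  (forall n, \sum_(i < n) h i * 4^-1 ^+ i <= M) ->
  (\int[mu]_(z in punctured) (h (shell_index z))%:E <= (disc_area * M)%:E)%E.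
Proof.
move=> h0 hM.
have mf := mshP h; rewrite punctured_shells in mf *.
rewrite (ge0_integral_bigcup mu measurable_shell mf); last 2 first.
- by move=> z _; rewrite lee_fin.
- exact: shell_disjoint.
have t0 n : (0 <= \int[mu]_(z in shell n) (h (shell_index z))%:E)%E.
  by apply: integral_ge0 => z _; rewrite lee_fin.
apply: lime_le; first by apply: is_cvg_nneseries => n _ _; exact: t0.
apply: nearW => n; under eq_bigr do rewrite integral_shell.
rewrite sumEFin lee_fin big_mkord.
apply: (@le_trans _ _ (disc_area * \sum_(i < n) h i * 4^-1 ^+ i)); last first.
  by rewrite ler_pM2l ?disc_area_gt0.
rewrite mulr_sumr; apply: ler_sum => i _; rewrite /shell_area.
have -> : h i * (disc_area * (3 / 4) * 4^-1 ^+ i) = disc_area * (h i * 4^-1 ^+ i) * (3 / 4) by ring.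
rewrite ler_piMr//; last by lra.
by rewrite !mulr_ge0 ?exprn_ge0 ?invr_ge0// ltW// disc_area_gt0.
Qed.

(** Unbounded contributions of single annuli already make the integral infinite. *)
Lemma integral_shells_infty h : (forall n, 0 <= h n) ->
  (forall M : R, exists n, M <= h n * 4^-1 ^+ n) ->
  (\int[mu]_(z in punctured) (h (shell_index z))%:E = +oo)%E.
Proof.
move=> h0 hM; apply/eqyP => M _.
have D0 := @disc_area_gt0 R.
have [n hn] := hM (M / (disc_area * (3 / 4))).
apply: (@le_trans _ _ (\int[mu]_(z in shell n) (h (shell_index z))%:E)%E).
  rewrite integral_shell lee_fin /shell_area mulrCA mulrC -ler_pdivrMr//.
  by rewrite mulr_gt0//; lra.
apply: (ge0_subset_integral mu (measurable_shell n) measurable_punctured (mshP h)).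
  by move=> z _; rewrite lee_fin.
by rewrite punctured_shells => z zn; exists n.
Qed.

End radial.

(** * Radial step weights *)

Section step_weights.
Context {R : realType}.
Local Notation mu := (@area R).
Implicit Types (z : plane R) (I K A : set (plane R)) (a l s t : R) (w : plane R -> \bar R).
Implicit Types (g h : nat -> R).

Definition step g : plane R -> \bar R := fun z => (g (shell_index z))%:E.

Definition summable_step h (M : R) := forall n, \sum_(i < n) h i * 4^-1 ^+ i <= M.

Lemma geometric_summable h (M : R) : 0 <= M -> (forall n, h n <= M * 2 ^+ n) ->
  summable_step h (2 * M).
Proof.
move=> M0 hM n.
have : \sum_(i < n) h i * 4^-1 ^+ i <= M * (2 - 2 * 2^-1 ^+ n).
  elim: n => [|n IH]; first by rewrite big_ord0 expr0 mulr1 subrr mulr0.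
  rewrite big_ord_recr/=.
  have q0 : 0 <= 4^-1 ^+ n :> R by rewrite exprn_ge0 ?invr_ge0.
  have hn := ler_wpM2r q0 (hM n).
  have E : 2 ^+ n * 4^-1 ^+ n = 2^-1 ^+ n :> R by rewrite -exprMn; congr (_ ^+ n); field.
  rewrite -mulrA E in hn; rewrite (exprS _ n).
  by move: IH hn; move: (\sum_(i < n) _) (h n * _) (2^-1 ^+ n) => x y u; clear; nra.
move=> h1; apply: (le_trans h1); rewrite mulrC ler_wpM2r//.
have /andP[p0 _] := @halfn_bound R n; lra.
Qed.

Lemma step_weight g : (forall n, 0 < g n) -> weight (step g).
Proof.
move=> g0; split.
- exact: measurable_shell_fun.
- by move=> z _; rewrite /step lee_fin ltW.
- by apply: aeW => z _; rewrite /step lte_fin g0 ltry.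
Qed.

Lemma integral_disc_punctured (f : plane R -> \bar R) : measurable_fun (@disc R) f ->
  (forall z, @disc R z -> 0 <= f z)%E ->
  (\int[mu]_(z in @disc R) f z = \int[mu]_(z in punctured) f z)%E.
Proof.
move=> mf f0.
rewrite (ge0_negligible_integral measurable_origin measurable_disc mf f0 area_origin).
congr (integral _ _ _); rewrite disc_punctured; apply/seteqP; split => z /=.
  by case=> -[].
move=> zp; split; first by left.
by move=> z0; case: zp; rewrite z0 (_ : modulus _ = 0) ?ltxx//; exact/modulus_eq0.
Qed.

Lemma step_integrable g (M : R) : (forall n, 0 < g n) -> summable_step g M ->
  integrable_weight (step g).
Proof.
move=> g0 gM; have ww := step_weight g0; split => //.
have [mw w0 _] := ww.
apply/integrableP; split; first exact: mw.
rewrite (_ : \int[mu]_(z in _) _ = \int[mu]_(z in @disc R) step g z)%E; last first.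
  by apply: eq_integral => z /set_mem dz; rewrite gee0_abs// w0.
rewrite integral_disc_punctured//.
apply: (le_lt_trans (integral_shells_le (fun n => ltW (g0 n)) gM)); exact: ltry.
Qed.

Lemma measurable_step A h : A `<=` @disc R -> measurable_fun A (step h).
Proof. by move=> AD; exact: (measurable_funS measurable_disc AD (measurable_shell_fun h)). Qed.

Lemma avg_le I (f : plane R -> \bar R) (x : R) : is_arc I ->
  (\int[mu]_(z in carleson I) f z <= (x * qarea I)%:E)%E -> (avg I f <= x%:E)%E.
Proof.
move=> aI h; have q0 := qarea_gt0 aI.
have : ((qarea I)^-1%:E * \int[mu]_(z in carleson I) f z
    <= (qarea I)^-1%:E * (x * qarea I)%:E)%E.
  by apply: lee_wpmul2l => //; rewrite lee_fin invr_ge0 ltW.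
by rewrite -(EFinM (qarea I)^-1) mulrCA mulVf ?gt_eqF// mulr1.
Qed.

Lemma avg_ge I (f : plane R -> \bar R) (x : R) : is_arc I ->
  ((x * qarea I)%:E <= \int[mu]_(z in carleson I) f z)%E -> (x%:E <= avg I f)%E.
Proof.
move=> aI h; have q0 := qarea_gt0 aI.
have : ((qarea I)^-1%:E * (x * qarea I)%:E
    <= (qarea I)^-1%:E * \int[mu]_(z in carleson I) f z)%E.
  by apply: lee_wpmul2l => //; rewrite lee_fin invr_ge0 ltW.
by rewrite -(EFinM (qarea I)^-1) mulrCA mulVf ?gt_eqF// mulr1.
Qed.

(** For |I| <= 1/2 the square lies in the outermost annulus.  Otherwise the area of the
    square is at least a quarter of that of the disc. *)
Lemma avg_step_le I h (M : R) : is_arc I -> (forall n, 0 <= h n) -> summable_step h M ->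
  (avg I (step h) <= (h 0%N + 4 * M)%:E)%E.
Proof.
move=> aI h0 hM; have D0 := @disc_area_gt0 R.
have M0 : 0 <= M by have := hM 0%N; rewrite big_ord0.
have mI := measurable_carleson aI; have dI := @carleson_disc R I.
have q0 := qarea_gt0 aI.
apply: (avg_le aI).
have [/andP[l0 l1] _] := is_arcP aI.
have [l2|l2] := leP (arclen I) 2^-1.
  rewrite (_ : \int[mu]_(z in _) _ = (h 0%N * qarea I)%:E)%E.
    by rewrite lee_fin ler_pM2r// lerDl mulr_ge0.
  transitivity (\int[mu]_(z in carleson I) (cst (h 0%N)%:E z))%E; last first.
    by rewrite (integral_cst mu mI) area_carlesonE.
  apply: eq_integral => z /set_mem [_ _ _ hz].
  by rewrite /step shell_index_outer//; lra.
apply: (@le_trans _ _ (disc_area * M)%:E).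
  apply: le_trans (integral_shells_le h0 hM).
  apply: (ge0_subset_integral mu mI measurable_punctured
    (measurable_step h punctured_disc) _ (@carleson_punctured R I)).
  by move=> z _; rewrite lee_fin.
rewrite lee_fin qareaE//.
move: (arclen I) (disc_area) (h 0%N) (h0 0%N) l0 l1 l2 D0 => l D x x0 l0 l1 l2 D0.
clear -x0 l0 l1 l2 D0 M0.
have h1 : 4^-1 <= l ^+ 2 * (2 - l).
  have a1 : 4^-1 <= l ^+ 2 by rewrite expr2; nra.
  have a2 : l ^+ 2 <= l ^+ 2 * (2 - l) by rewrite ler_peMr ?sqr_ge0//; lra.
  exact: le_trans a2.
have h2 : M <= 4 * (l ^+ 2 * (2 - l)) * M by rewrite ler_peMl//; lra.
have h3 : 0 <= l ^+ 2 * (2 - l) * x by rewrite mulr_ge0//; lra.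
have := ler_wpM2l (ltW D0) h2; have := mulr_ge0 (ltW D0) h3; lra.
Qed.

(** The outermost annulus fills at least half of every Carleson square. *)
Lemma avg_step_ge I h : is_arc I -> (forall n, 0 <= h n) ->
  ((h 0%N / 2)%:E <= avg I (step h))%E.
Proof.
move=> aI h0; have D0 := @disc_area_gt0 R.
have mI := measurable_carleson aI; have dI := @carleson_disc R I.
have q0 := qarea_gt0 aI.
apply: (avg_ge aI).
have [/andP[l0 l1] [a ab]] := is_arcP aI; set l := arclen I in l0 l1 ab.
pose r := Num.max (1 - l) 2^-1.
have r0 : 0 <= r by rewrite le_max; apply/orP; right; rewrite invr_ge0.
have r1 : r <= 1 by rewrite ge_max; apply/andP; split; lra.
have rl : 1 - l <= r by rewrite le_max lexx.
have r2 : 2^-1 <= r by rewrite le_max lexx orbT.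
pose E := carleson I `&` [set z : plane R | 2^-1 < modulus z].
have mE : measurable E.
  apply: (measurableI _ _ mI).
  exact: (measurable_lt_set (measurable_cst _) measurable_modulus_plane).
have EI : E `<=` carleson I by move=> z [].
have aE : mu E = (disc_area * l * (1 ^+ 2 - r ^+ 2))%:E.
  apply: (@area_sandwich _ a) => //.
  - by rewrite ltW.
  - move=> z z0 z1 z2 z3 z4; split; last exact: le_lt_trans z1.
    split; [exact: z2|exact/modulus_gt0| |by rewrite -/l; lra].
    by apply: (arc_direction_lo ab) => //; exact/modulus_gt0.
  - move=> z [[dz z0 Iz hz] z2]; split; [exact/modulus_gt0| |exact: ltW|].
      by rewrite ge_max; apply/andP; split; [rewrite -/l in hz; lra|exact: ltW].
    by apply: (arc_direction_hi _ ab) => //; rewrite ltW.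
apply: (@le_trans _ _ (\int[mu]_(z in E) step h z)%E); last first.
  apply: (ge0_subset_integral mu mE mI (measurable_step h dI) _ EI).
  by move=> z _; rewrite lee_fin.
rewrite (_ : \int[mu]_(z in E) _ = (h 0%N)%:E * mu E)%E; last first.
  rewrite -(integral_cst mu mE).
  by apply: eq_integral => z /set_mem [_ z2]; rewrite /step shell_index_outer.
rewrite aE -EFinM lee_fin qareaE// -/l.
suff key : l ^+ 2 * (2 - l) <= 2 * (l * (1 ^+ 2 - r ^+ 2)).
  have := ler_wpM2l (mulr_ge0 (ltW D0) (h0 0%N)) key.
  by move: (l ^+ 2 * _) (h 0%N) => u x; clear; lra.
have rcase : r = 1 - l \/ (r = 2^-1 /\ 2^-1 <= l).
  have [h1|h1] := leP 2^-1 (1 - l); [left|right].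
    by rewrite /r max_l.
  by split; [rewrite /r max_r// ltW|lra].
move: rcase l0 l1; clear; case=> [->|[-> l2]] l0 l1.
  by rewrite !expr2; nra.
rewrite !expr2.
have : 0 <= (1 - l) ^+ 2 by exact: sqr_ge0.
by rewrite expr2; nra.
Qed.

Lemma ess_inf_on_ge A w (y : \bar R) : (forall z, A z -> (y <= w z)%E) ->
  (y <= ess_inf_on A w)%E.
Proof.
move=> yw; apply/ess_infP; apply: aeW => z; rewrite /patch.
by case: ifPn => [/set_mem/yw//|_]; exact: leey.
Qed.

Lemma ess_sup_on_le A w (y : \bar R) : (forall z, A z -> (w z <= y)%E) ->
  (ess_sup_on A w <= y)%E.
Proof.
move=> yw; apply/ess_supP; apply: aeW => z; rewrite /patch.
by case: ifPn => [/set_mem/yw//|_]; exact: leNye.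
Qed.

Lemma ae_exists (P : plane R -> Prop) A : measurable A -> (0 < mu A)%E ->
  {ae mu, forall z, P z} -> exists2 z, A z & P z.
Proof.
move=> mA A0 [N [mN N0 NP]]; apply: contrapT => no.
have : (mu A <= mu N)%E.
  by apply: le_measure; rewrite ?inE// => z Az; apply: NP => Pz; apply: no; exists z.
by rewrite N0 leNgt A0.
Qed.

Lemma ess_inf_on_le A B w (y : \bar R) : measurable B -> (0 < mu B)%E -> B `<=` A ->
  (forall z, B z -> (w z <= y)%E) -> (ess_inf_on A w <= y)%E.
Proof.
move=> mB B0 BA wy.
have [z Bz h] := ae_exists mB B0 (ess_inf_le mu (patch (cst +oo%E) A w)).
apply: (le_trans h); rewrite /patch mem_set; [exact: wy|exact: BA].
Qed.

Lemma ess_sup_on_ge A B w (y : \bar R) : measurable B -> (0 < mu B)%E -> B `<=` A ->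
  (forall z, B z -> (y <= w z)%E) -> (y <= ess_sup_on A w)%E.
Proof.
move=> mB B0 BA wy.
have [z Bz h] := ae_exists mB B0 (ess_sup_ge mu (patch (cst -oo%E) A w)).
apply: le_trans h; rewrite /patch mem_set; [exact: wy|exact: BA].
Qed.

Definition whole_arc : set (plane R) := closed_arc 0 1.

Lemma is_arc_whole : is_arc whole_arc.
Proof. by apply: is_arc_closed_arc; rewrite ltr01 lexx. Qed.

Lemma arclen_whole : arclen whole_arc = 1.
Proof. by apply: arclen_closed_arc; rewrite ler01 lexx. Qed.

Lemma whole_arc_direction z : z <> (0, 0) -> whole_arc (direction z).
Proof.
move=> z0; apply/closed_arc_direction => //; first by rewrite ler01 lexx.
by rewrite mulr1; case/andP : (ang_bound 0 z) => _ /ltW.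
Qed.

Lemma carleson_whole : carleson whole_arc = punctured.
Proof.
apply/seteqP; split; first exact: carleson_punctured.
move=> z [z0 z1]; have zn : z <> (0, 0) by exact/modulus_gt0.
by split => //; [exact: whole_arc_direction|rewrite arclen_whole gtrBl].
Qed.

Lemma step_B1 g (c M : R) : 0 < c -> (forall n, c <= g n) -> summable_step g M -> B1 (step g).
Proof.
move=> c0 gc gM; have g0 n : 0 < g n := lt_le_trans c0 (gc n).
split; first exact: step_integrable gM.
have M0 : 0 <= M by have := gM 0%N; rewrite big_ord0.
have b0 : 0 < g 0%N + 4 * M by rewrite ltr_wpDr// mulr_ge0.
exists ((g 0%N + 4 * M) / c); first by rewrite divr_gt0.
move=> I aI; apply: (le_trans (avg_step_le aI (fun n => ltW (g0 n)) gM)).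
apply: (@le_trans _ _ (((g 0%N + 4 * M) / c)%:E * c%:E)%E).
  by rewrite -EFinM divfK// gt_eqF.
apply: lee_wpmul2l; first by rewrite lee_fin divr_ge0// ltW.
by apply: ess_inf_on_ge => z _; rewrite /step lee_fin.
Qed.

Lemma step_RH g (r M N : R) : (forall n, 0 < g n) -> summable_step g M -> 1 < r ->
  summable_step (fun n => powR (g n) r) N -> RH (step g).
Proof.
move=> g0 gM r1 gN; split; first exact: step_integrable gM.
exists r => //.
have r0 : 0 < r := lt_trans ltr01 r1.
have N0 : 0 <= N by have := gN 0%N; rewrite big_ord0.
set B := powR (g 0%N) r + 4 * N.
have B0 : 0 < B by rewrite ltr_wpDr ?powR_gt0// mulr_ge0.
have C0 : 0 < powR B r^-1 by rewrite powR_gt0.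
have h0 : 0 < g 0%N / 2 by rewrite divr_gt0.
exists (powR B r^-1 / (g 0%N / 2)); first by rewrite divr_gt0.
move=> I aI.
have up := @avg_step_le I (fun n => powR (g n) r) N aI (fun n => powR_ge0 _ _) gN.
have lo := avg_step_ge aI (fun n => ltW (g0 n)).
apply: (@le_trans _ _ (powR B r^-1)%:E).
  apply: (@gt0_ler_poweR _ r^-1 _ _ B%:E) => //.
  - by rewrite invr_ge0 ltW.
  - rewrite in_itv/= leey andbT.
    rewrite /avg mule_ge0 ?lee_fin ?invr_ge0 ?fine_ge0//.
    by apply: integral_ge0 => z _; rewrite lee_fin powR_ge0.
  - by rewrite in_itv/= leey andbT lee_fin ltW.
apply: (@le_trans _ _ ((powR B r^-1 / (g 0%N / 2))%:E * (g 0%N / 2)%:E)%E).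
  by rewrite -EFinM divfK// gt_eqF.
by apply: lee_wpmul2l => //; rewrite lee_fin ltW// divr_gt0.
Qed.

End step_weights.

(** * Counterexamples among step weights *)

Section examples.
Context {R : realType}.
Local Notation mu := (@area R).
Implicit Types (z : plane R) (I K A : set (plane R)) (w : plane R -> \bar R).
Implicit Types (g h : nat -> R).

(** From ln x <= x at x := (a / s) (n + 1). *)
Lemma succ_powR_exp (s a : R) : 0 < s -> 0 < a ->
  exists2 M : R, 0 < M & forall n, powR n.+1%:R s <= M * expR (a * n%:R).
Proof.
move=> s0 a0; exists (expR (a - s * ln (a / s))); first exact: expR_gt0.
move=> n; rewrite -expRD /powR pnatr_eq0/= ler_expR.
have q0 : 0 < a / s by rewrite divr_gt0.
have n0 : 0 < n.+1%:R :> R by rewrite ltr0n.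
have h : ln (a / s) + ln n.+1%:R <= a / s * n.+1%:R.
  rewrite -lnM ?posrE//.
  have := @ln_sublinear R _ (mulr_gt0 q0 n0); exact: ltW.
have := ler_wpM2l (ltW s0) h.
rewrite mulrDr (mulrA s) (mulrC s (a / s)) divfK ?gt_eqF//.
rewrite -(natr1 n); clear; lra.
Qed.

Lemma succ_powR_pow2 (s : R) : 0 < s ->
  exists2 M : R, 0 < M & forall n, powR n.+1%:R s <= M * 2 ^+ n.
Proof.
move=> s0; have l2 : 0 < ln 2 :> R by rewrite ln_gt0// ltr1n.
have [M M0 hM] := succ_powR_exp s0 l2; exists M => // n.
by rewrite -(@lnK R 2) ?posrE// -expRM_natr.
Qed.

Lemma nat_unbounded (C : R) : exists n : nat, C < n%:R.
Proof.
exists (Num.bound `|C|); have := archi_boundP (normr_ge0 C).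
exact: le_lt_trans (ler_norm C).
Qed.

Lemma le_one_summable h : (forall n, h n <= 1) -> summable_step h (2 * 1).
Proof.
move=> h1; apply: geometric_summable => // n.
by rewrite mul1r (le_trans (h1 n))// exprn_ege1// ler1n.
Qed.

Lemma avg_step_powR g p I :
  avg I (fun z => poweR (step g z) p) = avg I (step (fun n => powR (g n) p)).
Proof. by []. Qed.

Lemma avg_step_infty h : (forall n, 0 <= h n) ->
  (forall M : R, exists n, M <= h n * 4^-1 ^+ n) ->
  (avg whole_arc (step h) = +oo)%E.
Proof.
move=> h0 hM; rewrite /avg -/(qarea _) carleson_whole integral_shells_infty//.
by rewrite gt0_muley// lte_fin invr_gt0 (qarea_gt0 is_arc_whole).
Qed.

Lemma shell_sub_punctured n : @shell R n `<=` punctured.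
Proof. by rewrite punctured_shells => z zn; exists n. Qed.

Lemma shell_sub_top_half n : (2 <= n)%N -> shell n `<=` top_half (@whole_arc R).
Proof.
move=> n2 z zn; have [z0 z1] := shell_sub_punctured zn.
case: zn => _ _ zn; have zne : z <> (0, 0) by exact/modulus_gt0.
split => //; first exact: whole_arc_direction.
rewrite arclen_whole.
have : modulus z <= 4^-1.
  apply: (le_trans zn); rewrite (_ : 4^-1 = 2^-1 ^+ 2) ?expr2; last by field.
  by rewrite -expr2 ler_wiXn2l ?invr_ge0// invf_le1// ler1n.
by move=> h; apply/andP; split; lra.
Qed.

Lemma ess_inf_step_le g n : (ess_inf_on (carleson whole_arc) (step g) <= (g n)%:E)%E.
Proof.
apply: (@ess_inf_on_le _ _ (shell n)); first exact: measurable_shell.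
- by rewrite area_shell lte_fin shell_area_gt0.
- by rewrite carleson_whole; exact: shell_sub_punctured.
- by move=> z zn; rewrite /step (shell_indexE zn).
Qed.

(** In the top half of the square of the whole circle the weight is unbounded, while it
    equals 3 on an annulus. *)
Lemma B1_RH_not_AC : ~ ((@B1 R) `&` RH `<=` AC).
Proof.
pose g n : R := n.+1%:R.
have g0 n : 0 < g n by rewrite ltr0n.
have [M M0 hM] := @succ_powR_pow2 1 ltr01.
have [N N0 hN] := @succ_powR_pow2 2 (ltr0Sn _ 1).
have gM : summable_step g (2 * M).
  apply: geometric_summable => [|n]; first exact: ltW.
  by have := hM n; rewrite powRr1// ler0n.
have gN := geometric_summable (ltW N0) hN.
have wB : B1 (step g) by apply: (step_B1 ltr01 _ gM) => n; rewrite ler1n.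
have wH : RH (step g) by apply: (step_RH g0 gM _ gN); rewrite ltr1n.
move=> /(_ _ (conj wB wH)) [_ [C C1 /(_ _ is_arc_whole) hC]].
have C0 : 0 <= C by rewrite (le_trans ler01).
have [k hk] := nat_unbounded (C * 3).
have k0 : (2 <= k)%N.
  rewrite ltnNge; apply/negP => k1.
  have : k%:R <= 1 :> R by rewrite lern1.
  by move: hk C1; clear; lra.
have sA n : (0 < mu (shell n))%E by rewrite area_shell lte_fin shell_area_gt0.
have lo : ((g k)%:E <= ess_sup_on (top_half whole_arc) (step g))%E.
  apply: (ess_sup_on_ge (@measurable_shell _ k) (sA k) (shell_sub_top_half k0)) => z zn.
  by rewrite /step (shell_indexE zn).
have hi : (ess_inf_on (top_half whole_arc) (step g) <= (g 2%N)%:E)%E.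
  apply: (ess_inf_on_le (@measurable_shell _ 2) (sA 2%N) (shell_sub_top_half _)) => // z zn.
  by rewrite /step (shell_indexE zn).
have := le_trans lo (le_trans hC (lee_wpmul2l _ hi)).
rewrite lee_fin -EFinM lee_fin => /(_ C0); rewrite /g -(natr1 k).
by move: hk; clear; lra.
Qed.

Lemma inverse_square_sum n : \sum_(i < n.+1) (i.+1%:R ^- 2) <= 2 - n.+1%:R^-1 :> R.
Proof.
elim: n => [|n IH]; first by rewrite big_ord_recr big_ord0/= expr1n invr1; lra.
rewrite big_ord_recr/=.
have n0 : 0 < n.+1%:R :> R by rewrite ltr0n.
apply: (le_trans (lerD IH (lexx _))).
rewrite -(natr1 n.+1); move: (n.+1%:R) n0 => x x0; clear -x0.
rewrite -subr_ge0 (_ : _ - _ = (x * (x + 1) ^+ 2)^-1).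
  by rewrite invr_ge0 mulr_ge0 ?ltW// exprn_gt0//; lra.
by field; rewrite !gt_eqF//; lra.
Qed.

(** The factor 4^n is balanced by the areas, and (n + 1)^-2 makes the sum converge.
    Raised to a power q > 1, the geometric factor wins over every power of n + 1. *)
Lemma B1_not_RH : ~ ((@B1 R) `<=` RH).
Proof.
pose g n : R := 4 ^+ n * n.+1%:R ^- 2.
have n0 n : 0 < n.+1%:R :> R by rewrite ltr0n.
have g1 n : 1 <= g n.
  rewrite /g ler_pdivlMr ?exprn_gt0// mul1r.
  rewrite (_ : 4 = 2 ^+ 2); last by rewrite -natrX.
  by rewrite -exprM mulnC exprM ler_pXn2r ?nnegrE ?exprn_ge0 ?ler0n// -natrX ler_nat ltn_expl.
have g0 n : 0 < g n := lt_le_trans ltr01 (g1 n).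
have gM : summable_step g 2.
  case=> [|n]; first by rewrite big_ord0.
  rewrite (eq_bigr (fun i : 'I_n.+1 => i.+1%:R ^- 2)); last first.
    by move=> i _; rewrite /g mulrAC -exprMn divff// expr1n mul1r.
  by apply: le_trans (inverse_square_sum n) _; rewrite gerBl invr_ge0 ler0n.
move=> /(_ _ (step_B1 ltr01 g1 gM)) [_ [q q1 [C C0 /(_ _ is_arc_whole)]]].
have q0 : 0 < q := lt_trans ltr01 q1.
rewrite avg_step_powR (@avg_step_infty (fun n => powR (g n) _)).
- rewrite poweRyr ?gt_eqF ?invr_gt0//.
  move=> h; have := le_trans h (lee_wpmul2l _ (avg_step_le is_arc_whole (fun n => ltW (g0 n)) gM)).
  by rewrite lee_fin -EFinM => /(_ (ltW C0)); rewrite leye_eq.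
- by move=> n; exact: powR_ge0.
- move=> M.
  have s0 : 0 < 2 * q + 1 by lra.
  have l4 : 0 < ln 4 :> R by rewrite ln_gt0// ltr1n.
  have a0 : 0 < (q - 1) * ln 4 by rewrite mulr_gt0// subr_gt0.
  have [N N0 hN] := succ_powR_exp s0 a0.
  have [k hk] := nat_unbounded (M * N); exists k.
  have E : powR (g k) q * 4^-1 ^+ k = expR ((q - 1) * ln 4 * k%:R) / powR k.+1%:R (2 * q).
    rewrite /g powRM ?exprn_ge0 ?invr_ge0 ?exprn_ge0//.
    rewrite -(@powR_mulrn _ 4) // -powRrM -[_ ^- 2]powR_invn// -powRrM mulNr powRN.
    rewrite mulrAC; congr (_ / _).
    rewrite exprVn -(@powR_mulrn _ 4)// -powRN -powRD; last by rewrite pnatr_eq0 implybT.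
    by rewrite /powR pnatr_eq0/=; congr expR; ring.
  rewrite E ler_pdivlMr ?powR_gt0//.
  have := hN k; rewrite powRD ?(gt_eqF s0)// powRr1 ?ler0n// => h.
  have p0 : 0 < powR k.+1%:R (2 * q) :> R by rewrite powR_gt0.
  have : N * (M * powR k.+1%:R (2 * q)) <= N * expR ((q - 1) * ln 4 * k%:R).
    apply: le_trans h; rewrite mulrA (mulrC N) (mulrC (powR _ _)) ler_wpM2r ?(ltW p0)//.
    by rewrite -(natr1 k); move: hk; clear; lra.
  by rewrite ler_pM2l.
Qed.

Lemma RH_of_le_one g : (forall n, 0 < g n <= 1) -> RH (step g).
Proof.
move=> g01; have g0 n : 0 < g n by case/andP: (g01 n).
have g1 n : g n <= 1 by case/andP: (g01 n).
have h2 : summable_step (fun n => powR (g n) 2) (2 * 1).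
  apply: le_one_summable => n; rewrite powR_mulrn ?(ltW (g0 n))//.
  by rewrite exprn_ile1// ltW.
by apply: (step_RH g0 (le_one_summable g1) _ h2); rewrite ltr1n.
Qed.

Lemma avg_lne_step g I :  (forall n, 0 < g n) ->
  avg I (fun z => lne (step g z)) = avg I (step (fun n => ln (g n))).
Proof.
move=> g0; congr (_ * _)%E; apply: eq_integral => z _.
by rewrite /step lne_EFin.
Qed.

Lemma avg_step_opp h I : (forall n, 0 <= h n) ->
  avg I (step (fun n => - h n)) = (- avg I (step h))%E.
Proof.
move=> h0; rewrite /avg -muleN -integral_ge0N//.
by move=> z _; rewrite lee_fin.
Qed.

(** The logarithm has infinite integral, so that the exponential of its mean is 0. *)
Lemma RH_not_RJ : ~ ((@RH R) `<=` RJ).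
Proof.
pose h n : R := n%:R * 4 ^+ n.
have h0 n : 0 <= h n by rewrite mulr_ge0 ?ler0n ?exprn_ge0.
pose g n : R := expR (- h n).
have g0 n : 0 < g n by rewrite expR_gt0.
have wH : RH (step g).
  apply: RH_of_le_one => n; apply/andP; split => //.
  by rewrite /g -expR0 ler_expR oppr_le0 h0.
move=> /(_ _ wH) [_ [C C0 /(_ _ is_arc_whole)]].
rewrite avg_lne_step// (_ : (fun n => ln (g n)) = (fun n => - h n)); last first.
  by apply/funext => n; rewrite expRK.
rewrite avg_step_opp// (avg_step_infty h0); last first.
  move=> M; have [k hk] := nat_unbounded M; exists k.
  by rewrite /h -mulrA -exprMn divff// expr1n mulr1 ltW.
move=> h1; have := le_trans (avg_step_ge is_arc_whole (fun n => ltW (g0 n))) h1.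
rewrite mule0 lee_fin leNgt => /negP; apply.
by rewrite divr_gt0.
Qed.

(** The logarithm grows like 2^n, slower than 4^n, so it is integrable, but the
    exponential of any multiple of 2^n outgrows 4^n. *)
Lemma RJ_RH_not_Bp : ~ ((@RJ R) `&` RH `<=` bigcup_Bp).
Proof.
pose h n : R := 2 ^+ n.
have h0 n : 0 <= h n by rewrite exprn_ge0.
pose g n : R := expR (- h n).
have g0 n : 0 < g n by rewrite expR_gt0.
have g1 n : g n <= 1 by rewrite -expR0 ler_expR oppr_le0.
have wH : RH (step g) by apply: RH_of_le_one => n; rewrite g0 g1.
have hM : summable_step h (2 * 1) by apply: geometric_summable => // n; rewrite mul1r.
have wJ : RJ (step g).
  split; first by case: wH.
  exists ((g 0%N + 4 * (2 * 1)) / expR (- (h 0%N + 4 * (2 * 1)))).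
    by rewrite divr_gt0 ?expR_gt0// ltr_wpDr.
  move=> I aI.
  rewrite avg_lne_step// (_ : (fun n => ln (g n)) = (fun n => - h n)); last first.
    by apply/funext => n; rewrite expRK.
  rewrite avg_step_opp//.
  apply: (le_trans (avg_step_le aI (fun n => ltW (g0 n)) (le_one_summable g1))).
  apply: (@le_trans _ _ (((g 0%N + 4 * (2 * 1)) / expR (- (h 0%N + 4 * (2 * 1))))%:E *
      expeR (- (h 0%N + 4 * (2 * 1)))%:E)%E).
    by rewrite /= -EFinM divfK// gt_eqF// expR_gt0.
  apply: lee_wpmul2l.
    by rewrite lee_fin divr_ge0 ?expR_ge0// addr_ge0// ltW.
  rewrite lee_expeR EFinN leeN2.
  exact: avg_step_le.
move=> /(_ _ (conj wJ wH)) [p/= p1 [_ [C C0 /(_ _ is_arc_whole)]]].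
cbv zeta; rewrite avg_step_powR (@avg_step_infty (fun n => powR (g n) _)).
- have p0 : 0 < p - 1 by rewrite subr_gt0.
  rewrite poweRyr ?gt_eqF// gt0_muley ?leye_eq//.
  apply: lt_le_trans (avg_step_ge is_arc_whole (fun n => ltW (g0 n))).
  by rewrite lte_fin divr_gt0.
- by move=> n; exact: powR_ge0.
- move=> M.
  have p0 : 0 < p - 1 by rewrite subr_gt0.
  set s := (p - 1)^-1.
  have s0 : 0 < s by rewrite invr_gt0.
  have Es : 1 - p / (p - 1) = - s by rewrite /s; field; rewrite gt_eqF.
  rewrite Es.
  have c0 : 0 < (s / 3) ^+ 3 by rewrite exprn_gt0 ?divr_gt0.
  have [k hk] := nat_unbounded (M / (s / 3) ^+ 3); exists k.
  have k2 : k%:R <= 2 ^+ k :> R.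
    by rewrite -(natrX R 2 k) ler_nat; exact: ltnW (ltn_expl k (ltnSn 1)).
  rewrite ltr_pdivrMr// in hk.
  have E : powR (g k) (- s) = expR (s / 3 * h k) ^+ 3.
    by rewrite /g -expRM -expRM_natr; congr expR; field.
  have e : (s / 3 * h k) ^+ 3 <= expR (s / 3 * h k) ^+ 3.
    rewrite ler_pXn2r ?nnegrE ?expR_ge0 ?mulr_ge0 ?divr_ge0 ?(ltW s0)//.
    by apply: le_trans (expR_ge1Dx _); rewrite lerDr.
  have q0 : 0 <= 4^-1 ^+ k :> R by rewrite exprn_ge0 ?invr_ge0.
  rewrite E; apply: le_trans (ler_wpM2r q0 e).
  rewrite exprMn -mulrA (_ : h k ^+ 3 * _ = 2 ^+ k).
    apply: (le_trans (ltW hk)); rewrite mulrC ler_wpM2l// ltW//.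
  by rewrite /h -exprM mulnC exprM -exprMn; congr (_ ^+ k); field.
Qed.

(** Powers of n + 1 grow slower than 2^n, so all negative powers have bounded averages. *)
Lemma RH_Bp_not_B1 : ~ ((@RH R) `&` bigcap_Bp `<=` B1).
Proof.
pose g n : R := n.+1%:R^-1.
have g0 n : 0 < g n by rewrite invr_gt0 ltr0n.
have g1 n : g n <= 1 by rewrite invf_le1 ?ltr0n// ler1n.
have wH : RH (step g) by apply: RH_of_le_one => n; rewrite g0 g1.
have wP : bigcap_Bp (step g).
  move=> p/= p1; split; first by case: wH.
  have p0 : 0 < p - 1 by rewrite subr_gt0.
  set s := (p - 1)^-1.
  have s0 : 0 < s by rewrite invr_gt0.
  have Es : 1 - p / (p - 1) = - s by rewrite /s; field; rewrite gt_eqF.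
  have [M M0 hM] := succ_powR_pow2 s0.
  have Eg : (fun n => powR (g n) (- s)) = (fun n => powR n.+1%:R s).
    apply/funext => n; rewrite /g -powR_inv1 ?ler0n// -powRrM; congr powR; ring.
  have sM := geometric_summable (ltW M0) hM.
  set B := powR 1%:R s + 4 * (2 * M).
  have B0 : 0 < B.
    by rewrite ltr_wpDl ?powR_ge0//; move: M0; clear; lra.
  exists ((g 0%N + 4 * (2 * 1)) * powR B (p - 1)).
    by rewrite mulr_gt0 ?powR_gt0// ltr_wpDr.
  move=> I aI; cbv zeta; rewrite Es avg_step_powR Eg EFinM.
  have n0 n : 0 <= powR n.+1%:R s by exact: powR_ge0.
  have a0 := avg_step_ge aI n0.
  have a0' : (0 <= avg I (step (fun n => powR n.+1%:R s)))%E.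
    by apply: le_trans a0; rewrite lee_fin divr_ge0.
  apply: lee_pmul.
  - apply: le_trans (avg_step_ge aI (fun n => ltW (g0 n))).
    by rewrite lee_fin divr_ge0// ltW.
  - exact: poweR_ge0.
  - exact: avg_step_le (fun n => ltW (g0 n)) (le_one_summable g1).
  - apply: (@gt0_ler_poweR _ (p - 1) _ _ B%:E) => //.
    + exact: ltW.
    + by rewrite in_itv/= leey andbT.
    + by rewrite in_itv/= leey andbT lee_fin ltW.
    + exact: avg_step_le.
move=> /(_ _ (conj wH wP)) [_ [C C0 /(_ _ is_arc_whole) hC]].
have [k hk] := nat_unbounded (2 * C).
have C0' : (0 <= C%:E)%E by rewrite lee_fin ltW.
have := le_trans (avg_step_ge is_arc_whole (fun n => ltW (g0 n)))
  (le_trans hC (lee_wpmul2l C0' (ess_inf_step_le g k))).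
rewrite -EFinM lee_fin /g invr1 ler_pdivlMr ?ltr0n// -(natr1 k).
by move: hk; clear; lra.
Qed.

End examples.

(** * Powers of the distance to the circle *)

Section boundary_distance.
Context {R : realType}.
Local Notation mu := (@area R).
Implicit Types (z : plane R) (I K A : set (plane R)) (w : plane R -> \bar R).

Definition bdist z : R := 1 - modulus z.

Lemma bdist_gt0 z : disc z -> 0 < bdist z.
Proof. by move=> dz; rewrite subr_gt0. Qed.

Lemma measurable_bdist A : measurable_fun A bdist.
Proof.
apply: (measurable_funS measurableT (@subsetT _ A)).
exact: (measurable_funB (measurable_cst _) measurable_modulus_plane).
Qed.

Lemma bdist_powR_weight (p : R) : weight (fun z => (powR (bdist z) p)%:E).
Proof.
split.
- apply/measurable_EFinP.
  exact: (measurableT_comp (measurable_powR p) (measurable_bdist (A := _))).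
- by move=> z _; rewrite lee_fin powR_ge0.
- by apply: aeW => z dz; rewrite lte_fin powR_gt0 ?ltry// bdist_gt0.
Qed.

(** On the top half of Q_I the distance to the circle is between |I| / 2 and |I|. *)
Lemma bdist_AC (p : R) w (c1 c2 : R) : weight w -> 0 < c1 -> c1 <= c2 ->
  (forall I, is_arc I -> forall z, top_half I z ->
    ((c1 * powR (arclen I) p)%:E <= w z <= (c2 * powR (arclen I) p)%:E)%E) ->
  AC w.
Proof.
move=> ww c10 c12 h; split => //; exists (c2 / c1).
  by rewrite ler_pdivlMr// mul1r.
move=> I aI.
apply: (@le_trans _ _ (c2 * powR (arclen I) p)%:E).
  by apply: ess_sup_on_le => z /(h _ aI) /andP[].
apply: (@le_trans _ _ ((c2 / c1)%:E * (c1 * powR (arclen I) p)%:E)%E).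
  by rewrite -EFinM mulrA divfK// gt_eqF.
apply: lee_wpmul2l; first by rewrite lee_fin divr_ge0 ?(ltW c10)// (le_trans (ltW c10)).
by apply: ess_inf_on_ge => z /(h _ aI) /andP[].
Qed.

Lemma area_near_boundary (e : R) : 0 <= e <= 1 ->
  mu (annulus (1 - e) 1) = (disc_area * (1 ^+ 2 - (1 - e) ^+ 2))%:E.
Proof. by case/andP=> e0 e1; apply: area_annulus; [lra..|]. Qed.

Lemma area_near_boundary_gt0 (e : R) : 0 < e <= 1 -> (0 < mu (annulus (1 - e)%R 1%R))%E.
Proof.
case/andP=> e0 e1; rewrite area_near_boundary ?(ltW e0)//.
rewrite lte_fin mulr_gt0 ?disc_area_gt0//.
by rewrite !expr2; move: e0 e1; clear; nra.
Qed.

(** The annulus of width e := 1 / (n + 1) along the circle has area of the order of e, and the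
    weight is at least e^-2 on it. *)
Lemma AC_not_Binfty : ~ ((@AC R) `<=` Binfty).
Proof.
have ww := bdist_powR_weight (-2).
set w := (fun z => _) in ww.
have wA : AC w.
  apply: (@bdist_AC (-2) w 1 4 ww); [by []|lra|].
  move=> I aI z [dz z0 _ /andP[h1 h2]]; rewrite -/(bdist z) in h1 h2.
  have [/andP[l0 l1] _] := is_arcP aI.
  have d0 := bdist_gt0 dz.
  rewrite !lee_fin mul1r !powR_invn ?(ltW d0) ?(ltW l0)//.
  move: (arclen I) (bdist z) l0 d0 h1 h2 => l d l0 d0 h1 h2.
  apply/andP; split.
    by rewrite lef_pV2 ?posrE ?exprn_gt0// ler_pXn2r ?nnegrE ?(ltW _)// ltW.
  rewrite -[4]invrK -invfM lef_pV2 ?posrE ?mulr_gt0 ?invr_gt0 ?exprn_gt0//.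
  rewrite (_ : 4^-1 * _ = (l / 2) ^+ 2); last by field.
  by rewrite ler_pXn2r ?nnegrE ?divr_ge0 ?(ltW l0) ?(ltW d0) ?(ltW h1).
move=> /(_ _ wA) [[[mw w0 _] /integrableP[_ fin]] _]; move: fin.
rewrite (_ : (\int[mu]_(z in _) _ = \int[mu]_(z in @disc R) w z)%E); last first.
  by apply: eq_integral => z /set_mem dz; rewrite gee0_abs// w0.
have D0 := @disc_area_gt0 R.
suff -> : (\int[mu]_(z in @disc R) w z = +oo)%E by [].
apply/eqyP => M _.
have [n hn] := @nat_unbounded R (M / disc_area).
rewrite ltr_pdivrMr// in hn.
have n0 : 0 < n.+1%:R :> R by rewrite ltr0n.
set e := n.+1%:R^-1 : R.
have e0 : 0 < e by rewrite invr_gt0.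
have e1 : e <= 1 by rewrite invf_le1// ler1n.
have mA : measurable (annulus (1 - e) 1 : set (plane R)) by exact: measurable_annulus.
have AD : annulus (1 - e) 1 `<=` @disc R by move=> z [].
apply: le_trans (ge0_subset_integral mu mA measurable_disc mw w0 AD).
apply: (@le_trans _ _ (\int[mu]_(z in annulus (1 - e)%R 1%R) (cst (e ^- 2)%:E z))%E); last first.
  apply: ge0_le_integral => //.
  - by move=> z _; rewrite lee_fin invr_ge0 exprn_ge0// ltW.
  - exact: measurable_funS measurable_disc AD mw.
  - move=> z zA; have d0 := bdist_gt0 (AD _ zA).
    rewrite lee_fin powR_invn ?(ltW d0)// lef_pV2 ?posrE ?exprn_gt0//.
    rewrite ler_pXn2r ?nnegrE ?(ltW d0) ?(ltW e0)//.
    by case: zA => _ h _; rewrite /bdist; lra.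
rewrite (integral_cst mu mA) area_near_boundary ?(ltW e0)// -EFinM lee_fin.
have E : e ^- 2 * (disc_area * (1 ^+ 2 - (1 - e) ^+ 2)) = disc_area * (2 * n.+1%:R - 1).
  by rewrite /e; field; rewrite ?gt_eqF.
rewrite E; apply: (le_trans (ltW hn)); rewrite mulrC ler_wpM2l// ?(ltW D0)//.
by rewrite -(natr1 n); have : 0 <= n%:R :> R by []; clear; lra.
Qed.

(** On Q_I the weight is at most |I|, while its mean is at least |I| / 16; thus it is in
    RH, which is contained in B_infty. *)
Lemma AC_Binfty_not_B1 : ~ ((@AC R) `&` Binfty `<=` B1).
Proof.
pose w z := (bdist z)%:E.
have D0 := @disc_area_gt0 R.
have ww : weight w.
  split.
  - by apply/measurable_EFinP; exact: measurable_bdist.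
  - by move=> z /bdist_gt0/ltW; rewrite lee_fin.
  - by apply: aeW => z /bdist_gt0; rewrite lte_fin ltry andbT.
have wA : AC w.
  apply: (@bdist_AC 1 w (2^-1) 1 ww); [by rewrite invr_gt0|lra|].
  move=> I aI z [dz z0 _ /andP[h1 h2]].
  have [/andP[l0 l1] _] := is_arcP aI.
  rewrite !lee_fin powRr1 ?(ltW l0)// mul1r mulrC.
  by apply/andP; split; exact: ltW.
have [mw w0 _] := ww.
have wi : integrable_weight w.
  split => //; apply/integrableP; split => //.
  apply: (@le_lt_trans _ _ (\int[mu]_(z in @disc R) (cst 1%E z))%E).
    apply: (ge0_le_integral mu measurable_disc).
    - by move=> z _; exact: abse_ge0.
    - exact: measurableT_comp.
    - exact: measurable_cst.
    - move=> z dz; rewrite gee0_abs ?w0// lee_fin /bdist gerBl.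
      by rewrite sqrtr_ge0.
  rewrite integral_disc_punctured -?carleson_whole; [|exact: measurable_cst|by []].
  rewrite (integral_cst mu (measurable_carleson is_arc_whole)) mul1e.
  by rewrite (area_carlesonE is_arc_whole) ltry.
have lo I : is_arc I -> ((arclen I / 16)%:E <= avg I w)%E.
  move=> aI; have [/andP[l0 l1] _] := is_arcP aI.
  apply: (avg_ge aI).
  have mT := measurable_top_half aI; have mI := measurable_carleson aI.
  have TI : top_half I `<=` carleson I.
    by move=> z [? ? ? /andP[_ ?]].
  have ID := @carleson_disc R I.
  apply: le_trans (ge0_subset_integral mu mT mI (measurable_funS measurable_disc ID mw)
     (fun z zI => w0 z (ID _ zI)) TI).
  apply: (@le_trans _ _ (\int[mu]_(z in top_half I) (cst (arclen I / 2)%:E z))%E); last first.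
    apply: (ge0_le_integral mu mT).
    - by move=> z _; rewrite lee_fin divr_ge0// ltW.
    - exact: measurable_cst.
    - by apply: (measurable_funS measurable_disc _ mw) => z /TI/ID.
    - by move=> z [_ _ _ /andP[/ltW]]; rewrite lee_fin.
  rewrite (integral_cst mu mT) area_top_half// qareaE// -EFinM lee_fin.
  suff key : arclen I ^+ 2 * (2 - arclen I) <= 8 * (arclen I ^+ 2 * (1 - 3 / 4 * arclen I)).
    have := ler_wpM2l (mulr_ge0 (ltW D0) (ltW l0)) key.
    by move: (_ * (2 - _)) (_ * (1 - _)) => u v; clear; lra.
  rewrite mulrCA ler_wpM2l ?exprn_ge0 ?(ltW l0)//.
  by move: l1; clear; lra.
have wH : RH w.
  split => //; exists 2; first by rewrite ltr1n.
  exists 16 => // I aI; have [/andP[l0 l1] _] := is_arcP aI.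
  have mI := measurable_carleson aI; have ID := @carleson_disc R I.
  have up : (avg I (fun z => poweR (w z) 2) <= (powR (arclen I) 2)%:E)%E.
    apply: (avg_le aI).
    apply: (@le_trans _ _ (\int[mu]_(z in carleson I) (cst (powR (arclen I) 2)%:E z))%E).
      apply: (ge0_le_integral mu mI).
      - by move=> z _; rewrite lee_fin powR_ge0.
      - apply/measurable_EFinP.
        exact: (measurableT_comp (measurable_powR 2) (measurable_bdist (A := _))).
      - exact: measurable_cst.
      - move=> z [dz _ _ h]; rewrite lee_fin ge0_ler_powR ?nnegrE//; last exact: ltW.
        by rewrite ltW// bdist_gt0.
        exact: ltW.
    by rewrite (integral_cst mu mI) area_carlesonE.
  apply: (@le_trans _ _ (arclen I)%:E).
    have -> : (arclen I)%:E = poweR (powR (arclen I) 2)%:E 2^-1.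
      by rewrite /= -powRrM divff// powRr1// ltW.
    apply: gt0_ler_poweR => //.
    + rewrite in_itv/= leey andbT /avg mule_ge0 ?lee_fin ?invr_ge0 ?fine_ge0//.
      by apply: integral_ge0 => z _; rewrite lee_fin powR_ge0.
    + by rewrite in_itv/= leey andbT lee_fin powR_ge0.
  apply: le_trans (lee_wpmul2l _ (lo I aI)); last by rewrite lee_fin.
  by rewrite -EFinM lee_fin; lra.
move=> /(_ _ (conj wA (RH_sub_Binfty wH))) [_ [C C0 /(_ _ is_arc_whole) hC]].
set e := (32 * (C + 1))^-1.
have e0 : 0 < e by rewrite invr_gt0 mulr_gt0// addr_gt0.
have e1 : e <= 1 by rewrite invf_le1; move: C0; clear; lra.
have C0' : (0 <= C%:E)%E by rewrite lee_fin ltW.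
have hi : (ess_inf_on (carleson whole_arc) w <= e%:E)%E.
  apply: (@ess_inf_on_le _ _ (annulus (1 - e) 1)); first exact: measurable_annulus.
  - by apply: area_near_boundary_gt0; rewrite e0 e1.
  - by rewrite carleson_whole => z [].
  - by move=> z [_ h _]; rewrite lee_fin /bdist; lra.
have := le_trans (lo _ is_arc_whole) (le_trans hC (lee_wpmul2l C0' hi)).
rewrite arclen_whole -EFinM lee_fin /e ler_pdivlMr ?mulr_gt0 ?addr_gt0//.
by move: C0; clear; lra.
Qed.

End boundary_distance.

(** * The table of implications *)

(** All that matters about the reading of B_p is that it lies between the intersection
    and the union, because the false implications hold for the extreme ones. *)
Lemma bigcap_sub_reading (R : realType) (X : set (plane R -> \bar R)) :
  Bp_reading X -> bigcap_Bp `<=` X /\ X `<=` bigcup_Bp.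
Proof.
have p2 : (1 : R) < 2 by rewrite ltr1n.
case=> [[p p1 ->]|->|->]; split => // w h.
- exact: h.
- by exists p.
- by exists 2 => //; exact: h.
- by exists 2 => //; exact: h.
Qed.

Theorem theorem1p3 (R : realType) :
  ((@B1 R) `<=` bigcap_Bp /\
   (@bigcup_Bp R) `<=` RJ /\
   (@RJ R) `<=` Binfty /\
   (@RH R) `<=` Binfty) /\
  (~ ((@B1 R) `<=` RH) /\
   ~ ((@RH R) `<=` RJ) /\
   ~ ((@RJ R) `&` RH `<=` bigcup_Bp) /\
   ~ ((@B1 R) `&` RH `<=` AC) /\
   ~ ((@RH R) `&` bigcap_Bp `<=` B1) /\
   ~ ((@AC R) `&` Binfty `<=` B1) /\
   ~ ((@AC R) `<=` Binfty)) /\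
  (forall X : set (plane R -> \bar R), Bp_reading X ->
   forall P Q : property, P <> Q ->
     (class_of X P `<=` class_of X Q <->
      clos_trans property basic_implication P Q)).
Proof.
have s1 : (@B1 R) `<=` bigcap_Bp by move=> w wB p p1; exact: B1_sub_Bp.
have s2 : (@bigcup_Bp R) `<=` RJ by move=> w [p p1 wp]; exact: Bp_sub_RJ wp.
have s3 := @RJ_sub_Binfty R; have s4 := @RH_sub_Binfty R.
have n1 := @B1_not_RH R; have n2 := @RH_not_RJ R; have n3 := @RJ_RH_not_Bp R.
have n4 := @B1_RH_not_AC R; have n5 := @RH_Bp_not_B1 R.
have n6 := @AC_Binfty_not_B1 R; have n7 := @AC_not_Binfty R.
split; first exact (conj s1 (conj s2 (conj s3 s4))).
split; first exact (conj n1 (conj n2 (conj n3 (conj n4 (conj n5 (conj n6 n7)))))).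
move=> X /bigcap_sub_reading [cX Xc] P Q PQ; split; last first.
  elim=> {PQ P Q} [P Q|P Q S _ PQ _ QS]; last exact: subset_trans PQ QS.
  case=> /=; [exact: subset_trans cX|exact: subset_trans Xc s2|exact: s3|exact: s4].
have t1 := t_step _ _ _ _ Defs.B1_Bp; have t2 := t_step _ _ _ _ Defs.Bp_RJ.
have t3 := t_step _ _ _ _ Defs.RJ_Binfty; have t4 := t_step _ _ _ _ Defs.RH_Binfty.
have t23 := t_trans _ _ _ _ _ t2 t3; have t12 := t_trans _ _ _ _ _ t1 t2.
have t13 := t_trans _ _ _ _ _ t1 t23.
have B1X := subset_trans s1 cX; have XJ := subset_trans Xc s2.
have B1J := subset_trans B1X XJ.
have HN_AC (Y : set (plane R -> \bar R)) : B1 `<=` Y -> ~ (Y `<=` AC).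
  by move=> BY YA; apply: n4 => w [wB _]; apply/YA/BY.
have HN_RH (Y : set (plane R -> \bar R)) : B1 `<=` Y -> ~ (Y `<=` RH).
  by move=> BY YH; apply: n1; exact: subset_trans YH.
have HN_J (Y Z : set (plane R -> \bar R)) : RH `<=` Y -> Z `<=` RJ -> ~ (Y `<=` Z).
  by move=> HY ZJ YZ; apply: n2; exact: subset_trans HY (subset_trans YZ ZJ).
have JN_X (Z : set (plane R -> \bar R)) : Z `<=` bigcup_Bp -> ~ (RJ `<=` Z).
  by move=> Zc JZ; apply: n3 => w [wJ _]; apply/Zc/JZ.
have AN (Z : set (plane R -> \bar R)) : Z `<=` Binfty -> ~ (AC `<=` Z).
  by move=> ZI AZ; apply: n7; exact: subset_trans ZI.
have B1I := subset_trans B1J s3; have XI := subset_trans XJ s3.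
have B1c := subset_trans B1X Xc.
case: P PQ; case: Q => PQ; try by case: (PQ erefl).
(* Sources are taken in the order B_1, B_p, B_infty, RH, RJ, AC, and so are the
   targets of each source. *)
- by move=> _; exact: t1.
- by move=> _; exact: t13.
- by move/n1.
- by move=> _; exact: t12.
- by move/(HN_AC _ (@subset_refl _ _)).
- by move=> XB; case: n5 => w [_ wc]; apply/XB/cX.
- by move=> _; exact: t23.
- by move/(HN_RH _ B1X).
- by move=> _; exact: t2.
- by move/(HN_AC _ B1X).
- by move/(HN_J _ _ s4 B1J).
- by move/(HN_J _ _ s4 XJ).
- by move/(HN_RH _ B1I).
- by move/(HN_J _ _ s4 (@subset_refl _ _)).
- by move/(HN_AC _ B1I).
- by move/(HN_J _ _ (@subset_refl _ _) B1J).
- by move/(HN_J _ _ (@subset_refl _ _) XJ).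
- by move=> _; exact: t4.
- by move/n2.
- by move=> HA; case: n4 => w [_ wH]; exact: HA.
- by move/(JN_X _ B1c).
- by move/(JN_X _ Xc).
- by move=> _; exact: t3.
- by move/(HN_RH _ B1J).
- by move/(HN_AC _ B1J).
- by move/(AN _ B1I).
- by move/(AN _ XI).
- by move/n7.
- by move/(AN _ s4).
- by move/(AN _ s3).
Qed.
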